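(* Let $\bar\nu_\varepsilon$ be the multimarginal Schrödinger barycenter and $\hat\nu^N_\varepsilon$ the empirical multimarginal Schrödinger barycenter. Let $\beta>0$, $L>0$ and $\mathcal H=\mathcal H([-1,1]^d;\beta,L)$. There exists a constant $C>0$ depending only on $m,\varepsilon,\beta$ and $d$ such that for all $N\ge2$ $$\mathbb E\sup_{h\in\mathcal H}|(\bar\nu_\varepsilon-\hat\nu^N_\varepsilon)(h)|\le\begin{cases}CLN^{-1/2}&\text{if } d<2\beta,\\ CLN^{-1/2}\log N&\text{if } d=2\beta,\\ CLN^{-\beta/d}&\text{if } d>2\beta.\end{cases}$$ In particular, for $p=1,2$, $$\mathbb E[W_p^p(\bar\nu_\varepsilon,\hat\nu^N_\varepsilon)]\le\begin{cases}CN^{-1/2}&\text{if } d<2p,\\ CN^{-1/2}\log N&\text{if } d=2p,\\ CN^{-p/d}&\text{if } d>2p,\end{cases}$$ for some constant $C>0$ depending only on $m,\varepsilon,d$.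
   Context: Fix integers $m\ge2$, $d\ge1$, $\varepsilon>0$ and weights $\alpha=(\alpha_1,\dots,\alpha_m)$ with $\alpha_j\ge0$, $\sum_j\alpha_j=1$. For $j\in[m]:=\{1,\dots,m\}$, $\mathcal X_j\subset[-1,1]^d$ is compact with non-empty interior and $\nu_j$ is a Borel probability measure on $\mathcal X_j$; $\mathcal X=\prod_j\mathcal X_j$. Let $c_\alpha(x_1,\dots,x_m)=\sum_{1\le i<j\le m}|\alpha_ix_i-\alpha_jx_j|^2$, $T_\alpha(x_1,\dots,x_m)=\sum_{j=1}^m\alpha_jx_j$, and, with $\Pi(\mu_1,\dots,\mu_m)$ the set of couplings and $\mathrm{KL}$ relative entropy, $$S_{\alpha,\varepsilon}(\mu_1,\dots,\mu_m)=\inf_{\pi\in\Pi(\mu_1,\dots,\mu_m)}\int_{\mathcal X}c_\alpha\,d\pi+\varepsilon\,\mathrm{KL}(\pi\|\otimes_k\mu_k).$$ The multimarginal Schrödinger barycenter (MSB) is $\bar\nu_\varepsilon=(T_\alpha)_\sharp\pi^*_\varepsilon$ (pushforward), where $\pi_\varepsilon^*$ is the unique minimizer of $S_{\alpha,\varepsilon}(\nu_1,\dots,\nu_m)$. For each $j$ let $X^{(j)}_1,\dots,X^{(j)}_N$ be i.i.d. from $\nu_j$, the $m$ samples being independent, and $\hat\nu_j^N=\frac1N\sum_k\delta_{X^{(j)}_k}$. The empirical MSB is $\hat\nu^N_\varepsilon=(T_\alpha)_\sharp\hat\pi^N_\varepsilon$, with $\hat\pi^N_\varepsilon$ the unique minimizer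 of $S_{\alpha,\varepsilon}(\hat\nu^N_1,\dots,\hat\nu^N_m)$. For a (signed) measure $\mu$, $\mu(h)=\int h\,d\mu$. The cost (hence $\alpha$) is regarded as fixed. The Hölder class $\mathcal H(\Omega;\beta,L)$ is the set of $f:\Omega\to\mathbb R$ with $$\|f\|_\beta:=\max_{|k|\le\lfloor\beta\rfloor}\sup_{x\in\Omega}|D^kf(x)|+\max_{|k|=\lfloor\beta\rfloor}\sup_{x\ne y\in\Omega}\frac{|D^kf(x)-D^kf(y)|}{\|x-y\|^{\beta-\lfloor\beta\rfloor}}\le L,$$ where $k$ ranges over multi-indices and $\lfloor\beta\rfloor$ is the largest integer strictly smaller than $\beta$. $W_p$ is the $p$-Wasserstein distance with respect to the Euclidean distance: $W_p^p(\mu,\nu)=\inf_{\gamma\in\Pi(\mu,\nu)}\int\|x-y\|^pd\gamma(x,y)$. *)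

(* Defs.v *)
From HB Require Import structures.
From mathcomp Require Import all_boot all_order all_algebra.
From mathcomp Require Import all_classical all_reals all_analysis measurable_realfun.

Set Implicit Arguments.
Unset Strict Implicit.
Unset Printing Implicit Defensive.

Import Order.TTheory GRing.Theory Num.Theory.
Import numFieldNormedType.Exports.

Local Open Scope classical_set_scope.
Local Open Scope ring_scope.

(* R^d is 'rV[R]_d with the Borel sigma-algebra of the library topology (the
   usual one). The library norm `|x| on 'rV[R]_d is the sup norm, hence the
   separate Euclidean norm [enorm] below. *)
Definition borel_display : measure_display. Proof. exact. Qed.

Section borel_matrix.
Context (R : realType) (p q : nat).
Let O : set (set 'M[R]_(p, q)) := open.

HB.instance Definition _ := @isMeasurable.Build borel_display
  'M[R]_(p, q) <<s O >> (@sigma_algebra0 _ setT O) (@sigma_algebraC _ O)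
  (@sigma_algebra_bigcup _ setT O).

Lemma measurable_coord i j :
  measurable_fun [set: 'M[R]_(p, q)] (fun M : 'M[R]_(p, q) => M i j).
Proof.
apply: (measurability _ (RGenOpens.measurableE R)).
move=> _ [_ [a [b ->] <-]]; rewrite setTI.
apply: sub_sigma_algebra; apply: open_comp; last exact: interval_open.
by move=> M _; exact: coord_continuous.
Qed.

Lemma measurable_fun_mx d (T : measurableType d) (f : T -> 'M[R]_(p, q)) :
  (forall i j, measurable_fun [set: T] (fun t => f t i j)) ->
  measurable_fun [set: T] f.
Proof.
move=> mf; apply: (measurability O) => //.
move=> _ [U oU <-]; rewrite setTI.
pose B (Ae : 'M[rat]_(p, q) * rat) : set 'M[R]_(p, q) :=
  [set M | forall i j, `|ratr (Ae.1 i j) - M i j| < ratr Ae.2].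
pose F (Ae : 'M[rat]_(p, q) * rat) : set T :=
  if `[< B Ae `<=` U >] then f @^-1` B Ae else set0.
have -> : f @^-1` U = \bigcup_Ae F Ae.
  apply/seteqP; split=> [t /= Uft|t [Ae _]]; last first.
    by rewrite /F; case: asboolP => // BU ?; exact: BU.
  have /nbhs_ballP[e /= e0 eU] : nbhs (f t) U by exact: open_nbhs_nbhs.
  have [r] := rat_in_itvoo (divr_gt0 e0 (ltr0Sn _ 1)).
  rewrite in_itv/= => /andP[r0 re].
  have hq i j : exists q : rat, `|ratr q - f t i j| < ratr r.
    have : f t i j - ratr r < f t i j + ratr r.
      by rewrite ltrBlDr -addrA ltrDl addr_gt0.
    move=> /rat_in_itvoo[s]; rewrite in_itv/= => /andP[s1 s2].
    by exists s; rewrite ltr_norml ltrBrDr ltrBlDr addrC s1 addrC.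
  exists (\matrix_(i, j) sval (cid (hq i j)), r) => //.
  rewrite /F; case: asboolP => [_|[]] /=.
    by move=> i j /=; rewrite mxE; case: cid.
  move=> M BM; apply: eU; split=> // i j.
  rewrite /ball/=; have := BM i j; rewrite /= mxE.
  case: cid => s /= s1 s2.
  rewrite -(subrKA (ratr s)) (splitr e) (le_lt_trans (ler_normD _ _))//.
  by rewrite ltrD// (lt_trans _ re)// distrC.
apply: countable_bigcupT_measurable => [|Ae]; first exact: countableP.
rewrite /F; case: ifP => // _.
rewrite (_ : _ @^-1` _ = \bigcap_(ij in [set: 'I_p * 'I_q])
   (fun t => f t ij.1 ij.2) @^-1`
     `](ratr (Ae.1 ij.1 ij.2) - ratr Ae.2), (ratr (Ae.1 ij.1 ij.2) + ratr Ae.2)[).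
  apply: fin_bigcap_measurable; first exact: finite_finset.
  by move=> ij _; rewrite -[_ @^-1` _]setTI; exact: mf.
apply/seteqP; split=> t /= Bt.
  move=> ij _ /=; have := Bt ij.1 ij.2.
  by rewrite in_itv/= distrC -ltr_distl.
move=> i j; have := Bt (i, j) Logic.I => /=.
by rewrite in_itv/= distrC -ltr_distl.
Qed.

End borel_matrix.

Section product_probability.
Local Open Scope ereal_scope.
Context d1 d2 (T1 : measurableType d1) (T2 : measurableType d2) (R : realType).
Variables (P1 : probability T1 R) (P2 : probability T2 R).

Definition product_prob : set (T1 * T2) -> \bar R := P1 \x P2.

HB.instance Definition _ := Measure.on product_prob.

Let product_prob_setT : product_prob setT = 1.
Proof.
rewrite -setXTT [LHS]product_measure1E//.
by rewrite [X in X * _]probability_setT [X in _ * X]probability_setT mule1.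
Qed.

HB.instance Definition _ :=
  Measure_isProbability.Build _ _ _ product_prob product_prob_setT.

End product_probability.

Section tensor.
Context dT (T : measurableType dT) (R : realType).

Definition tuple_cons n (x : T * n.-tuple T) : n.+1.-tuple T :=
  [the n.+1.-tuple T of x.1 :: x.2].

Let measurable_tuple_cons n : measurable_fun [set: T * n.-tuple T] (@tuple_cons n).
Proof. exact: measurable_cons. Qed.

HB.instance Definition _ n :=
  isMeasurableFun.Build _ _ _ _ (@tuple_cons n) (@measurable_tuple_cons n).

Fixpoint tensor n : ('I_n -> probability T R) -> probability (n.-tuple T) R :=
  match n with
  | 0 => fun=> \d_[tuple]
  | n'.+1 => fun mu =>
      distribution (product_prob (mu ord0) (tensor (fun i => mu (lift ord0 i))))
        (@tuple_cons n')
  end.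

End tensor.

Section empirical.
Local Open Scope ereal_scope.
Context dT (T : measurableType dT) (R : realType) (N : nat) (x : 'I_N -> T).

(* The value for N = 0 only serves to make this a probability for every N. *)
Definition empirical (A : set T) : \bar R :=
  if N == 0%N then \d_point A else (N%:R^-1)%:E * \sum_(k < N) \d_(x k) A.

Let empirical0 : empirical set0 = 0.
Proof.
rewrite /empirical; case: ifP => _; first exact: measure0.
by rewrite big1 ?mule0// => k _; exact: measure0.
Qed.

Let empirical_ge0 A : 0 <= empirical A.
Proof.
rewrite /empirical; case: ifP => _; first exact: measure_ge0.
by rewrite mule_ge0// ?lee_fin ?invr_ge0//; exact: sume_ge0.
Qed.

Let empirical_sigma_additive : semi_sigma_additive empirical.
Proof.
move=> F mF tF mUF; rewrite /empirical; case: ifP => _.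
  exact: measure_semi_sigma_additive.
pose S (A : set T) : \bar R := \sum_(k < N) \d_(x k) A.
rewrite (_ : (fun _ => _) = (fun n => (N%:R^-1)%:E * \sum_(0 <= i < n) S (F i))).
  apply: cvgeZl => //.
  rewrite [X in _ --> X](_ : _ = lim ((fun n => \sum_(0 <= i < n) S (F i)) @ \oo)).
    by apply: is_cvg_ereal_nneg_natsum => k _; exact: sume_ge0.
  rewrite nneseries_sum//; apply: eq_bigr => /= i _.
  exact: measure_semi_bigcup.
apply/funext => n; rewrite ge0_sume_distrr// => i _; exact: sume_ge0.
Qed.

HB.instance Definition _ := isMeasure.Build _ _ _ empirical
  empirical0 empirical_ge0 empirical_sigma_additive.

Let empirical_setT : empirical setT = 1.
Proof.
rewrite /empirical; case: ifPn => [_|N0]; first exact: diracT.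
under eq_bigr do rewrite diracT.
by rewrite sumEFin -EFinM big_const_ord iter_addr_0 mulVf// pnatr_eq0.
Qed.

HB.instance Definition _ :=
  Measure_isProbability.Build _ _ _ empirical empirical_setT.

End empirical.

Section independence.
Context dO dT (Omega : measurableType dO) (T : measurableType dT) (R : realType).
Local Open Scope ereal_scope.

Definition mutually_independent (P : probability Omega R) (I : finType)
    (X : I -> {RV P >-> T}) : Prop :=
  forall (J : {set I}) (A : I -> set T),
    (forall i, i \in J -> measurable (A i)) ->
    P (\bigcap_(i in [set` J]) X i @^-1` A i) =
    \prod_(i in J) P (X i @^-1` A i).

(* An array of N samples for each j: entries are identically distributed within
   a row, and independent both within and across rows. *)
Definition independent_samples (P : probability Omega R) (m N : nat)
    (nu : 'I_m -> probability T R) (X : 'I_m -> 'I_N -> {RV P >-> T}) : Prop :=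
  (forall j k A, measurable A -> distribution P (X j k) A = nu j A) /\
  mutually_independent (fun jk : 'I_m * 'I_N => X jk.1 jk.2).

End independence.

Section relative_entropy.
Context dT (T : measurableType dT) (R : realType).
Local Open Scope ereal_scope.
Local Open Scope charge_scope.

Definition KL (P Q : probability T R) : \bar R :=
  if `[< P `<< Q >]
  then \int[P]_x lne (('d (charge_of_finite_measure P) '/d Q) x)
  else +oo.

End relative_entropy.

Section euclidean.
Context (R : realType) (d : nat).

Definition enorm (x : 'rV[R]_d) : R := Num.sqrt (\sum_(i < d) x 0 i ^+ 2).

Definition cube : set 'rV[R]_d := [set x | forall i, -1 <= x 0 i <= 1].

Definition wasserstein_couplings (mu nu : probability 'rV[R]_d R) :
    set (probability ('rV[R]_d * 'rV[R]_d)%type R) :=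
  [set gamma | forall A : set 'rV[R]_d, measurable A ->
     gamma (fst @^-1` A) = mu A /\ gamma (snd @^-1` A) = nu A].

(* W_p^p rather than W_p. *)
Definition wasserstein_pow (p : nat) (mu nu : probability 'rV[R]_d R) : \bar R :=
  ereal_inf [set (\int[gamma]_z (enorm (z.1 - z.2) ^+ p)%:E)%E
            | gamma in wasserstein_couplings mu nu].

End euclidean.

Section schroedinger_barycenter.
Context (R : realType) (m d : nat) (alpha : 'I_m -> R).
Local Notation X := (m.-tuple 'rV[R]_d).

Definition cost (x : X) : R :=
  \sum_(i < m) \sum_(j < m | (i < j)%N)
    enorm (alpha i *: tnth x i - alpha j *: tnth x j) ^+ 2.

Definition average (x : X) : 'rV[R]_d := \sum_(j < m) alpha j *: tnth x j.

Let measurable_average : measurable_fun [set: X] average.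
Proof.
apply: measurable_fun_mx => i j.
rewrite (_ : (fun _ => _) = fun x : X => \sum_(k < m) alpha k * tnth x k i j).
  apply: measurable_sum => k; apply: measurable_funM => //.
  apply: (measurableT_comp (measurable_coord i j)); exact: measurable_tnth.
by apply/funext => x; rewrite summxE; apply: eq_bigr => k _; rewrite mxE.
Qed.

HB.instance Definition _ :=
  isMeasurableFun.Build _ _ _ _ average measurable_average.

Definition couplings (mu : 'I_m -> probability 'rV[R]_d R) :
    set (probability X R) :=
  [set pi | forall j (A : set 'rV[R]_d), measurable A ->
     pi ((fun x : X => tnth x j) @^-1` A) = mu j A].

Definition entropic_cost (eps : R) (mu : 'I_m -> probability 'rV[R]_d R)
    (pi : probability X R) : \bar R :=
  (\int[pi]_x (cost x)%:E + eps%:E * KL pi (tensor mu))%E.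

Definition schroedinger_value (eps : R) (mu : 'I_m -> probability 'rV[R]_d R) :
    \bar R :=
  ereal_inf [set entropic_cost eps mu pi | pi in couplings mu].

(* The minimizer exists and is unique when the mu j have compact support. *)
Definition schroedinger_plan (eps : R) (mu : 'I_m -> probability 'rV[R]_d R) :
    probability X R :=
  get [set pi | couplings mu pi /\
                entropic_cost eps mu pi = schroedinger_value eps mu].

Definition MSB (eps : R) (mu : 'I_m -> probability 'rV[R]_d R) :
    probability 'rV[R]_d R :=
  distribution (schroedinger_plan eps mu) average.

End schroedinger_barycenter.

Section hoelder.
Context (R : realType) (d : nat) (D : set 'rV[R]_d).
Implicit Types f : 'rV[R]_d -> R.

Definition partial_quotient (i : 'I_d) f (x : 'rV[R]_d) (t : R) : R :=
  t^-1 * (f (x + t *: delta_mx 0 i) - f x).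

(* Only increments that stay in D are used, so that the derivative depends only
   on the restriction of f to D and is one-sided at boundary points. *)
Definition partial_filter (i : 'I_d) (x : 'rV[R]_d) : set_system R :=
  within [set t | D (x + t *: delta_mx 0 i)] 0^'.

Definition partial (i : 'I_d) f (x : 'rV[R]_d) : R :=
  lim (partial_quotient i f x @ partial_filter i x).

Fixpoint class_C (n : nat) f : Prop :=
  {within D, continuous f} /\
  if n is n'.+1 then
    forall i, (forall x, D x -> cvg (partial_quotient i f x @ partial_filter i x))
              /\ class_C n' (partial i f)
  else True.

Definition morder (k : 'I_d -> nat) : nat := \sum_(i < d) k i.

Definition mderiv (k : 'I_d -> nat) f : 'rV[R]_d -> R :=
  foldr (fun i g => iter (k i) (partial i) g) f (enum 'I_d).

(* The largest integer strictly smaller than beta, for beta > 0. *)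
Definition strict_floor (beta : R) : nat := `|Num.ceil beta|%N.-1.

Definition hoelder_norm (beta : R) f : \bar R :=
  (ereal_sup [set ereal_sup [set `|mderiv k f x|%:E | x in D]
             | k in [set k | (morder k <= strict_floor beta)%N]]
  + ereal_sup [set ereal_sup
        [set (`|mderiv k f xy.1 - mderiv k f xy.2| /
              enorm (xy.1 - xy.2) `^ (beta - (strict_floor beta)%:R))%:E
        | xy in [set xy | D xy.1 /\ D xy.2 /\ xy.1 <> xy.2]]
      | k in [set k | morder k = strict_floor beta]])%E.

Definition hoelder_class (beta L : R) : set ('rV[R]_d -> R) :=
  [set f | class_C (strict_floor beta) f /\ (hoelder_norm beta f <= L%:E)%E].

End hoelder.

Definition rate (R : realType) (d : nat) (beta : R) (N : nat) : R :=
  if d%:R < 2 * beta then N%:R `^ (- (1 / 2))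
  else if d%:R == 2 * beta then N%:R `^ (- (1 / 2)) * ln N%:R
  else N%:R `^ (- (beta / d%:R)).

(* Main.v *)
Require Import Defs.
From HB Require Import structures.
From mathcomp Require Import all_boot all_order all_algebra.
From mathcomp Require Import all_classical all_reals all_analysis.
From mathcomp Require Import measurable_realfun qpoly.
From mathcomp Require Import ring lra zify.

(** The minimizer of the entropic problem has a density [K * expR (t + sum g_j)]
    with respect to the product of the marginals, where [K] is the exponential of
    minus the cost over [eps] and the potentials [g_j] solve the Schroedinger
    system: all marginal densities are equal to one. Since the cost is bounded on
    the cube, such potentials exist with a bound that depends only on [m], [d] and
    [eps] ([schroedinger_system_solvable]): the dual problem is uniformly concave
    in the sum of the potentials, so a maximizing sequence converges, and updating
    one potential of the limit cannot increase the dual. Gibbs' inequality then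
    identifies the plan ([schroedinger_plan_gibbs]).

    An integral against the barycenter is thus an integral against the product of
    the marginals with a bounded density ([int_MSB]). Passing to the samples has
    two effects. The product of the empirical measures fluctuates around the
    product of the marginals; as an average over index tuples, most pairs of which
    are independent, it does so with variance of order [1 / N] ([sqr_deviation]).
    And the density changes; by strong convexity this change is at most the amount
    by which the population potentials violate the empirical marginal constraints
    ([potential_stability]), which is an average of the same kind
    ([sqr_deviation_slice]). In total, a family of [n] test functions whose
    absolute values add up to a bounded function has expected total error of order
    [sqrt (n / N)] ([family_deviation]).

    Both claims reduce to such families, one for each dyadic scale. A Hoelder
    function is the telescoping sum of its piecewise polynomial interpolants on
    dyadic cells of side [2 ^ - l]; the increments have coefficients of order
    [2 ^ (- l * beta)] with respect to test functions that do not depend on it, one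
    bounded number for each of the [2 ^ (l * d)] cells ([hoelder_multiscale]). For
    the Wasserstein distance, a coupling that matches mass inside the smallest cells
    first moves mass over a distance [2 ^ - l] only to the extent that the two
    measures differ on the cells of the next level ([wasserstein_multiscale]). In
    both cases the error is the sum over scales of
    [2 ^ (- l * beta) * sqrt (2 ^ (l * d) / N)], stopped when the cells number about
    [N], and the three regimes are those of this geometric series ([rate_bound]).

    The random quantities of the theorem need not be measurable in the sample; they
    are dominated outside a null event by bounded measurable functions, which is
    enough for the integral ([integral_le_ae]). *)

Set Implicit Arguments.
Unset Strict Implicit.
Unset Printing Implicit Defensive.

Import Order.TTheory GRing.Theory Num.Theory.
Import numFieldNormedType.Exports.

Local Open Scope classical_set_scope.
Local Open Scope ring_scope.

(** * Bounded measurable functions *)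

(** Every function integrated below is bounded, so this one closure property
    stands in for all integrability conditions. *)
Definition bounded_measurable d (T : measurableType d) (R : realType) (f : T -> R) :=
  measurable_fun setT f /\ exists M, forall x, `|f x| <= M.
Notation bm := bounded_measurable.

Lemma sqr_le_norm (R : realType) (x M : R) : `|x| <= M -> x ^+ 2 <= M ^+ 2.
Proof.
move=> h; rewrite -[x ^+ 2]real_normK ?num_real//.
by rewrite lerXn2r ?nnegrE// (le_trans _ h).
Qed.

Lemma measurable_pre d1 d2 (T1 : measurableType d1) (T2 : measurableType d2)
    (f : T1 -> T2) (A : set T2) :
  measurable_fun setT f -> measurable A -> measurable (f @^-1` A).
Proof. by move=> mf mA; rewrite -[_ @^-1` _]setTI; exact: mf. Qed.

Section bounded_measurable_closure.
Context d (T : measurableType d) (R : realType).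
Implicit Types f g : T -> R.

Lemma bm_meas f : bm f -> measurable_fun setT f. Proof. by case. Qed.

Lemma bmI f M : measurable_fun setT f -> (forall x, `|f x| <= M) -> bm f.
Proof. by move=> mf fM; split=> //; exists M. Qed.

Lemma bm_cst c : bm (fun _ : T => c : R).
Proof. by apply: (@bmI _ `|c|) => //; exact: measurable_cst. Qed.

Lemma bmD f g : bm f -> bm g -> bm (fun x => f x + g x).
Proof.
move=> [mf [M fM]] [mg [N gN]]; apply: (@bmI _ (M + N)).
  exact: measurable_funD.
by move=> x; rewrite (le_trans (ler_normD _ _))// lerD.
Qed.

Lemma bmM f g : bm f -> bm g -> bm (fun x => f x * g x).
Proof.
move=> [mf [M fM]] [mg [N gN]]; apply: (@bmI _ (M * N)).
  exact: measurable_funM.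
by move=> x; rewrite normrM ler_pM.
Qed.

Lemma bmZ c f : bm f -> bm (fun x => c * f x).
Proof. by move=> bf; apply: bmM => //; exact: bm_cst. Qed.

Lemma bmN f : bm f -> bm (fun x => - f x).
Proof. by move=> bf; under eq_fun do rewrite -mulN1r; exact: bmZ. Qed.

Lemma bmB f g : bm f -> bm g -> bm (fun x => f x - g x).
Proof. by move=> bf bg; apply: bmD => //; exact: bmN. Qed.

Lemma bmX f n : bm f -> bm (fun x => f x ^+ n).
Proof.
move=> bf; elim: n => [|n IH]; first exact: bm_cst.
by under eq_fun do rewrite exprS; exact: bmM.
Qed.

Lemma bm_norm f : bm f -> bm (fun x => `|f x|).
Proof.
move=> [mf [M fM]]; apply: (@bmI _ M); last by move=> x; rewrite normr_id.
exact: measurableT_comp.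
Qed.

Lemma bm_sum (I : Type) (s : seq I) (P : pred I) (f : I -> T -> R) :
  (forall i, bm (f i)) -> bm (fun x => \sum_(i <- s | P i) f i x).
Proof.
move=> bf; elim: s => [|i s IH].
  by under eq_fun do rewrite big_nil; exact: bm_cst.
under eq_fun do rewrite big_cons.
by case: (P i) => //; apply: bmD.
Qed.

Lemma bm_indic (A : set T) : measurable A -> bm (\1_A : T -> R).
Proof.
move=> mA; apply: (@bmI _ 1); first exact: measurable_indic.
by move=> x; rewrite indicE; case: (x \in A); rewrite ?normr1 ?normr0.
Qed.

Lemma bm_comp d' (T' : measurableType d') (f : T -> R) (h : T' -> T) :
  bm f -> measurable_fun setT h -> bm (fun x => f (h x)).
Proof.
move=> [mf [M fM]] mh; split; last by exists M.
exact: (measurableT_comp mf mh).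
Qed.

Lemma bm_expR f : bm f -> bm (fun x => expR (f x)).
Proof.
move=> [mf [M fM]]; apply: (@bmI _ (expR M)).
  exact: (measurableT_comp (@measurable_expR R) mf).
by move=> x; rewrite ger0_norm ?expR_ge0// ler_expR (le_trans (ler_norm _)).
Qed.

Lemma bm_ln f c : 0 < c -> (forall x, c <= f x) -> bm f -> bm (fun x => ln (f x)).
Proof.
move=> c0 cf [mf [M fM]]; apply: (@bmI _ (Num.max (ln M) (- ln c))).
  exact: (measurableT_comp (@measurable_ln R) mf).
move=> x; have f0 : 0 < f x by exact: lt_le_trans (cf x).
have fxM : f x <= M by rewrite (le_trans (ler_norm _)).
rewrite le_max ler_norml; case: (lerP 0 (ln (f x))) => h.
  apply/orP; left; rewrite ler_ln ?posrE ?fxM ?(lt_le_trans f0)//.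
  rewrite andbT (le_trans _ h)// oppr_le0 (le_trans h)// ler_ln ?posrE//.
  exact: lt_le_trans f0 fxM.
apply/orP; right; rewrite ler_norml opprK ler_ln ?posrE// cf/=.
by rewrite (le_trans (ltW h))// oppr_ge0 (le_trans _ (ltW h))// ler_ln ?posrE.
Qed.

Variable mu : probability T R.

Lemma bm_integrable f : bm f -> mu.-integrable setT (EFin \o f).
Proof.
move=> [mf [M fM]]; apply: (@le_integrable _ _ _ _ _ measurableT _ (fun=> M%:E)).
- exact/measurable_EFinP.
- by move=> x _ /=; rewrite lee_fin (le_trans (fM x))// ler_norm.
- exact: finite_measure_integrable_cst.
Qed.

Lemma intE f : bm f -> (\int[mu]_x f x)%:E = (\int[mu]_x (f x)%:E)%E.
Proof.
move=> bf; rewrite /Rintegral fineK//; apply: integrable_fin_num => //.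
exact: bm_integrable.
Qed.

Lemma intD f g : bm f -> bm g ->
  \int[mu]_x (f x + g x) = \int[mu]_x f x + \int[mu]_x g x.
Proof. by move=> bf bg; rewrite RintegralD//; exact: bm_integrable. Qed.

Lemma intB f g : bm f -> bm g ->
  \int[mu]_x (f x - g x) = \int[mu]_x f x - \int[mu]_x g x.
Proof. by move=> bf bg; rewrite RintegralB//; exact: bm_integrable. Qed.

Lemma intZ c f : bm f -> \int[mu]_x (c * f x) = c * \int[mu]_x f x.
Proof. by move=> bf; rewrite RintegralZl//; exact: bm_integrable. Qed.

Lemma int_cst c : \int[mu]_x c = c.
Proof. rewrite Rintegral_cst// -[RHS]mulr1; congr (_ * _).
exact: (congr1 fine (probability_setT mu)). Qed.

Lemma le_int f g : bm f -> bm g -> (forall x, f x <= g x) ->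
  \int[mu]_x f x <= \int[mu]_x g x.
Proof. by move=> bf bg fg; apply: le_Rintegral => //; exact: bm_integrable. Qed.

Lemma int_ge0 f : (forall x, 0 <= f x) -> 0 <= \int[mu]_x f x.
Proof. by move=> f0; exact: Rintegral_ge0. Qed.

Lemma le_norm_int f : bm f -> `|\int[mu]_x f x| <= \int[mu]_x `|f x|.
Proof. by move=> bf; apply: le_normr_Rintegral => //; exact: bm_integrable. Qed.

Lemma int_sum (I : Type) (s : seq I) (P : pred I) (f : I -> T -> R) :
  (forall i, bm (f i)) ->
  \int[mu]_x (\sum_(i <- s | P i) f i x) = \sum_(i <- s | P i) \int[mu]_x f i x.
Proof.
move=> bf; elim: s => [|i s IH].
  by under eq_Rintegral do rewrite big_nil; rewrite big_nil int_cst.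
under eq_Rintegral do rewrite big_cons.
rewrite big_cons; case: (P i) => //.
by rewrite intD//; [rewrite IH|exact: bm_sum].
Qed.

Lemma int_bound f M : bm f -> (forall x, `|f x| <= M) -> `|\int[mu]_x f x| <= M.
Proof.
move=> bf fM; rewrite (le_trans (le_norm_int bf))// -[leRHS]int_cst.
by apply: le_int => //; [exact: bm_norm|exact: bm_cst].
Qed.

Lemma le_int_cst f c : bm f -> (forall x, f x <= c) -> \int[mu]_x f x <= c.
Proof. by move=> bf fc; rewrite -[leRHS]int_cst; apply: le_int => //; exact: bm_cst. Qed.

Lemma ge_int_cst f c : bm f -> (forall x, c <= f x) -> c <= \int[mu]_x f x.
Proof. by move=> bf fc; rewrite -[leLHS]int_cst; apply: le_int => //; exact: bm_cst. Qed.

(** The variance formula; it gives both that centring decreases the second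
    moment and that a squared mean is at most the mean square. *)
Lemma int_sqr_centered f : bm f ->
  \int[mu]_x ((f x - \int[mu]_y f y) ^+ 2) =
  \int[mu]_x (f x ^+ 2) - (\int[mu]_x f x) ^+ 2.
Proof.
move=> bf; set a := \int[mu]_x f x.
transitivity (\int[mu]_x (f x ^+ 2 + ((- (2 * a)) * f x + a ^+ 2))).
  by apply: eq_Rintegral => x _; ring.
rewrite intD; [|exact: bmX|by apply: bmD; [exact: bmZ|exact: bm_cst]].
rewrite intD; [|exact: bmZ|exact: bm_cst].
by rewrite intZ// int_cst -/a; ring.
Qed.

Lemma sqr_int_le f : bm f -> (\int[mu]_x f x) ^+ 2 <= \int[mu]_x (f x ^+ 2).
Proof.
move=> bf; rewrite -subr_ge0 -int_sqr_centered//.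
by apply: int_ge0 => x; exact: sqr_ge0.
Qed.

Lemma int_indic (A : set T) : measurable A -> \int[mu]_x (\1_A x : R) = fine (mu A).
Proof.
by move=> mA; rewrite /Rintegral integral_indic// setIT.
Qed.

Lemma prob_int (A : set T) : measurable A -> mu A = (\int[mu]_x (\1_A x : R))%:E.
Proof. by move=> mA; rewrite int_indic// fineK// fin_num_measure. Qed.

Lemma ae_prob1 (A : set T) : measurable A -> mu A = 1%E -> {ae mu, forall x, A x}.
Proof.
move=> mA A1; exists (~` A); split => //; first exact: measurableC.
by rewrite probability_setC// A1 subee.
Qed.

Lemma ae_forall (I : finType) (Q : I -> T -> Prop) :
  (forall i, {ae mu, forall x, Q i x}) -> {ae mu, forall x, forall i, Q i x}.
Proof.
move=> h; have : {ae mu, forall x, forall i, i \in index_enum I -> Q i x}.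
  elim: (index_enum I) => [|j s IH]; first exact: aeW.
  move: IH (h j); apply: filterS2 => x Qs Qj i.
  by rewrite inE => /predU1P[->//|]; exact: Qs.
by apply: filterS => x Qx i; apply: Qx; rewrite mem_index_enum.
Qed.

Lemma int_ae f g : bm f -> bm g -> {ae mu, forall x, f x = g x} ->
  \int[mu]_x f x = \int[mu]_x g x.
Proof.
move=> bf bg fg; rewrite /Rintegral; congr fine; apply: ae_eq_integral => //.
- by apply/measurable_EFinP; case: bf.
- by apply/measurable_EFinP; case: bg.
- by apply: filterS fg => x /= -> _.
Qed.

Lemma int_eq0_ae f : bm f -> (forall x, 0 <= f x) -> \int[mu]_x f x <= 0 ->
  {ae mu, forall x, f x = 0}.
Proof.
move=> bf f0 fle; have /eqP f00 : \int[mu]_x f x == 0.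
  by rewrite eq_le fle int_ge0.
have mf : measurable_fun setT (EFin \o f) by apply/measurable_EFinP; case: bf.
have : (\int[mu]_x `|(EFin \o f) x| = 0)%E.
  under eq_integral do rewrite /= ger0_norm//.
  by rewrite -intE// f00.
move/(@ae_eq_integral_abs _ _ _ mu _ measurableT _ mf).
by apply: filterS => x /= /(_ I) [].
Qed.

End bounded_measurable_closure.

Section product_integrals.
Context d1 d2 (T1 : measurableType d1) (T2 : measurableType d2) (R : realType).
Variables (P1 : probability T1 R) (P2 : probability T2 R).

Lemma int_distribution (X : {RV P1 >-> T2}) (f : T2 -> R) : bm f ->
  \int[distribution P1 X]_y f y = \int[P1]_x f (X x).
Proof.
move=> [mf [M fM]]; rewrite /Rintegral; congr fine.
rewrite integral_pushforward//; first exact/measurable_EFinP.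
apply: (@bm_integrable _ _ _ _ (fun x => f (X x))).
by apply: (@bm_comp _ _ _ _ _ f); [split=> //; exists M|].
Qed.

Lemma bm_pair1 (f : T1 * T2 -> R) x : bm f -> bm (fun y => f (x, y)).
Proof. by move=> bf; apply: (@bm_comp _ _ _ _ _ f) => //; exact: measurable_pair1. Qed.

Lemma bm_pair2 (f : T1 * T2 -> R) y : bm f -> bm (fun x => f (x, y)).
Proof. by move=> bf; apply: (@bm_comp _ _ _ _ _ f) => //; exact: measurable_pair2. Qed.

Lemma bm_int1 (f : T1 * T2 -> R) : bm f -> bm (fun x => \int[P2]_y f (x, y)).
Proof.
move=> bf; case: (bf) => mf [M fM]; apply: (@bmI _ _ _ _ M); last first.
  by move=> x; apply: int_bound => //; exact: bm_pair1.
have /= := @measurable_fubini_F _ _ _ _ _ P1 P2 (EFin \o f).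
move=> /(_ (bm_integrable (product_prob P1 P2) bf)) mF.
apply/measurable_EFinP; apply: eq_measurable_fun mF => x _ /=.
by rewrite intE//; exact: bm_pair1.
Qed.

Lemma int_product (f : T1 * T2 -> R) : bm f ->
  \int[product_prob P1 P2]_z f z = \int[P1]_x \int[P2]_y f (x, y).
Proof.
move=> bf; apply: EFin_inj; rewrite [LHS]intE//.
have /esym := @integral12_prod_meas1 _ _ _ _ _ P1 P2 (EFin \o f)
  (bm_integrable (product_prob P1 P2) bf).
move=> /= h; apply: (eq_trans h).
rewrite intE; last exact: bm_int1.
by apply: eq_integral => x _; rewrite intE//; exact: bm_pair1.
Qed.

Lemma bm_int2 (f : T1 * T2 -> R) : bm f -> bm (fun y => \int[P1]_x f (x, y)).
Proof.
move=> bf; case: (bf) => mf [M fM]; apply: (@bmI _ _ _ _ M); last first.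
  by move=> x; apply: int_bound => //; exact: bm_pair2.
have /= := @measurable_fubini_G _ _ _ _ _ P1 P2 (EFin \o f).
move=> /(_ (bm_integrable (product_prob P1 P2) bf)) mF.
apply/measurable_EFinP; apply: eq_measurable_fun mF => x _ /=.
by rewrite intE//; exact: bm_pair2.
Qed.

Lemma int_swap (f : T1 * T2 -> R) : bm f ->
  \int[P1]_x \int[P2]_y f (x, y) = \int[P2]_y \int[P1]_x f (x, y).
Proof.
move=> bf; apply: EFin_inj; rewrite !intE; [|exact: bm_int2|exact: bm_int1].
under eq_integral do rewrite (intE P2 (bm_pair1 _ bf)).
under [RHS]eq_integral do rewrite (intE P1 (bm_pair2 _ bf)).
apply: (@Fubini _ _ _ _ _ P1 P2 (EFin \o f)).
exact: (bm_integrable (product_prob P1 P2) bf).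
Qed.

End product_integrals.

(** * Integrals over product measures *)

Section tuple_update.
Context d (T : measurableType d) (R : realType).

Definition upd n (z : n.-tuple T) (j : 'I_n) (y : T) : n.-tuple T :=
  [tuple if i == j then y else tnth z i | i < n].

Lemma tnth_upd n (z : n.-tuple T) j y i :
  tnth (upd z j y) i = if i == j then y else tnth z i.
Proof. by rewrite tnth_mktuple. Qed.

Lemma upd_upd n (z : n.-tuple T) j x y : upd (upd z j x) j y = upd z j y.
Proof. by apply: eq_from_tnth => i; rewrite !tnth_upd; case: eqP. Qed.

Lemma measurable_fun_upd d' (T' : measurableType d') n (j : 'I_n)
    (f : T' -> n.-tuple T) (g : T' -> T) :
  measurable_fun setT f -> measurable_fun setT g ->
  measurable_fun setT (fun w => upd (f w) j (g w)).
Proof.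
move=> mf mg; apply/measurable_fun_tnthP => i.
rewrite [X in measurable_fun _ X](_ : _ = if i == j then g
  else fun w => tnth (f w) i); last first.
  by apply/funext => w /=; rewrite tnth_upd; case: eqP.
case: eqP => // _.
exact: (measurableT_comp (measurable_tnth i) mf).
Qed.

Lemma tnth_cons0 n (x : T) (z : n.-tuple T) : tnth (tuple_cons (x, z)) ord0 = x.
Proof. by []. Qed.

Lemma tnth_consS n (x : T) (z : n.-tuple T) i :
  tnth (tuple_cons (x, z)) (lift ord0 i) = tnth z i.
Proof. exact: tnthS. Qed.

Lemma upd_cons0 n (x y : T) (z : n.-tuple T) :
  upd (tuple_cons (x, z)) ord0 y = tuple_cons (y, z).
Proof.
apply: eq_from_tnth => i; rewrite tnth_upd.
by case: (unliftP ord0 i) => [j ->|->]; rewrite ?eqxx ?tnth_consS//=.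
Qed.

Lemma upd_consS n (x y : T) (z : n.-tuple T) j :
  upd (tuple_cons (x, z)) (lift ord0 j) y = tuple_cons (x, upd z j y).
Proof.
apply: eq_from_tnth => i; rewrite tnth_upd.
case: (unliftP ord0 i) => [k ->|->]; last by rewrite tnth_cons0.
by rewrite !tnth_consS tnth_upd (inj_eq lift_inj).
Qed.

Lemma bm_upd n (F : n.-tuple T -> R) j : bm F ->
  bm (fun zy : n.-tuple T * T => F (upd zy.1 j zy.2)).
Proof. by move=> bF; apply: bm_comp => //; exact: measurable_fun_upd. Qed.

Lemma bm_updz n (F : n.-tuple T -> R) j y : bm F -> bm (fun z => F (upd z j y)).
Proof. by move=> bF; exact: (bm_pair2 y (bm_upd j bF)). Qed.

Lemma bm_tnth n (f : T -> R) (j : 'I_n) : bm f -> bm (fun z : n.-tuple T => f (tnth z j)).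
Proof. by move=> bf; apply: bm_comp => //; exact: measurable_tnth. Qed.

Lemma int_tensorS n (nu : 'I_n.+1 -> probability T R) (F : n.+1.-tuple T -> R) :
  bm F -> \int[tensor nu]_z F z =
    \int[nu ord0]_x \int[tensor (fun i => nu (lift ord0 i))]_z F (tuple_cons (x, z)).
Proof.
move=> bF; rewrite /= int_distribution// int_product//.
by apply: bm_comp => //; exact: measurable_funPT.
Qed.

(** One coordinate of a product measure can be integrated after all the others.
    The marginal constraints are stated through [upd], so Fubini is only ever
    used in this form, which does not depend on the order of the coordinates. *)
Lemma int_upd n (nu : 'I_n -> probability T R) (F : n.-tuple T -> R) j : bm F ->
  \int[tensor nu]_z F z = \int[nu j]_y \int[tensor nu]_z F (upd z j y).
Proof.
elim: n => [|n IH] in nu F j *; first by case: j.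
move=> bF; have bFc : bm (fun xz => F (@tuple_cons _ T n xz)).
  by apply: bm_comp => //; exact: measurable_funPT.
rewrite int_tensorS//; case: (unliftP ord0 j) => [k ->|->].
  under [LHS]eq_Rintegral => x _.
    rewrite (IH (fun i => nu (lift ord0 i)) (fun z => F (tuple_cons (x, z))) k).
      over.
    exact: (bm_pair1 x bFc).
  pose G (xy : T * T) :=
    \int[tensor (fun i => nu (lift ord0 i))]_z F (tuple_cons (xy.1, upd z k xy.2)).
  rewrite -/(\int[_]_x \int[_]_y G (x, y)).
  rewrite (@int_swap _ _ _ _ _ (nu ord0) (nu (lift ord0 k)) G); last first.
    have h := @bm_int1 _ _ (T * T)%type (n.-tuple T) R
      (product_prob (nu ord0) (nu ord0)) (tensor (fun i => nu (lift ord0 i)))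
      (fun p => F (tuple_cons (p.1.1, upd p.2 k p.1.2))).
    apply: h; apply: (@bm_comp _ _ _ _ _ (fun xz => F (@tuple_cons _ T n xz))) => //.
    apply/measurable_fun_pairP; split => /=.
      exact: (measurableT_comp measurable_fst measurable_fst).
    apply: measurable_fun_upd => //.
    exact: (measurableT_comp measurable_snd measurable_fst).
  apply: eq_Rintegral => y _; rewrite int_tensorS; last exact: bm_updz.
  by apply: eq_Rintegral => x _; apply: eq_Rintegral => z _; rewrite upd_consS.
apply: eq_Rintegral => y _; rewrite int_tensorS; last exact: bm_updz.
under [RHS]eq_Rintegral do under eq_Rintegral do rewrite upd_cons0.
by rewrite int_cst.
Qed.

Lemma bm_int_upd n (nu : 'I_n -> probability T R) (F : n.-tuple T -> R) j :
  bm F -> bm (fun y => \int[tensor nu]_z F (upd z j y)).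
Proof.
move=> bF.
exact: (@bm_int2 _ _ _ _ _ (tensor nu) (nu j) _ (bm_upd j bF)).
Qed.

Lemma int_tnth n (nu : 'I_n -> probability T R) (f : T -> R) j : bm f ->
  \int[tensor nu]_z f (tnth z j) = \int[nu j]_y f y.
Proof.
move=> bf; rewrite (int_upd nu j (bm_tnth j bf)).
apply: eq_Rintegral => y _.
by under eq_Rintegral do rewrite tnth_upd eqxx; rewrite int_cst.
Qed.

Definition box n (A : 'I_n -> set T) : set (n.-tuple T) :=
  [set z | forall i, A i (tnth z i)].

Lemma measurable_box n (A : 'I_n -> set T) :
  (forall i, measurable (A i)) -> measurable (box A).
Proof.
move=> mA; rewrite (_ : box A = \bigcap_(i in [set: 'I_n]) (fun z => tnth z i) @^-1` A i).
  apply: fin_bigcap_measurable => // i _.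
  exact: measurable_pre (measurable_tnth i) (mA i).
by apply/seteqP; split=> [z Az i _|z Az i]; [exact: Az|exact: (Az i)].
Qed.

Lemma tensor_box n (nu : 'I_n -> probability T R) (A : 'I_n -> set T) :
  (forall i, measurable (A i)) ->
  tensor nu (box A) = (\prod_(i < n) nu i (A i))%E.
Proof.
elim: n => [|n IH] in nu A *; move=> mA.
  rewrite big_ord0 /= diracE mem_set//.
  by move=> [].
rewrite big_ord_recl -IH// /=.
rewrite -product_measure1E//; last exact: measurable_box.
congr (product_prob _ _ _).
apply/seteqP; split=> [[x z] /= Az|[x z] /= [Ax Az] i].
  split; first by have := Az ord0; rewrite tnth_cons0.
  by move=> i; have := Az (lift ord0 i); rewrite tnth_consS.
by case: (unliftP ord0 i) => [k ->|->]; rewrite ?tnth_consS.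
Qed.

(** Boxes are stable under intersection, so this makes two measures on tuples
    equal as soon as they agree on boxes. *)
Lemma measurable_boxE n :
  (measurable : set (set (n.-tuple T))) =
  <<s [set B | exists2 A : 'I_n -> set T, (forall i, measurable (A i)) & B = box A] >>.
Proof.
apply/seteqP; split; last first.
  apply: smallest_sub; first exact: sigma_algebra_measurable.
  by move=> _ [A mA ->]; exact: measurable_box.
apply: smallest_sub; first exact: smallest_sigma_algebra.
move=> B; rewrite -bigcup_seq => -[i _ [A mA <-]].
apply: sub_sigma_algebra; exists (fun k => if k == i then A else setT).
  by move=> k; case: eqP.
rewrite setTI; apply/seteqP; split=> [z Az k|z /(_ i)]; first by case: eqP => [->|].
by rewrite eqxx.
Qed.

Lemma tuple_measure_unique n (m1 m2 : {measure set (n.-tuple T) -> \bar R}) :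
  (m1 setT < +oo)%E ->
  (forall A : 'I_n -> set T, (forall i, measurable (A i)) ->
     m1 (box A) = m2 (box A)) ->
  forall A, measurable A -> m1 A = m2 A.
Proof.
move=> m1oo m12 A mA.
apply: (measure_unique _ (fun=> setT) (measurable_boxE n)) => //.
- move=> _ _ [B mB ->] [C mC ->]; exists (fun i => B i `&` C i).
    by move=> i; exact: measurableI.
  apply/seteqP; split=> [z [Bz Cz] i|z BCz]; first by split; [exact: Bz|exact: Cz].
  by split=> i; have [] := BCz i.
- by move=> i; exists (fun=> setT) => //; apply/seteqP; split.
- by apply/seteqP; split => // x _; exists 0%N.
- by move=> _ [B mB ->]; exact: m12.
Qed.

End tuple_update.

Section pair_law.
Context d d' (T : measurableType d) (O : measurableType d') (R : realType).
Variables (P : probability O R) (n : nat) (X X' : {mfun O >-> n.-tuple T}).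
Variables (nu nu' : 'I_n -> probability T R).
Hypothesis XX' : forall A A' : 'I_n -> set T,
  (forall i, measurable (A i)) -> (forall i, measurable (A' i)) ->
  P (X @^-1` box A `&` X' @^-1` box A') =
  (tensor nu (box A) * tensor nu' (box A'))%E.

Let mpre (Y : {mfun O >-> n.-tuple T}) A : measurable A -> measurable (Y @^-1` A).
Proof. exact: measurable_pre (measurable_funPT Y). Qed.

Let law_restr (Y : {mfun O >-> n.-tuple T}) (B : set O) (mB : measurable B) :
  {measure set (n.-tuple T) -> \bar R} :=
  measure_function_pushforward__canonical__measure_function_Measure
    (mrestr P mB) (measurable_funPT Y).

Let law_step (Y : {mfun O >-> n.-tuple T}) (mu : 'I_n -> probability T R)
    (B : set O) (mB : measurable B) (r : R) : P B = r%:E ->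
  (forall A, (forall i, measurable (A i)) ->
     P (Y @^-1` box A `&` B) = (tensor mu (box A) * r%:E)%E) ->
  forall A, measurable A -> P (Y @^-1` A `&` B) = (tensor mu A * r%:E)%E.
Proof.
move=> PB h A mA.
have r0 : 0 <= r by rewrite -lee_fin -PB.
have h1 := @tuple_measure_unique _ _ _ n (law_restr Y mB)
  (mscale (NngNum r0) (tensor mu)).
rewrite [LHS](h1 _ _ A mA)//=.
- by rewrite /mscale/= muleC.
- rewrite /pushforward /mrestr preimage_setT setTI [X in (X < _)%E]PB.
  exact: ltry.
- by move=> C mC; rewrite /pushforward /mrestr/= h// /mscale/= muleC.
Qed.

(** Independence of samples is a statement about boxes. It extends to integrals
    of functions of both tuples by uniqueness of measures, applied to one tuple
    while the other is confined to a box, and then the other way round. *)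
Lemma pair_law (H : n.-tuple T * n.-tuple T -> R) : bm H ->
  \int[P]_w H (X w, X' w) = \int[tensor nu]_z \int[tensor nu']_z' H (z, z').
Proof.
move=> bH; rewrite -int_product//.
have mXX : measurable_fun setT (fun w => (X w, X' w)).
  by apply/measurable_fun_pairP; split; exact: measurable_funPT.
pose m' : {measure set (n.-tuple T * n.-tuple T) -> \bar R} :=
  measure_function_pushforward__canonical__measure_function_Measure P mXX.
have m'E A B : measurable A -> measurable B ->
    m' (A `*` B) = (tensor nu A * tensor nu' B)%E.
  move=> mA mB; rewrite [LHS](_ : _ = P (X @^-1` A `&` X' @^-1` B)) //.
  have finT (mu : 'I_n -> probability T R) C : measurable C ->
      exists r, tensor mu C = r%:E.
    move=> mC; exists (fine (tensor mu C)); rewrite fineK//.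
    exact: fin_num_measure.
  have boxT : box (fun=> setT) = [set: n.-tuple T] by apply/seteqP; split.
  have [r rE] := finT nu A mA.
  rewrite setIC muleC rE; apply: law_step => //; first exact: mpre.
    have h := @law_step X nu setT measurableT 1 (probability_setT P) _ A mA.
    rewrite setIT mule1 rE in h; apply: h.
    move=> C mC; rewrite setIT mule1; have := XX' mC (fun=> measurableT) => /=.
    by rewrite boxT preimage_setT setIT probability_setT mule1.
  move=> C mC; have [s sE] := finT nu' _ (measurable_box mC).
  rewrite setIC muleC -rE sE.
  apply: law_step => //; first by apply: mpre; exact: measurable_box.
    have := XX' (fun=> measurableT) mC => /=.
    by rewrite boxT preimage_setT setTI probability_setT mul1e sE.
  by move=> D mD; rewrite XX'// sE.
rewrite -(@int_distribution _ _ _ _ _ P (mfun_Sub (mem_set mXX)))//.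
rewrite /Rintegral; congr fine; apply: eq_measure_integral => A mA _.
by rewrite [RHS](@product_measure_unique _ _ _ _ _ (tensor nu) (tensor nu') m').
Qed.

End pair_law.

(** * Averages over tuples of samples *)

Section empirical_integrals.
Context d (T : measurableType d) (R : realType).

Lemma empiricalE N (x : 'I_N -> T) (A : set T) : (0 < N)%N ->
  empirical R x A = (N%:R^-1 * \sum_(k < N) \1_A (x k))%:E.
Proof.
move=> N0; rewrite /empirical (negbTE (lt0n_neq0 N0)) EFinM -sumEFin.
by congr (_ * _)%E; apply: eq_bigr => k _; rewrite diracE indicE.
Qed.

Lemma int_empirical N (x : 'I_N -> T) (f : T -> R) : (0 < N)%N -> bm f ->
  \int[empirical R x]_y f y = N%:R^-1 * \sum_(k < N) f (x k).
Proof.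
case: N x => // N x _ bf.
suff nneg (g : T -> R) : bm g -> (forall y, 0 <= g y) ->
    \int[empirical R x]_y g y = N.+1%:R^-1 * \sum_(k < N.+1) g (x k).
  case: (bf) => mf [M fM].
  have bfM : bm (fun y => f y + M) by apply: bmD => //; exact: bm_cst.
  have := nneg _ bfM (fun y => _).
  rewrite intD//; last exact: bm_cst.
  rewrite int_cst big_split/= sumr_const card_ord mulrDr -[M *+ _]mulr_natl.
  rewrite mulKf ?pnatr_eq0// => /(_ _)/addIr; apply => y.
  by rewrite -lerBlDr sub0r; have := fM y; rewrite ler_norml => /andP[].
move=> bg g0; pose m_ := (fun k => \d_(x (inord k))) : {measure set T -> \bar R}^nat.
have N0 : 0 <= N.+1%:R^-1 :> R by rewrite invr_ge0.
apply: EFin_inj; rewrite intE//.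
have mg : measurable_fun setT (EFin \o g) by apply/measurable_EFinP; case: bg.
transitivity (\int[mscale (NngNum N0) (msum m_ N.+1)]_y (g y)%:E)%E.
  apply: eq_measure_integral => A mA _.
  rewrite /mscale/= /msum /= /empirical/=; congr (_ * _)%E.
  have e (h : 'I_N.+1 -> T) : h = x ->
      (\sum_(k < N.+1) \d_(x k) A = \sum_(k < N.+1) \d_(h k) A :> \bar R)%E by move=> ->.
  by apply: e; apply/funext => k; rewrite inord_val.
rewrite (@ge0_integral_mscale _ _ _ _ _ measurableT (NngNum N0) (EFin \o g))//=; last first.
  by move=> ? _; rewrite lee_fin.
rewrite ge0_integral_measure_sum//=; last by move=> ? _; rewrite lee_fin.
rewrite EFinM -sumEFin; congr (_ * _)%E; apply: eq_bigr => k _.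
rewrite inord_val integral_dirac// diracT mul1e//.
Qed.

End empirical_integrals.

Section tensor_empirical.
Context d (T : measurableType d) (R : realType).

Definition subtuple m N (x : 'I_m -> 'I_N -> T) (k : {ffun 'I_m -> 'I_N}) :
  m.-tuple T := [tuple x j (k j) | j < m].

(** The product of the empirical measures of the rows is itself the empirical
    measure of all the tuples that pick one sample in each row. *)
Lemma int_tensor_empirical m N (x : 'I_m -> 'I_N -> T) (F : m.-tuple T -> R) :
  (0 < N)%N -> bm F ->
  \int[tensor (fun j => empirical R (x j))]_z F z =
  (N%:R ^+ m)^-1 * \sum_(k : {ffun 'I_m -> 'I_N}) F (subtuple x k).
Proof.
move=> N0 bF.
pose D := #|{: {ffun 'I_m -> 'I_N}}|.
have DE : D = (N ^ m)%N by rewrite /D card_ffun !card_ord.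
have D0 : (0 < D)%N by rewrite DE expn_gt0 N0.
pose y : 'I_D -> m.-tuple T := fun i => subtuple x (enum_val i).
transitivity (\int[empirical R y]_z F z).
  rewrite /Rintegral; congr fine; apply: eq_measure_integral => A mA _.
  apply: tuple_measure_unique => //.
    by rewrite (le_lt_trans (probability_le1 _ _))// ltry.
  move=> B mB; etransitivity; first exact: tensor_box.
  rewrite (eq_bigr _ (fun i _ => empiricalE R (x i) (B i) N0)).
  rewrite [RHS](_ : _ = (D%:R^-1 * \sum_(i < D) \1_(box B) (y i))%:E); last exact: empiricalE.
  rewrite prodEFin; congr EFin.
  rewrite big_split/= prodr_const card_ord exprVn; congr (_ * _); first by rewrite DE natrX.
  rewrite bigA_distr_bigA/=.
  rewrite [RHS](_ : _ = \sum_(k in {: {ffun 'I_m -> 'I_N}}) \1_(box B) (subtuple x k)); last first.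
    by rewrite (big_enum_val (fun k => \1_(box B) (subtuple x k))).
  apply: eq_bigr => k _.
  have [Bk|nBk] := pselect (box B (subtuple x k)).
    rewrite indicE mem_set// big1// => i _.
    by rewrite indicE mem_set//; have := Bk i; rewrite tnth_mktuple.
  rewrite indicE memNset//.
  have [i Bi] : exists i, ~ B i (x i (k i)).
    by apply/existsNP => h; apply: nBk => i; rewrite tnth_mktuple.
  by rewrite (bigD1 i)//= indicE memNset// mul0r.
rewrite int_empirical//; congr (_ * _); first by rewrite DE natrX.
rewrite [RHS](_ : _ = \sum_(k in {: {ffun 'I_m -> 'I_N}}) F (subtuple x k)); last by [].
by rewrite (big_enum_val (fun k => F (subtuple x k))).
Qed.

End tensor_empirical.

Section sample_average.
Context d dO (T : measurableType d) (O : measurableType dO) (R : realType).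
Variables (P : probability O R) (m N : nat) (nu : 'I_m -> probability T R).
Variables (X : 'I_m -> 'I_N -> {RV P >-> T}).
Hypothesis N2 : (2 <= N)%N.
Hypothesis iX : independent_samples nu X.
Local Notation idx := {ffun 'I_m -> 'I_N}.

Let N0 : (0 < N)%N. Proof. exact: ltnW. Qed.

Definition sample (w : O) : 'I_m -> 'I_N -> T := fun j l => X j l w.

Lemma measurable_subtuple (k : idx) :
  measurable_fun setT (fun w => subtuple (sample w) k).
Proof.
apply/measurable_fun_tnthP => i.
have -> : tnth (T := T) ^~ i \o (fun w => subtuple (sample w) k) = (X i (k i) : O -> T).
  by apply/funext => w; rewrite /= tnth_mktuple.
exact: measurable_funPT.
Qed.

Definition disjoint_idx (k k' : idx) := [forall j, k j != k' j].

Lemma int_disjoint_pair (k k' : idx) (H : m.-tuple T * m.-tuple T -> R) :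
  disjoint_idx k k' -> bm H ->
  \int[P]_w H (subtuple (sample w) k, subtuple (sample w) k') =
  \int[tensor nu]_z \int[tensor nu]_z' H (z, z').
Proof.
move=> /forallP kk' bH.
have := @pair_law _ _ _ _ _ P m (mfun_Sub (mem_set (measurable_subtuple k)))
  (mfun_Sub (mem_set (measurable_subtuple k'))) nu nu _ H bH.
apply=> A A' mA mA'; rewrite !tensor_box//.
pose B (jl : 'I_m * 'I_N) := if jl.2 == k jl.1 then A jl.1 else
  if jl.2 == k' jl.1 then A' jl.1 else setT.
have [dX /(_ [set: 'I_m * 'I_N]%SET B)] := iX.
have mB jl : measurable (B jl) by rewrite /B; case: ifP => // _; case: ifP.
move=> /(_ (fun jl _ => mB jl)) h.
rewrite -big_split/=.
transitivity (P (\bigcap_(i in [set` [set: 'I_m * 'I_N]%SET]) (X i.1 i.2 @^-1` B i))).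
  congr (P _); apply/seteqP; split=> [w [Aw Aw'] [j l] _ |w Bw]; last first.
    split=> j; rewrite tnth_mktuple.
      by have := Bw (j, k j); rewrite /B/= inE eqxx; apply.
    have := Bw (j, k' j); rewrite /B/= inE eqxx eq_sym (negbTE (kk' j)).
    exact.
  rewrite /B/=; case: eqP => [->|_].
    by have := Aw j; rewrite tnth_mktuple.
  by case: eqP => // ->; have := Aw' j; rewrite tnth_mktuple.
rewrite h [LHS](eq_bigl predT); last by move=> i; rewrite !inE.
rewrite (eq_bigr (fun p => P (X p.1 p.2 @^-1` B (p.1, p.2)))); last by case.
rewrite -(pair_big predT predT (fun j l => P (X j l @^-1` B (j, l))))/=.
apply: eq_bigr => j _; rewrite (bigD1 (k j))//= (bigD1 (k' j))/=; last by rewrite eq_sym.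
rewrite big1 ?mule1; last first.
  move=> l /andP[lk lk']; rewrite /B/= (negbTE lk) (negbTE lk') preimage_setT.
  exact: probability_setT.
rewrite {1 2}/B/= !eqxx eq_sym (negbTE (kk' j)).
by rewrite -[nu j (A j)](dX j (k j) _ (mA j)) -[nu j (A' j)](dX j (k' j) _ (mA' j)).
Qed.

Lemma other_index (l : 'I_N) : exists l', l' != l.
Proof.
have [->|] := eqVneq l (Ordinal N0); first by exists (Ordinal N2).
by exists (Ordinal N0); rewrite eq_sym.
Qed.

Lemma int_subtuple (k : idx) (F : m.-tuple T -> R) : bm F ->
  \int[P]_w F (subtuple (sample w) k) = \int[tensor nu]_z F z.
Proof.
move=> bF.
have kk' : disjoint_idx k [ffun j => sval (cid (other_index (k j)))].
  by apply/forallP => j; rewrite ffunE; case: cid => l' /=; rewrite eq_sym.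
have -> := @int_disjoint_pair _ _ (fun zz => F zz.1) kk'.
  by apply: eq_Rintegral => z _; rewrite /= int_cst.
by apply: bm_comp.
Qed.

Lemma bm_subtuple (k : idx) (F : m.-tuple T -> R) : bm F ->
  bm (fun w => F (subtuple (sample w) k)).
Proof. by move=> bF; apply: bm_comp => //; exact: measurable_subtuple. Qed.

Lemma sum_overlap j (k : idx) : N%:R * (\sum_(k' : idx) (k j == k' j)%:R) = N%:R ^+ m :> R.
Proof.
rewrite (eq_bigr (fun k' : idx => \prod_(i < m) (if i == j then (k j == k' i)%:R else 1))); last first.
  by move=> k' _; rewrite -big_mkcond big_pred1_eq.
rewrite -(bigA_distr_bigA (fun i l => if i == j then (k j == l)%:R else 1)).
rewrite (bigD1 j)//= eqxx.
have -> : \sum_(l < N) (k j == l)%:R = 1 :> R.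
  rewrite (bigD1 (k j))//= eqxx big1 ?addr0// => l.
  by rewrite eq_sym => /negbTE ->.
rewrite mul1r (eq_bigr (fun=> N%:R)); last first.
  by move=> i /negbTE ->; rewrite sumr_const card_ord.
by rewrite -[in RHS](card_ord m) -prodr_const [in RHS](bigD1 j).
Qed.

(** An average over all index tuples of quantities that are uncorrelated when the
    two tuples share no index has variance of order [1/N]: only a fraction
    [m/N] of the pairs overlap. *)
Lemma sqr_average_le (G : idx -> O -> R) (s : R) : 0 <= s ->
  (forall k, bm (G k)) ->
  (forall k k', disjoint_idx k k' -> \int[P]_w (G k w * G k' w) = 0) ->
  (forall k, \int[P]_w (G k w ^+ 2) <= s) ->
  \int[P]_w (((N%:R ^+ m)^-1 * \sum_k G k w) ^+ 2) <= m%:R * s / N%:R.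
Proof.
move=> s0 bG G0 Gs.
have Np : 0 < N%:R ^+ m :> R by rewrite exprn_gt0// ltr0n.
have N0' : 0 < N%:R :> R by rewrite ltr0n.
under eq_Rintegral do rewrite exprMn.
rewrite intZ; last by apply: bmX; exact: bm_sum.
have -> : \int[P]_w ((\sum_k G k w) ^+ 2) = \sum_k \sum_k' \int[P]_w (G k w * G k' w).
  under eq_Rintegral do rewrite expr2 mulr_suml.
  rewrite int_sum; last by move=> k; apply: bmM => //; exact: bm_sum.
  apply: eq_bigr => k _.
  under eq_Rintegral do rewrite mulr_sumr.
  by rewrite int_sum// => k'; exact: bmM.
rewrite exprVn mulrC ler_pdivrMr ?exprn_gt0//.
apply: (@le_trans _ _ (\sum_(k : idx) \sum_(k' : idx) \sum_(j < m) (k j == k' j)%:R * s)).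
  apply: ler_sum => k _; apply: ler_sum => k' _.
  have [kk'|] := boolP (disjoint_idx k k').
    by rewrite G0//; apply: sumr_ge0 => j _; rewrite mulr_ge0// ler0n.
  rewrite negb_forall => /existsP[j]; rewrite negbK => /eqP kj.
  rewrite (bigD1 j)//= kj eqxx mul1r.
  apply: (@le_trans _ _ s); last first.
    by rewrite lerDl; apply: sumr_ge0 => i _; rewrite mulr_ge0// ler0n.
  apply: (@le_trans _ _ (\int[P]_w (2^-1 * G k w ^+ 2 + 2^-1 * G k' w ^+ 2))).
    apply: le_int; [exact: bmM|by apply: bmD; apply: bmZ; exact: bmX|].
    by move=> w; have := sqr_ge0 (G k w - G k' w); nra.
  rewrite intD; [|by apply: bmZ; exact: bmX..].
  rewrite !intZ; [|exact: bmX..].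
  by have := Gs k; have := Gs k'; lra.
under eq_bigr do rewrite exchange_big/=.
rewrite exchange_big/=.
have ov j : \sum_(k : idx) \sum_(k' : idx) (k j == k' j)%:R * s = (N%:R ^+ m) ^+ 2 * s / N%:R.
  under eq_bigr do rewrite -mulr_suml.
  rewrite -mulr_suml.
  rewrite (eq_bigr (fun=> N%:R ^+ m / N%:R)); last first.
    by move=> k _; rewrite -(sum_overlap j k) mulrC mulKf// gt_eqF.
  by rewrite sumr_const card_ffun !card_ord -[_ *+ _]mulr_natr natrX expr2; field; rewrite gt_eqF.
under eq_bigr do rewrite ov.
rewrite sumr_const card_ord -[_ *+ _]mulr_natl.
rewrite [leLHS](_ : _ = m%:R * s / N%:R * N%:R ^+ m ^+ 2)//.
by field; rewrite gt_eqF.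
Qed.

Definition emp w : 'I_m -> probability T R := fun j => empirical R (sample w j).

Lemma bm_int_emp (F : m.-tuple T -> R) : bm F -> bm (fun w => \int[tensor (emp w)]_z F z).
Proof.
move=> bF; under eq_fun do rewrite /emp int_tensor_empirical//.
by apply: bmZ; apply: bm_sum => k; exact: bm_subtuple.
Qed.

(** The deviation is the average of the centred [F] over all index tuples, and
    two tuples of samples without a common index are independent. *)
Lemma sqr_deviation (F : m.-tuple T -> R) : bm F ->
  \int[P]_w ((\int[tensor (emp w)]_z F z - \int[tensor nu]_z F z) ^+ 2) <=
  m%:R * (\int[tensor nu]_z (F z ^+ 2)) / N%:R.
Proof.
move=> bF; set a := \int[tensor nu]_z F z.
have bFa : bm (fun z => F z - a) by apply: bmB => //; exact: bm_cst.
have va : \int[tensor nu]_z (F z - a) ^+ 2 <= \int[tensor nu]_z (F z ^+ 2).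
  by rewrite int_sqr_centered// gerBl sqr_ge0.
have Np : N%:R ^+ m != 0 :> R by rewrite expf_neq0// pnatr_eq0 -lt0n.
under eq_Rintegral => w _.
  rewrite (_ : _ - a =
    ((N%:R ^+ m)^-1 * \sum_(k : idx) (F (subtuple (sample w) k) - a))); last first.
    rewrite int_tensor_empirical//.
    rewrite big_split/= sumr_const.
    rewrite card_ffun !card_ord mulrDr -[(- a) *+ _]mulr_natl natrX.
    by rewrite mulrA mulVf// mul1r.
  over.
have bG k : bm (fun w => F (subtuple (sample w) k) - a).
  by apply: bmB; [exact: bm_subtuple|exact: bm_cst].
apply: (le_trans (sqr_average_le (s := \int[tensor nu]_z (F z - a) ^+ 2) _ bG _ _)).
- by apply: int_ge0 => z; exact: sqr_ge0.
- move=> k k' kk'.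
  have := int_disjoint_pair kk' (H := fun zz => (F zz.1 - a) * (F zz.2 - a)).
  move=> /= -> //; last first.
    by apply: bmM; apply: bmB; [apply: bm_comp| exact: bm_cst|apply: bm_comp|exact: bm_cst].
  under eq_Rintegral => z _.
    rewrite intZ// intB//; last exact: bm_cst.
    rewrite int_cst -/a subrr mulr0.
    over.
  by rewrite int_cst.
- by move=> k; rewrite (int_subtuple k (F := fun z => (F z - a) ^+ 2))//; exact: bmX.
- by rewrite ler_pM2r ?invr_gt0 ?ltr0n// ler_wpM2l.
Qed.

(** The sample plugged in at [j] also enters the average, so the terms of the
    average are not centred one by one. They are uncorrelated nevertheless:
    conditionally on that sample, [F] has mean zero. *)
Lemma sqr_deviation_slice (F : m.-tuple T -> R) (M : R) (j : 'I_m) (l : 'I_N) : bm F ->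
  (forall z, `|F z| <= M) ->
  {ae nu j, forall y, \int[tensor nu]_z F (upd z j y) = 0} ->
  \int[P]_w ((\int[tensor (emp w)]_z F (upd z j (sample w j l))) ^+ 2) <=
  m%:R * M ^+ 2 / N%:R.
Proof.
move=> bF FM F0.
pose kl (k : idx) (l : 'I_N) : idx := [ffun i => if i == j then l else k i].
have klE (k : idx) w l' : upd (subtuple (sample w) k) j (sample w j l') = subtuple (sample w) (kl k l').
  apply: eq_from_tnth => i; rewrite tnth_upd !tnth_mktuple ffunE.
  by case: eqP => [->|].
under eq_Rintegral => w _.
  rewrite (int_tensor_empirical _ _ (bm_updz j _ bF))//.
  under eq_bigr do rewrite klE.
  over.
apply: sqr_average_le.
- exact: sqr_ge0.
- by move=> k; exact: bm_subtuple.
- move=> k k' /forallP kk'.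
  (* Both tuples carry the sample [l] at [j]. Moving the second one to another
     index [l'] there makes them disjoint, and [upd] restores the common sample. *)
  have [l' l'l] := other_index l.
  under eq_Rintegral => w _ do rewrite -(klE k') -(upd_upd _ _ (sample w j l')) (klE k').
  have dk : disjoint_idx (kl k l) (kl k' l').
    by apply/forallP => i; rewrite !ffunE; case: (i == j) => //; rewrite eq_sym.
  pose H (zz : m.-tuple T * m.-tuple T) := F zz.1 * F (upd zz.2 j (tnth zz.1 j)).
  have bH : bm H.
    apply: bmM; apply: bm_comp => //; apply: measurable_fun_upd => //.
    exact: (measurableT_comp (measurable_tnth j) measurable_fst).
  have := int_disjoint_pair dk bH.
  rewrite /H /=; under eq_Rintegral do rewrite tnth_mktuple ffunE eqxx.
  move=> ->.
  pose S y := \int[tensor nu]_z F (upd z j y).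
  have bS : bm S by exact: bm_int_upd.
  have S0 : \int[nu j]_y `|S y| = 0.
    rewrite -(int_cst (nu j) 0); apply: int_ae; [exact: bm_norm|exact: bm_cst|].
    by apply: filterS F0 => y /= Sy; rewrite /S Sy normr0.
  under eq_Rintegral => z _.
    rewrite intZ; last exact: bm_updz.
    rewrite -/(S (tnth z j)).
    over.
  have bFS : bm (fun z => F z * S (tnth z j)) by apply: bmM => //; exact: bm_tnth.
  apply/eqP; rewrite -normr_le0 (le_trans (le_norm_int _ bFS))//.
  apply: (@le_trans _ _ (\int[tensor nu]_z (M * `|S (tnth z j)|))).
    apply: le_int; first exact: bm_norm.
      by apply: bmZ; apply: bm_norm; exact: bm_tnth.
    by move=> z; rewrite normrM ler_wpM2r.
  rewrite intZ; last by apply: bm_norm; exact: bm_tnth.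
  by rewrite (int_tnth nu j (bm_norm bS)) S0 mulr0.
- move=> k; apply: le_int_cst; first by apply: bmX; exact: bm_subtuple.
  by move=> w; exact: sqr_le_norm.
Qed.

Lemma bm_slice (F : m.-tuple T -> R) (j : 'I_m) (l : 'I_N) : bm F ->
  bm (fun w => \int[tensor (emp w)]_z F (upd z j (sample w j l))).
Proof.
move=> bF; under eq_fun => w do rewrite (int_tensor_empirical _ _ (bm_updz j _ bF))//.
apply: bmZ; apply: bm_sum => k; apply: bm_comp => //.
by apply: measurable_fun_upd; [exact: measurable_subtuple|exact: measurable_funPT].
Qed.

End sample_average.

(** * Almost everywhere limits *)

Lemma cvg_summable_increments (R : realType) (u : nat -> R) (B : R) :
  (forall n, \sum_(0 <= k < n) `|u k.+1 - u k| <= B) -> cvgn u.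
Proof.
move=> uB; have : cvgn [normed series (telescope u)].
  apply: nondecreasing_is_cvgn.
    by apply: nondecreasing_series => n _ _ /=.
  by exists B => _ [n _ <-] /=; rewrite seriesEnat/=.
move/(@normed_cvg R R^o) => h.
have -> : u = (series (telescope u) \+ (fun=> u 0%N)).
  by apply/funext => n /=; rewrite telescopeK/= subrK.
by apply: is_cvgD => //; exact: is_cvg_cst.
Qed.

Lemma sum_half_le (R : realType) (C : R) n : 0 <= C ->
  \sum_(0 <= i < n) C * 2^-1 ^+ i <= C * (1 - 2^-1)^-1.
Proof.
move=> C0; have := @geometric_le_lim R n C 2^-1 C0.
rewrite seriesEnat/=; apply; first by rewrite invr_gt0.
by rewrite ger0_norm ?invr_ge0// invf_lt1// ltr1n.
Qed.

Section bounded_limits.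
Context d (T : measurableType d) (R : realType) (mu : probability T R).

Lemma int_cvg (f_ : nat -> T -> R) (f : T -> R) (M : R) :
  (forall n, measurable_fun setT (f_ n)) -> (forall n x, `|f_ n x| <= M) ->
  bm f -> {ae mu, forall x, f_ ^~ x @ \oo --> f x} ->
  \int[mu]_x f_ n x @[n --> \oo] --> \int[mu]_x f x.
Proof.
move=> mf fM bf cf.
have bf_ n : bm (f_ n) by split=> //; exists M.
have h1 : {ae mu, forall x, [set: T] x ->
    (fun n => (EFin \o f_ n) x) @ \oo --> (EFin \o f) x}.
  apply: filterS cf => x cx _ /=.
  apply: cvg_EFin; [exact: nearW|exact: cx].
have h2 : mu.-integrable setT (fun=> M%:E) by exact: finite_measure_integrable_cst.
have h3 : {ae mu, forall x n, [set: T] x -> (`|(EFin \o f_ n) x| <= M%:E)%E}.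
  by apply: aeW => x n _; rewrite /= lee_fin.
have [_ _] := @dominated_convergence _ _ _ mu setT measurableT
  (fun n => EFin \o f_ n) (EFin \o f) (fun=> M%:E)
  (fun n => (measurable_EFinP _ _).2 (mf n))
  ((measurable_EFinP _ _).2 (bm_meas bf)) h1 h2 h3.
rewrite -(intE mu bf) /=.
under eq_fun do rewrite -(intE mu (bf_ _)).
exact: fine_cvg.
Qed.

(** Fast convergence in mean forces almost sure convergence: the sum of the
    increments has a finite integral, hence is finite almost everywhere. *)
Lemma fast_L1_cauchy_ae_cvg (f_ : nat -> T -> R) (C : R) :
  (forall n, bm (f_ n)) ->
  (forall n, \int[mu]_x `|f_ n.+1 x - f_ n x| <= C * 2^-1 ^+ n) ->
  {ae mu, forall x, cvgn (f_ ^~ x)}.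
Proof.
move=> bf fC.
pose e n x := (`|f_ n.+1 x - f_ n x|%:E : \bar R).
have be n : bm (fun x => `|f_ n.+1 x - f_ n x|) by apply: bm_norm; exact: bmB.
have me n : measurable_fun setT (e n) by apply/measurable_EFinP; case: (be n).
have e0 n x : (0 <= e n x)%E by rewrite lee_fin.
have C0 : 0 <= C by have := le_trans (int_ge0 mu (fun x => normr_ge0 _)) (fC 0%N); rewrite expr0 mulr1.
have finS : (\int[mu]_x (\sum_(n <oo) e n x) < +oo)%E.
  rewrite integral_nneseries//.
  apply: (@le_lt_trans _ _ (C * (1 - 2^-1)^-1)%:E); last exact: ltry.
  apply: lime_le.
    by apply: is_cvg_ereal_nneg_natsum => k _; exact: integral_ge0.
  apply: nearW => n.
  apply: (@le_trans _ _ (\sum_(0 <= i < n) (C * 2^-1 ^+ i)%:E)%E).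
    by apply: lee_sum => i _; rewrite -intE// lee_fin.
  by rewrite sumEFin lee_fin sum_half_le.
have mS : measurable_fun setT (fun x => \sum_(n <oo) e n x)%E.
  exact: ge0_emeasurable_sum.
have /integrable_ae : mu.-integrable setT (fun x => \sum_(n <oo) e n x)%E.
  apply/integrableP; split => //.
  under eq_integral do rewrite gee0_abs ?nneseries_ge0//.
  exact: finS.
move=> /(_ measurableT); apply: filterS => x /(_ I) finx.
apply: (@cvg_summable_increments _ _ (fine (\sum_(n <oo) e n x))) => n.
rewrite -lee_fin fineK// -sumEFin.
exact: nneseries_lim_ge.
Qed.

(** Clipping the upper limit to the interval from [- M] to [M] keeps the bound
    everywhere, also where the sequence diverges. *)
Lemma bounded_ae_limit (f_ : nat -> T -> R) (M : R) :
  (forall n, measurable_fun setT (f_ n)) -> (forall n x, `|f_ n x| <= M) ->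
  {ae mu, forall x, cvgn (f_ ^~ x)} ->
  exists f : T -> R, [/\ measurable_fun setT f, forall x, `|f x| <= M &
    {ae mu, forall x, f_ ^~ x @ \oo --> f x}].
Proof.
move=> mf fM cf.
have M0 : 0 <= M by apply: le_trans (fM 0%N point).
pose l x := limn_sup (f_ ^~ x).
have ml : measurable_fun setT l.
  apply: measurable_fun_limn_sup => // x _.
    by exists M => _ [n _ <-]; rewrite (le_trans (ler_norm _)).
  by exists (- M) => _ [n _ <-]; have := fM n x; rewrite ler_norml => /andP[].
exists (fun x => Num.max (- M) (Num.min M (l x))); split.
- by apply: measurable_maxr => //; exact: measurable_minr.
- move=> x; rewrite ler_norml le_max lexx/= ge_max ge_min lexx/= andbT.
  by rewrite lerNl (le_trans _ M0)// oppr_le0.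
- apply: filterS cf => x cx.
  have lE : l x = limn (f_ ^~ x) by rewrite /l cvg_limn_supE.
  have lM : l x <= M.
    rewrite lE; apply: limr_le => //; apply: nearW => n.
    by rewrite (le_trans (ler_norm _)).
  have Ml : - M <= l x.
    rewrite lE; apply: limr_ge => //; apply: nearW => n.
    by have := fM n x; rewrite ler_norml => /andP[].
  by rewrite (min_idPr lM) (max_idPr Ml) lE.
Qed.

End bounded_limits.

Section ae_tensor.
Context d (T : measurableType d) (R : realType) (n : nat).
Variable nu : 'I_n -> probability T R.

Lemma ae_tnth j (Q : T -> Prop) : {ae nu j, forall y, Q y} ->
  {ae tensor nu, forall z, Q (tnth z j)}.
Proof.
move=> [A [mA A0 QA]]; have mpA := measurable_pre (@measurable_tnth _ T n j) mA.
exists ((fun z => tnth z j) @^-1` A); split => //; last by move=> z /= nQ; exact: QA.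
rewrite (prob_int (tensor nu) mpA) -A0 (prob_int (nu j) mA); congr EFin.
exact: (int_tnth nu j (bm_indic R mA)).
Qed.

Lemma ae_tnth_all (Q : 'I_n -> T -> Prop) : (forall j, {ae nu j, forall y, Q j y}) ->
  {ae tensor nu, forall z, forall j, Q j (tnth z j)}.
Proof. by move=> h; apply: ae_forall => j; exact: ae_tnth. Qed.

End ae_tensor.

(** * The Schroedinger system *)

Section convexity_estimates.
Context (R : realType).
Implicit Types x y M : R.

Lemma expRB_ge x y M : - M <= x -> - M <= y ->
  expR (- M) * `|x - y| <= `|expR x - expR y|.
Proof.
wlog xy : x y / y <= x => [h Mx My|Mx My].
  have [/h|/ltW /h] := leP y x; first exact.
  by move=> hs; rewrite [X in expR _ * X]distrC [leRHS]distrC; exact: hs.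
rewrite !ger0_norm ?subr_ge0 ?ler_expR//.
have -> : expR x = expR y * expR (x - y) by rewrite -expRD addrC subrK.
have h1 := expR_ge1Dx (x - y).
have h2 : expR (- M) <= expR y by rewrite ler_expR.
have h3 : 0 <= x - y by rewrite subr_ge0.
have h4 := expR_gt0 y.
have -> : expR y * expR (x - y) - expR y = expR y * (expR (x - y) - 1) by ring.
by apply: ler_pM; rewrite ?expR_ge0//; lra.
Qed.

(** Uniform convexity of the exponential on bounded sets, from the identity
    [(a ^+ 2 + b ^+ 2) / 2 - a * b = (a - b) ^+ 2 / 2] at half arguments. *)
Lemma expR_midpoint x y M : - M <= x -> - M <= y ->
  expR ((x + y) / 2) + expR (- M) / 8 * (x - y) ^+ 2 <= (expR x + expR y) / 2.
Proof.
move=> Mx My.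
have := @expRB_ge (x / 2) (y / 2) (M / 2).
have h1 : - (M / 2) <= x / 2 by lra.
have h2 : - (M / 2) <= y / 2 by lra.
move=> /(_ h1 h2) h.
have {h} : (expR (- (M / 2)) * `|x / 2 - y / 2|) ^+ 2 <= (expR (x / 2) - expR (y / 2)) ^+ 2.
  rewrite -[leRHS]real_normK ?num_real// lerXn2r ?nnegrE//.
rewrite exprMn real_normK ?num_real//.
have -> : expR (- (M / 2)) ^+ 2 = expR (- M).
  by rewrite -expRM_natl; congr expR; field.
have -> : expR x = expR (x / 2) ^+ 2 by rewrite -expRM_natl; congr expR; field.
have -> : expR y = expR (y / 2) ^+ 2 by rewrite -expRM_natl; congr expR; field.
have -> : expR ((x + y) / 2) = expR (x / 2) * expR (y / 2).
  by rewrite -expRD; congr expR; field.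
set a := expR (x / 2); set b := expR (y / 2); set c := expR (- M); nra.
Qed.

Lemma expR_monotone x y M : - M <= x -> - M <= y ->
  expR (- M) * (x - y) ^+ 2 <= (expR x - expR y) * (x - y).
Proof.
move=> Mx My; have := expRB_ge Mx My.
have [xy|/ltW xy] := leP y x.
  have e : expR y <= expR x by rewrite ler_expR.
  rewrite !ger0_norm ?subr_ge0// => h; nra.
have e : expR x <= expR y by rewrite ler_expR.
rewrite !ler0_norm ?subr_le0// => h; nra.
Qed.

Lemma expRB_le x y M : x <= M -> y <= M -> `|expR x - expR y| <= expR M * `|x - y|.
Proof.
wlog xy : x y / y <= x => [h Mx My|Mx My].
  have [/h|/ltW /h] := leP y x; first exact.
  by move=> hs; rewrite [X in expR _ * X]distrC [leLHS]distrC; exact: hs.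
rewrite !ger0_norm ?subr_ge0 ?ler_expR//.
have -> : expR y = expR x * expR (y - x) by rewrite -expRD addrC subrK.
have h1 := expR_ge1Dx (y - x).
have h2 : expR x <= expR M by rewrite ler_expR.
have h4 := expR_gt0 x.
have -> : expR x - expR x * expR (y - x) = expR x * (1 - expR (y - x)) by ring.
have [h5|h5] := leP 0 (1 - expR (y - x)); first by apply: ler_pM; lra.
by apply: (@le_trans _ _ 0); [rewrite pmulr_rle0//; lra|rewrite mulr_ge0 ?expR_ge0//; lra].
Qed.

End convexity_estimates.

Section schroedinger_system.
Context d (T : measurableType d) (R : realType) (m : nat).
Variables (nu : 'I_m -> probability T R) (K : m.-tuple T -> R) (b : R).
Hypothesis b0 : 0 <= b.
Hypothesis mK : measurable_fun setT K.
Hypothesis K_ge : forall z, expR (- b) <= K z.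
Hypothesis K_le : forall z, K z <= 1.

(** A family of potentials is a constant [p.1] with one function [p.2 j] for each
    coordinate. Keeping the constant apart allows all the functions to be
    centred, which makes the decomposition of their sum unique. *)
Definition totpot (p : R * ('I_m -> T -> R)) (z : m.-tuple T) : R :=
  p.1 + \sum_j p.2 j (tnth z j).

(** The form of the density of the plan with respect to the product measure. *)
Definition gibbs (p : R * ('I_m -> T -> R)) (z : m.-tuple T) : R :=
  K z * expR (totpot p z).

(** The density, with respect to [nu j], of the [j]-th marginal of the measure with
    density [gibbs p]. *)
Definition marginal (p : R * ('I_m -> T -> R)) (j : 'I_m) (y : T) : R :=
  \int[tensor nu]_z gibbs p (upd z j y).

Definition admissible (p : R * ('I_m -> T -> R)) : Prop :=
  [/\ `|p.1| <= m%:R * b, forall j, measurable_fun setT (p.2 j),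
      forall j y, `|p.2 j y| <= b & forall j, \int[nu j]_y p.2 j y = 0].

(** The dual of the entropic problem in units of [eps], up to an additive
    constant; the potentials are centred, so only [p.1] remains of the linear
    part. *)
Definition dual (p : R * ('I_m -> T -> R)) : R := p.1 - \int[tensor nu]_z gibbs p z.

Lemma bm_kernel : bm K.
Proof.
apply: (@bmI _ _ _ _ 1) => // z; rewrite ger0_norm//.
by rewrite (le_trans _ (K_ge z)) ?expR_ge0.
Qed.

Section admissible_facts.
Variable p : R * ('I_m -> T -> R).
Hypothesis ap : admissible p.

Lemma bm_potential j : bm (p.2 j).
Proof. by case: ap => _ mg gb _; exact: (@bmI _ _ _ _ b). Qed.

Lemma bm_totpot : bm (totpot p).
Proof.
apply: bmD; first exact: bm_cst.
by apply: bm_sum => j; apply: bm_tnth; exact: bm_potential.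
Qed.

Lemma bm_gibbs : bm (gibbs p).
Proof. by apply: bmM; [exact: bm_kernel|apply: bm_expR; exact: bm_totpot]. Qed.

Lemma totpot_bound z : `|totpot p z| <= 2 * m%:R * b.
Proof.
case: ap => tb _ gb _; rewrite (le_trans (ler_normD _ _))//.
have : `|\sum_j p.2 j (tnth z j)| <= m%:R * b.
  rewrite (le_trans (ler_norm_sum _ _ _))//.
  apply: (@le_trans _ _ (\sum_(j < m) b)); first by apply: ler_sum => j _.
  by rewrite sumr_const card_ord mulr_natl.
by move: tb; lra.
Qed.

Lemma gibbs_gt0 z : 0 < gibbs p z.
Proof. by rewrite mulr_gt0 ?expR_gt0// (lt_le_trans _ (K_ge z))// expR_gt0. Qed.

Lemma gibbs_ge z : expR (- (b + 2 * m%:R * b)) <= gibbs p z.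
Proof.
rewrite opprD expRD ler_pM ?expR_ge0// ler_expR.
by have := totpot_bound z; rewrite ler_norml => /andP[].
Qed.

Lemma bm_marginal j : bm (marginal p j).
Proof. exact: bm_int_upd bm_gibbs. Qed.

Lemma marginal_ge j y : expR (- (b + 2 * m%:R * b)) <= marginal p j y.
Proof.
by apply: ge_int_cst => [|z]; [exact: bm_updz bm_gibbs|exact: gibbs_ge].
Qed.

Lemma marginal_gt0 j y : 0 < marginal p j y.
Proof. by apply: lt_le_trans (marginal_ge j y); exact: expR_gt0. Qed.

Lemma int_marginal j : \int[nu j]_y marginal p j y = \int[tensor nu]_z gibbs p z.
Proof. by rewrite (int_upd nu j bm_gibbs). Qed.

Lemma bm_ln_marginal j : bm (fun y => ln (marginal p j y)).
Proof.
apply: bm_ln (marginal_ge j) (bm_marginal j); exact: expR_gt0.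
Qed.

(* The marginal factors as the exponential of its own potential times [slice],
   which depends on the other potentials only. *)
Let rest j z := expR (\sum_(i < m | i != j) p.2 i (tnth z i)).
Let slice j y := \int[tensor nu]_z (K (upd z j y) * rest j z).

Let bm_rest j : bm (rest j).
Proof. by apply: bm_expR; apply: bm_sum => i; apply: bm_tnth; exact: bm_potential. Qed.

Let gibbsE j z y : gibbs p (upd z j y) = expR (p.1 + p.2 j y) * (K (upd z j y) * rest j z).
Proof.
rewrite /gibbs /totpot mulrCA; congr (_ * _); rewrite -expRD; congr expR.
rewrite (bigD1 j)//= tnth_upd eqxx addrA; congr (_ + _); apply: eq_bigr => i ij.
by rewrite tnth_upd (negbTE ij).
Qed.

Let bm_slice_integrand j y : bm (fun z => K (upd z j y) * rest j z).
Proof. by apply: bmM => //; exact: bm_updz bm_kernel. Qed.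

Let marginalE j y : marginal p j y = expR (p.1 + p.2 j y) * slice j y.
Proof. by rewrite /marginal; under eq_Rintegral do rewrite gibbsE; rewrite intZ. Qed.

Let slice_gt0 j y : 0 < slice j y.
Proof.
by have := marginal_gt0 j y; rewrite marginalE pmulr_rgt0// expR_gt0.
Qed.

Let ln_slice j y : p.2 j y - ln (marginal p j y) = - p.1 - ln (slice j y).
Proof.
by rewrite marginalE lnM ?posrE ?expR_gt0// expRK; ring.
Qed.

Let norm_sum_rest j z : `|\sum_(i < m | i != j) p.2 i (tnth z i)| <= (m%:R - 1) * b.
Proof.
case: ap => _ _ gb _; rewrite (le_trans (ler_norm_sum _ _ _))//.
apply: (@le_trans _ _ (\sum_(i < m | i != j) b)); first by apply: ler_sum.
rewrite sumr_const cardC1 card_ord -[b *+ _]mulr_natl ler_wpM2r//.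
by case: m j => [[]//|n] _; rewrite -[n.+1%:R]natr1 addrK.
Qed.

(** The kernel varies by a factor at most [expR b], hence so does [slice], whatever
    the other potentials are. This is what confines updated potentials to a fixed
    ball. *)
Let ln_slice_bounds j : exists2 c, `|c| <= (m%:R - 1) * b &
  forall y, c - b <= ln (slice j y) <= c.
Proof.
have br := bm_rest j.
have rge z : expR (- ((m%:R - 1) * b)) <= rest j z.
  by rewrite ler_expR; have := norm_sum_rest j z; rewrite ler_norml => /andP[].
have rle z : rest j z <= expR ((m%:R - 1) * b).
  by rewrite ler_expR; have := norm_sum_rest j z; rewrite ler_norml => /andP[].
pose e := \int[tensor nu]_z rest j z.
have ege : expR (- ((m%:R - 1) * b)) <= e by exact: ge_int_cst.
have ele : e <= expR ((m%:R - 1) * b) by exact: le_int_cst.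
have e0 : 0 < e by apply: lt_le_trans ege; exact: expR_gt0.
exists (ln e).
  rewrite ler_norml -ler_expR lnK ?posrE// ege/=.
  by rewrite -ler_expR lnK ?posrE.
move=> y; apply/andP; split.
  rewrite -ler_expR expRD !lnK ?posrE ?slice_gt0//.
  rewrite mulrC -intZ//; apply: le_int => //; first exact: bmZ.
  by move=> z; rewrite ler_wpM2r// expR_ge0.
rewrite ler_ln ?posrE ?slice_gt0//.
apply: le_int => // z; rewrite -[leRHS]mul1r ler_wpM2r// expR_ge0//.
Qed.

(** Maximizing the dual in the [j]-th potential alone makes the [j]-th marginal
    constraint hold and keeps the potentials in the same bounded set; the gain
    is a relative entropy, so it vanishes only when the constraint already held. *)
Lemma block_update j : exists2 q, admissible q &
  dual q - dual p = \int[nu j]_y (marginal p j y - 1 - ln (marginal p j y)).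
Proof.
have [tb mg gb g0] := ap.
pose h y := p.2 j y - ln (marginal p j y).
have bh : bm h by apply: bmB; [exact: bm_potential|exact: bm_ln_marginal].
pose a := \int[nu j]_y h y.
have aE : a = - \int[nu j]_y ln (marginal p j y).
  by rewrite /a intB ?g0 ?sub0r//; [exact: bm_potential|exact: bm_ln_marginal].
pose q : R * ('I_m -> T -> R) :=
  (p.1 + a, fun i y => if i == j then h y - a else p.2 i y).
have [c cb cs] := ln_slice_bounds j.
have hb y : - p.1 - c <= h y <= - p.1 - c + b.
  by rewrite /h ln_slice; have /andP[] := cs y; lra.
have ab : - p.1 - c <= a <= - p.1 - c + b.
  by rewrite ge_int_cst ?le_int_cst// => y; have /andP[] := hb y.
have aq : admissible q.
  split => /=.
  - have := cb; rewrite ler_norml => /andP[c1 c2].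
    have /andP[a1 a2] := ab; rewrite ler_norml; apply/andP; split; lra.
  - move=> i; case: eqP => // _; apply: bm_meas; apply: bmB => //; exact: bm_cst.
  - move=> i y; case: eqP => // _; have /andP[h1 h2] := hb y.
    by have /andP[a1 a2] := ab; rewrite ler_norml; apply/andP; split; lra.
  - move=> i; case: eqP => // ->.
    by rewrite intB ?int_cst ?subrr//; exact: bm_cst.
exists q => //.
have gq z y : gibbs q (upd z j y) = gibbs p (upd z j y) / marginal p j y.
  rewrite /gibbs -mulrA; congr (_ * _).
  rewrite -[X in _ = _ / X]lnK ?posrE ?marginal_gt0// -expRN -expRD; congr expR.
  rewrite /totpot (bigD1 j)//= [in RHS](bigD1 j)//= !eqxx tnth_upd eqxx /h.
  rewrite (eq_bigr (fun i => p.2 i (tnth (upd z j y) i))); last first.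
    by move=> i /negbTE ->.
  by ring.
have Iq : \int[tensor nu]_z gibbs q z = 1.
  rewrite (int_upd nu j); last first.
    apply: bmM; first exact: bm_kernel.
    apply: bm_expR; apply: bmD; first exact: bm_cst.
    apply: bm_sum => i /=; case: eqP => _.
      by apply: (bm_tnth i (f := fun y => h y - a)); apply: bmB => //; exact: bm_cst.
    by apply: bm_tnth; exact: bm_potential.
  rewrite -[RHS](int_cst (nu j)); apply: eq_Rintegral => y _.
  under eq_Rintegral do rewrite gq mulrC.
  rewrite intZ; last exact: bm_updz bm_gibbs.
  by rewrite mulVf// gt_eqF// marginal_gt0.
rewrite /dual Iq -(int_marginal j) /=.
rewrite intB; [|apply: bmB; [exact: bm_marginal|exact: bm_cst]|exact: bm_ln_marginal].
rewrite intB; [|exact: bm_marginal|exact: bm_cst].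
by rewrite int_cst aE; ring.
Qed.

Lemma int_totpot : \int[tensor nu]_z totpot p z = p.1.
Proof.
have [_ _ _ g0] := ap.
rewrite intD; [|exact: bm_cst|by apply: bm_sum => j; exact: bm_tnth (bm_potential j)].
rewrite int_cst int_sum; last by move=> j; exact: bm_tnth (bm_potential j).
by rewrite big1 ?addr0// => j _; rewrite int_tnth ?g0//; exact: bm_potential.
Qed.

(** Integrating out the other coordinates isolates one potential; convergence of
    the total potentials thus passes to each of them. *)
Lemma int_totpot_slice j y : \int[tensor nu]_z totpot p (upd z j y) = p.1 + p.2 j y.
Proof.
have [_ _ _ g0] := ap.
transitivity (\int[tensor nu]_z ((p.1 + p.2 j y) +
    \sum_(i < m | i != j) p.2 i (tnth z i))).
  apply: eq_Rintegral => z _; rewrite /totpot (bigD1 j)//= tnth_upd eqxx addrA; congr (_ + _).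
  by apply: eq_bigr => i ij; rewrite tnth_upd (negbTE ij).
have bt i : bm (fun z : m.-tuple T => p.2 i (tnth z i)) by exact: bm_tnth (bm_potential i).
rewrite intD; [|exact: bm_cst|exact: bm_sum].
rewrite int_cst int_sum// big1 ?addr0// => i _.
by rewrite int_tnth ?g0//; exact: bm_potential.
Qed.

End admissible_facts.

Lemma admissible0 : admissible (0, fun _ _ => 0).
Proof.
split=> //=; first by rewrite normr0 mulr_ge0.
- by move=> j y; rewrite normr0.
- by move=> j; rewrite int_cst.
Qed.

Lemma dual_le p : admissible p -> dual p <= m%:R * b.
Proof.
move=> ap; have [tb _ _ _] := ap.
have : 0 <= \int[tensor nu]_z gibbs p z by apply: int_ge0 => z; exact/ltW/gibbs_gt0.
by have := ler_norm p.1; rewrite /dual; lra.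
Qed.

Let delta := expR (- b) * (expR (- (2 * m%:R * b)) / 8).

Let delta_gt0 : 0 < delta.
Proof. by rewrite mulr_gt0 ?divr_gt0 ?expR_gt0. Qed.

(** Uniform concavity of the dual, from that of the exponential: two nearly
    optimal families of potentials have nearly equal sums. *)
Lemma dual_midpoint p q : admissible p -> admissible q ->
  exists2 r, admissible r &
  (dual p + dual q) / 2 +
    delta * \int[tensor nu]_z (totpot p z - totpot q z) ^+ 2 <= dual r.
Proof.
move=> ap aq.
pose r : R * ('I_m -> T -> R) :=
  ((p.1 + q.1) / 2, fun j y => 2^-1 * (p.2 j y + q.2 j y)).
have [tp mp gp g0p] := ap; have [tq mq gq g0q] := aq.
have ar : admissible r.
  split=> /=.
  - by move: tp tq; rewrite !ler_norml => /andP[? ?] /andP[? ?]; lra.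
  - by move=> j; apply: measurable_funM => //; exact: measurable_funD.
  - by move=> j y; move: (gp j y) (gq j y); rewrite !ler_norml => /andP[? ?] /andP[? ?]; lra.
  - move=> j; have bp := bm_potential ap j; have bq := bm_potential aq j.
    by rewrite intZ ?intD ?g0p ?g0q ?addr0 ?mulr0//; exact: bmD.
exists r => //.
have tr z : totpot r z = (totpot p z + totpot q z) / 2.
  by rewrite /totpot /= -mulr_sumr big_split/=; field; rewrite ?pnatr_eq0.
have btp := bm_totpot ap; have btq := bm_totpot aq; have btr := bm_totpot ar.
have bgp := bm_gibbs ap; have bgq := bm_gibbs aq; have bgr := bm_gibbs ar.
have bd : bm (fun z => (totpot p z - totpot q z) ^+ 2) by apply: bmX; exact: bmB.
have : \int[tensor nu]_z (gibbs r z + delta * (totpot p z - totpot q z) ^+ 2) <=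
       \int[tensor nu]_z (2^-1 * (gibbs p z + gibbs q z)).
  apply: le_int; [by apply: bmD => //; exact: bmZ|by apply: bmZ; exact: bmD|].
  move=> z; have lowp : - (2 * m%:R * b) <= totpot p z.
    by have := totpot_bound ap z; rewrite ler_norml => /andP[].
  have lowq : - (2 * m%:R * b) <= totpot q z.
    by have := totpot_bound aq z; rewrite ler_norml => /andP[].
  have := expR_midpoint lowp lowq; rewrite -tr /gibbs.
  have Kz := K_ge z; have K0 : 0 < K z by apply: lt_le_trans Kz; exact: expR_gt0.
  have e0 : 0 <= expR (- (2 * m%:R * b)) / 8 * (totpot p z - totpot q z) ^+ 2.
    by rewrite mulr_ge0 ?sqr_ge0// divr_ge0 ?expR_ge0.
  rewrite /delta; move: e0 Kz K0; set A := expR (totpot p z); set B := expR (totpot q z).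
  set C := expR (totpot r z); set D := _ / 8 * _; set k := expR (- b).
  move=> D0 Kz K0 h; have -> : k * (expR (- (2 * m%:R * b)) / 8) * (totpot p z - totpot q z) ^+ 2 = k * D.
    by rewrite /D !mulrA.
  have : K z * (C + D) <= K z * ((A + B) / 2) by rewrite ler_pM2l.
  have : k * D <= K z * D by rewrite ler_wpM2r.
  lra.
rewrite intD//; last exact: bmZ.
rewrite !intZ//; last exact: bmD.
rewrite intD// /dual.
move: (\int[_]_z gibbs p z) (\int[_]_z gibbs q z) (\int[_]_z gibbs r z) (delta * _).
by rewrite /= => *; lra.
Qed.

(** A maximizing sequence of the dual is Cauchy because the dual is uniformly concave in the total potential; its
    limit is a maximizer, and [block_update] then forces all marginal
    constraints. *)
Lemma schroedinger_system_solvable : exists2 p, admissible p &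
  forall j, {ae nu j, forall y, marginal p j y = 1}.
Proof.
pose V := [set dual p | p in admissible].
have V0 : V !=set0 by exists (dual (0, fun _ _ => 0)); exists (0, fun _ _ => 0) => //; exact: admissible0.
have supV : has_sup V.
  by split=> //; exists (m%:R * b) => _ [p ap <-]; exact: dual_le.
have e_gt0 n : 0 < delta * (4^-1 ^+ n) :> R by rewrite mulr_gt0// exprn_gt0// invr_gt0.
have /choice[p_ p_P] : forall n, exists p, admissible p /\ sup V - delta * 4^-1 ^+ n < dual p.
  move=> n; have [_ [p ap <-] h] := sup_adherent (e_gt0 n) supV.
  by exists p.
have ap n : admissible (p_ n) by case: (p_P n).
have pV n : sup V - delta * 4^-1 ^+ n < dual (p_ n) by case: (p_P n).
have Vub p : admissible p -> dual p <= sup V.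
  by move=> ap'; apply: ub_le_sup; [case: supV|exists p].
have bt n := bm_totpot (ap n).
have btd n : bm (fun z => totpot (p_ n.+1) z - totpot (p_ n) z) by exact: bmB.
have L2 n : \int[tensor nu]_z (totpot (p_ n.+1) z - totpot (p_ n) z) ^+ 2 <= 4^-1 ^+ n.
  have [r ar] := dual_midpoint (ap n.+1) (ap n).
  have := Vub _ ar; have := pV n; have := pV n.+1.
  have : delta * 4^-1 ^+ n.+1 <= delta * 4^-1 ^+ n.
    rewrite ler_pM2l// exprS ler_piMl ?exprn_ge0 ?invr_ge0//.
    by rewrite invf_le1// ler1n.
  move=> h0 h1 h2 h3 h4.
  suff : delta * \int[tensor nu]_z (totpot (p_ n.+1) z - totpot (p_ n) z) ^+ 2 <=
    delta * 4^-1 ^+ n by rewrite ler_pM2l.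
  move: h0 h1 h2 h3 h4.
  move: (dual _) (dual _) (dual _) (delta * _) (delta * _) (delta * _) (sup V).
  by move=> *; lra.
have L1 n : \int[tensor nu]_z `|totpot (p_ n.+1) z - totpot (p_ n) z| <= 2^-1 ^+ n.
  have i0 : 0 <= \int[tensor nu]_z `|totpot (p_ n.+1) z - totpot (p_ n) z| by exact: int_ge0.
  have h0 : 0 <= 2^-1 ^+ n :> R by rewrite exprn_ge0// invr_ge0.
  rewrite -(ler_pXn2r (_ : 0 < 2)%N) ?nnegrE//.
  rewrite (le_trans (sqr_int_le _ (bm_norm (btd n))))//.
  rewrite -exprM mulnC exprM (_ : 2^-1 ^+ 2 = 4^-1 :> R); last by rewrite exprVn -natrX.
  apply: le_trans (L2 n); apply: le_int; [exact/bmX/bm_norm|exact: bmX|].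
  by move=> z; rewrite real_normK ?num_real.
have tcauchy n : `|(p_ n.+1).1 - (p_ n).1| <= 2^-1 ^+ n.
  rewrite -!int_totpot// -intB//.
  exact: le_trans (le_norm_int _ (btd n)) (L1 n).
have gcauchy j n : \int[nu j]_y `|(p_ n.+1).2 j y - (p_ n).2 j y| <= 2 * 2^-1 ^+ n.
  have bg k : bm (fun y => (p_ k).2 j y) by exact: bm_potential.
  have bI : bm (fun y => \int[tensor nu]_z
     `|totpot (p_ n.+1) (upd z j y) - totpot (p_ n) (upd z j y)|).
    by apply: (bm_int_upd nu j (F := fun z => `|totpot (p_ n.+1) z - totpot (p_ n) z|)); exact: bm_norm.
  apply: (@le_trans _ _ (\int[nu j]_y (\int[tensor nu]_z
     `|totpot (p_ n.+1) (upd z j y) - totpot (p_ n) (upd z j y)| + 2^-1 ^+ n))).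
    apply: le_int; [by apply/bm_norm/bmB|by apply: bmD => //; exact: bm_cst|].
    move=> y; have -> : (p_ n.+1).2 j y - (p_ n).2 j y =
      \int[tensor nu]_z (totpot (p_ n.+1) (upd z j y) - totpot (p_ n) (upd z j y)) -
      ((p_ n.+1).1 - (p_ n).1).
      rewrite intB; [|exact: bm_updz (bt n.+1)|exact: bm_updz (bt n)].
      by rewrite !int_totpot_slice//; ring.
    rewrite (le_trans (ler_normB _ _))// lerD//.
    apply: le_norm_int; exact: (bm_updz j y (btd n)).
  rewrite intD//; last exact: bm_cst.
  rewrite int_cst -(int_upd nu j (bm_norm (btd n))).
  by have := L1 n; lra.
have tcvg : cvgn (fun n => (p_ n).1).
  apply: (@cvg_summable_increments _ _ (1 * (1 - 2^-1)^-1)) => n.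
  apply: le_trans (sum_half_le n ler01); apply: ler_sum => i _.
  by rewrite mul1r.
have /choice[g gP] : forall j, exists f : T -> R, [/\ measurable_fun setT f,
    forall x, `|f x| <= b & {ae nu j, forall x, (fun n => (p_ n).2 j x) @ \oo --> f x}].
  move=> j; apply: bounded_ae_limit.
  - by move=> n; case: (ap n).
  - by move=> n x; case: (ap n).
  - apply: fast_L1_cauchy_ae_cvg (gcauchy j) => n; exact: bm_potential.
pose p := (limn (fun n => (p_ n).1), g).
have bgj j : bm (g j) by have [mg gb _] := gP j; exact: (@bmI _ _ _ _ b).
have app : admissible p.
  split=> /=.
  - rewrite -lim_norm//; apply: limr_le; first exact: is_cvg_norm.
    by apply: nearW => n; case: (ap n).
  - by move=> j; case: (gP j).
  - by move=> j; case: (gP j).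
  - move=> j; have [mg gb gc] := gP j.
    have := @int_cvg _ _ _ (nu j) (fun n => (p_ n).2 j) (g j) b _ _ (bgj j) gc.
    have h1 n : measurable_fun setT ((p_ n).2 j) by case: (ap n).
    have h2 n x : `|(p_ n).2 j x| <= b by case: (ap n).
    move=> /(_ h1 h2) /cvg_lim <- //.
    rewrite (_ : (fun n => _) = (fun=> 0)); first exact: lim_cst.
    by apply/funext => n; case: (ap n).
have dualp : sup V <= dual p.
  have aecvg : {ae tensor nu, forall z, (fun n => gibbs (p_ n) z) @ \oo --> gibbs p z}.
    have := ae_tnth_all (fun j => let: And3 _ _ h := gP j in h).
    apply: filterS => z gz; apply: cvgM; first exact: cvg_cst.
    apply: continuous_cvg; first exact: continuous_expR.
    apply: cvgD => //.
    by apply: cvg_big => [|j _]; [exact: add_continuous|exact: gz].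
  have gM n z : `|gibbs (p_ n) z| <= expR (2 * m%:R * b).
    rewrite ger0_norm; last exact/ltW/gibbs_gt0.
    rewrite -[leRHS]mul1r ler_pM ?expR_ge0 ?ler_expR//.
      by rewrite (le_trans _ (K_ge z)) ?expR_ge0.
    by rewrite (le_trans (ler_norm _))// totpot_bound.
  have dcvg : (fun n => dual (p_ n)) @ \oo --> dual p.
    apply: cvgB => //.
    exact: (int_cvg (fun n => bm_meas (bm_gibbs (ap n))) gM (bm_gibbs app) aecvg).
  have lcvg : (fun n => sup V - delta * 4^-1 ^+ n) @ \oo --> sup V - 0.
    apply: cvgB; first exact: cvg_cst.
    apply: (@cvg_geometric R delta 4^-1).
    by rewrite ger0_norm ?invr_ge0// invf_lt1// ltr1n.
  rewrite subr0 in lcvg.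
  by apply: (ler_cvg_to lcvg dcvg); apply: nearW => n; exact/ltW.
exists p => // j.
have [q aq dq] := block_update app j.
have s_pos y := marginal_gt0 app j y.
have bs := bm_marginal app j; have bl := bm_ln_marginal app j.
have : {ae nu j, forall y, marginal p j y - 1 - ln (marginal p j y) = 0}.
  apply: int_eq0_ae.
  - by apply: bmB => //; apply: bmB => //; exact: bm_cst.
  - move=> y; have := @le_ln1Dx R (marginal p j y - 1).
    by rewrite ltrBrDr addNr addrC subrK => /(_ (s_pos y)); lra.
  - by rewrite -dq; have := Vub _ aq; lra.
apply: filterS => y /= h.
apply/eqP; rewrite -subr_eq0; apply/negPn/negP => ne.
have ln0 : ln (marginal p j y) != 0 by rewrite ln_eq0//; rewrite -subr_eq0.
have := expR_gt1Dx ln0; rewrite lnK ?posrE//.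
by move=> h1; move: h h1; lra.
Qed.

End schroedinger_system.

(** * Relative entropy with respect to a tilted measure *)

Section tilting.
Context d (T : measurableType d) (R : realType).
Variables (Q : probability T R) (p : T -> R).
Hypothesis p_ge0 : forall x, 0 <= p x.
Hypothesis bp : bm p.
Hypothesis intp : \int[Q]_x p x = 1.
Local Open Scope ereal_scope.

Definition tilt (A : set T) : \bar R := \int[Q]_(x in A) (p x)%:E.

Let tilt0 : tilt set0 = 0. Proof. exact: integral_set0. Qed.

Let tilt_ge0 A : 0 <= tilt A.
Proof. by apply: integral_ge0 => x _; rewrite lee_fin. Qed.

Let mp : measurable_fun setT (fun x => (p x)%:E).
Proof. by apply/measurable_EFinP; case: bp. Qed.

Let tilt_sigma_additive : semi_sigma_additive tilt.
Proof.
move=> F mF tF mUF; rewrite /tilt ge0_integral_bigcup//.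
- by apply: is_cvg_ereal_nneg_natsum_cond => n _ _; exact: tilt_ge0.
- exact: measurable_funTS.
- by move=> x _; rewrite lee_fin.
Qed.

HB.instance Definition _ := isMeasure.Build _ _ _ tilt tilt0 tilt_ge0 tilt_sigma_additive.

Let tilt_setT : tilt setT = 1. Proof. by rewrite /tilt -intE// intp. Qed.

HB.instance Definition _ := Measure_isProbability.Build _ _ _ tilt tilt_setT.

Definition tilted : probability T R := tilt.

Lemma tilted_dominates : tilted `<< Q.
Proof.
apply/null_content_dominatesP => A mA QA0; rewrite /= /tilt.
by apply: null_set_integral => //; exact: measurable_funTS.
Qed.

Lemma tilt_eq_dominates (P' : probability T R) :
  (forall A, measurable A -> P' A = tilt A) -> P' `<< Q.
Proof.
move=> P'E; apply/null_content_dominatesP => A mA QA0; rewrite P'E//.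
by have /null_content_dominatesP := tilted_dominates; apply.
Qed.

End tilting.

Section density.
Context d (T : measurableType d) (R : realType).
Variables (Q : probability T R) (p : T -> R) (lo : R).
Hypothesis lo0 : 0 < lo.
Hypothesis p_ge : forall x, lo <= p x.
Hypothesis bp : bm p.
Hypothesis intp : \int[Q]_x p x = 1.
Local Open Scope ereal_scope.

Let p_gt0 x : (0 < p x)%R. Proof. exact: lt_le_trans (p_ge x). Qed.

Let mp : measurable_fun setT (fun x => (p x)%:E).
Proof. by apply/measurable_EFinP; case: bp. Qed.

Let intpE : \int[Q]_x (p x)%:E = 1.
Proof. by rewrite -intE// intp. Qed.

Local Notation tilt := (tilt Q p).
Local Notation tilted := (tilted (fun x => ltW (p_gt0 x)) bp intp).

Section dominated.
Variable P' : probability T R.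
Hypothesis P'Q : P' `<< Q.

Let r (x : T) : R := fine (Radon_Nikodym_SigmaFinite.f P' Q x).

Let rE x : (r x)%:E = Radon_Nikodym_SigmaFinite.f P' Q x.
Proof. by rewrite /r fineK// Radon_Nikodym_SigmaFinite.f_fin_num. Qed.

Let r_ge0 x : (0 <= r x)%R.
Proof. by rewrite -lee_fin rE Radon_Nikodym_SigmaFinite.f_ge0. Qed.

Let mr : measurable_fun setT r.
Proof.
apply/measurable_EFinP; rewrite (_ : EFin \o r = Radon_Nikodym_SigmaFinite.f P' Q).
  exact: measurable_int (Radon_Nikodym_SigmaFinite.f_integrable P'Q).
by apply/funext => x /=; rewrite rE.
Qed.

Let density A : measurable A -> P' A = \int[Q]_(x in A) (r x)%:E.
Proof.
move=> mA; rewrite (Radon_Nikodym_SigmaFinite.f_integral P'Q)//.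
by apply: eq_integral => x _; rewrite rE.
Qed.

Let change (f : T -> R) : (forall x, 0 <= f x)%R -> measurable_fun setT f ->
  \int[P']_x (f x)%:E = \int[Q]_x (f x * r x)%:E.
Proof.
move=> f0 mf; rewrite -(Radon_Nikodym_SigmaFinite.change_of_variables P'Q)//.
- by apply: eq_integral => x _; rewrite -rE.
- exact/measurable_EFinP.
Qed.

Let r_pos : {ae P', forall x, 0 < r x}%R.
Proof.
have m0 : measurable [set x | (r x <= 0)%R].
  rewrite (_ : [set _ | _] = r @^-1` `]-oo, 0%R]); first exact: measurable_pre.
  by apply/seteqP; split=> x /=; rewrite in_itv.
exists [set x | (r x <= 0)%R]; split => //.
- rewrite density// integral0_eq// => x /= rx.
  by congr EFin; apply/eqP; rewrite eq_le rx r_ge0.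
- by move=> x /= /negP; rewrite -leNgt.
Qed.

Lemma KL_density : KL P' Q = \int[P']_x (ln (r x))%:E.
Proof.
rewrite /KL asboolT//; apply: ae_eq_integral => //.
- pose f := fine \o Radon_Nikodym (charge_of_finite_measure P') Q.
  have fE x : Radon_Nikodym (charge_of_finite_measure P') Q x = (f x)%:E.
    by rewrite /f /= fineK// Radon_Nikodym_fin_num.
  have mf : measurable_fun setT f.
    apply/measurable_EFinP; rewrite (_ : _ \o f = Radon_Nikodym (charge_of_finite_measure P') Q).
      by have /measurable_int := @Radon_Nikodym_integrable _ _ _ (charge_of_finite_measure P') Q P'Q.
    by apply/funext => x /=; rewrite fE.
  under eq_fun do rewrite fE /=.
  apply: measurable_fun_ifT => //.
    exact: measurable_fun_ler.
  by apply/measurable_EFinP; exact: (measurableT_comp (@measurable_ln R) mf).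
- by apply/measurable_EFinP; exact: (measurableT_comp (@measurable_ln R) mr).
- have h := ae_eq_Radon_Nikodym_SigmaFinite P'Q measurableT.
  have h2 := null_dominates_ae_eq measurableT P'Q h.
  apply: filterS2 h2 r_pos => x /= hx rx _.
  by rewrite -hx// -rE lne_EFin.
Qed.

Let mpR : measurable_fun setT p. Proof. by case: bp. Qed.

(* p / r, written so as to be positive where r vanishes *)
Let ratio x : R := (p x * expR (- ln (r x)))%R.

Let ratioE x : (0 < r x)%R -> ratio x = (p x / r x)%R.
Proof. by move=> rx; rewrite /ratio expRN lnK. Qed.

Let mratio : measurable_fun setT ratio.
Proof. apply: measurable_funM => //; apply: (measurableT_comp (@measurable_expR R)).
by apply: measurableT_comp => //; exact: (measurableT_comp (@measurable_ln R) mr). Qed.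

Let ratio_ge0 x : (0 <= ratio x)%R.
Proof. by rewrite mulr_ge0 ?expR_ge0// ltW. Qed.

Let int_ratio : \int[P']_x (ratio x)%:E = \int[Q]_(x in [set x | (0 < r x)%R]) (p x)%:E.
Proof.
rewrite change// [RHS]integral_mkcond; apply: eq_integral => x _.
rewrite /patch; case: ifPn => [|]; rewrite ?inE ?notin_setE/= => rx.
  by rewrite ratioE// divfK// gt_eqF.
have -> : r x = 0%R by apply/eqP; rewrite eq_le r_ge0 andbT leNgt; apply/negP.
by rewrite mulr0.
Qed.

Let mpos : measurable [set x | (0 < r x)%R].
Proof.
rewrite (_ : [set _ | _] = r @^-1` `]0%R, +oo[); first exact: measurable_pre.
by apply/seteqP; split=> x /=; rewrite in_itv/= andbT.
Qed.

Let int_ratio_le1 : \int[P']_x (ratio x)%:E <= 1.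
Proof.
rewrite int_ratio -intpE; apply: ge0_subset_integral => //.
by move=> x _; rewrite lee_fin ltW.
Qed.

Let ratio_integrable : P'.-integrable setT (EFin \o ratio).
Proof.
apply/integrableP; split; first by apply/measurable_EFinP; exact: mratio.
under eq_integral do rewrite /= ger0_norm//.
by rewrite (le_lt_trans int_ratio_le1)// ltry.
Qed.

Let lnp x : R := ln (p x).

Let blnp : bm lnp. Proof. exact: (bm_ln lo0 p_ge bp). Qed.

(* By [1 + ln y <= y] at [y = p / r], the function [psi] is an integrable minorant
   of [ln r], with equality only where [r = p]. *)
Let psi x : R := (lnp x + 1 - ratio x)%R.

Let psi_integrable : P'.-integrable setT (EFin \o psi).
Proof.
have hr := ratio_integrable.
have h : P'.-integrable setT (EFin \o (fun x => lnp x + 1)%R).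
  by apply: bm_integrable; apply: bmD => //; exact: bm_cst.
rewrite (_ : EFin \o psi = ((EFin \o (fun x => lnp x + 1)%R) \- (EFin \o ratio))).
  exact: (integrableB measurableT h hr).
by apply/funext => x /=; rewrite EFinB.
Qed.

Let psi_le x : (0 < r x)%R -> (psi x <= ln (r x) ?= iff (r x == p x))%R.
Proof.
move=> rx; rewrite /psi ratioE// /lnp.
have h : (ln (r x) = ln (p x) - ln (p x / r x))%R.
  by rewrite ln_div ?posrE//; ring.
rewrite h; set y := (p x / r x)%R.
have y0 : (0 < y)%R by exact: divr_gt0.
have ry : (r x == p x) = (y == 1)%R.
  apply/eqP/eqP => [e|h1]; first by rewrite /y -e divff ?gt_eqF.
  by rewrite -[p x](divfK (lt0r_neq0 rx)) -/y h1 mul1r.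
have [y1|y1] := eqVneq y 1%R.
  rewrite ry y1 eqxx ln1 /=; split; first by lra.
  by apply/eqP; ring.
rewrite ry (negbTE y1).
have hy : (1 + ln y < y)%R.
  by rewrite -[ltRHS]lnK ?posrE//; apply: expR_gt1Dx; rewrite ln_eq0.
by split; [lra|apply/negbTE; rewrite lt_eqF//; lra].
Qed.

(* Almost everywhere for [P'] this is [ln r]; being above an integrable function
   everywhere, it has a well defined integral, possibly infinite. *)
Let phi x : R := Num.max (ln (r x)) (psi x).

Let mlnr : measurable_fun setT (fun x => ln (r x)).
Proof. exact: (measurableT_comp (@measurable_ln R) mr). Qed.

Let mpsi : measurable_fun setT psi.
Proof. by apply/measurable_EFinP; exact: measurable_int psi_integrable. Qed.

Let mphi : measurable_fun setT phi.
Proof. exact: measurable_maxr. Qed.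

Let KL_phi : KL P' Q = \int[P']_x (phi x)%:E.
Proof.
rewrite KL_density; apply: ae_eq_integral => //; [exact/measurable_EFinP..|].
by apply: filterS r_pos => x rx _; rewrite /phi (max_idPl (psi_le rx).1).
Qed.

Let int_psi : \int[P']_x (psi x)%:E = (\int[P']_x lnp x)%:E + 1 - \int[P']_x (ratio x)%:E.
Proof.
have h : P'.-integrable setT (EFin \o (fun x => lnp x + 1)%R).
  by apply: bm_integrable; apply: bmD => //; exact: bm_cst.
under eq_integral do rewrite /psi EFinB.
rewrite integralB//.
congr (_ - _); rewrite -EFinD -[X in (_ + X)%R](int_cst P') -intD//; last exact: bm_cst.
by rewrite intE//; apply: bmD => //; exact: bm_cst.
Qed.

Let int_ratio_fin : \int[P']_x (ratio x)%:E \is a fin_num.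
Proof. exact: integrable_fin_num ratio_integrable. Qed.

Let int_psi_ge : (\int[P']_x lnp x)%:E <= \int[P']_x (psi x)%:E.
Proof.
rewrite int_psi; move: int_ratio_le1 int_ratio_fin.
by case: (\int[P']_x (ratio x)%:E) => // s; rewrite !lee_fin => s1 _; lra.
Qed.

Let psi_phi x : (psi x <= phi x)%R. Proof. by rewrite le_max lexx orbT. Qed.

Let phi_not_integrable : ~ P'.-integrable setT (EFin \o phi) ->
  \int[P']_x (phi x)%:E = +oo.
Proof.
move=> nphi; rewrite integralE.
have mE : measurable_fun setT (EFin \o phi) by exact/measurable_EFinP.
have neg_fin : \int[P']_x ((EFin \o phi)^\- x) < +oo.
  have /(integrable_lty measurableT) := integrable_funeneg measurableT psi_integrable.
  apply: le_lt_trans; apply: ge0_le_integral => //.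
  - exact: measurable_funeneg.
  - by apply: measurable_funeneg; apply/measurable_EFinP.
  - move=> x _; rewrite !funenegE/= -!EFin_max lee_fin.
    by rewrite ge_max !le_max lerN2 psi_phi lexx orbT.
have pos_inf : \int[P']_x ((EFin \o phi)^\+ x) = +oo.
  apply/eqP; rewrite -leye_eq leNgt; apply/negP => pos_fin; apply: nphi.
  apply/integrableP; split => //.
  rewrite (_ : (fun x => `|(EFin \o phi) x|) =
      ((EFin \o phi)^\+ \+ (EFin \o phi)^\-)); last first.
    by rewrite -fune_abse.
  rewrite ge0_integralD//; [|exact: measurable_funepos|exact: measurable_funeneg].
  exact: lte_add_pinfty.
have neg_ge0 : 0 <= \int[P']_x ((EFin \o phi)^\- x) by exact: integral_ge0.
rewrite pos_inf; move: neg_fin neg_ge0.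
by case: (\int[P']_x ((EFin \o phi)^\- x)).
Qed.

(** Gibbs' inequality: relative entropy exceeds the mean of [ln p], since the
    excess is the relative entropy with respect to the tilted measure. The
    bound is stated without integrability of the density of [P']. *)
Lemma KL_ge : (\int[P']_x ln (p x))%:E <= KL P' Q.
Proof.
rewrite KL_phi; have [iphi|/phi_not_integrable ->] := pselect (P'.-integrable setT (EFin \o phi)); last by rewrite leey.
apply: le_trans int_psi_ge _; apply: le_integral => // x _.
by rewrite lee_fin.
Qed.

(** The equality case of Gibbs' inequality. Equality gives [r = p] only almost
    everywhere for [P']. The set where [r] vanishes is nevertheless null for [Q],
    because the tilted measure gives full mass to its complement and has a
    density bounded below. *)
Lemma KL_le_unique : KL P' Q <= (\int[P']_x ln (p x))%:E ->
  forall A, measurable A -> P' A = tilt A.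
Proof.
rewrite KL_phi => KLle.
have iphi : P'.-integrable setT (EFin \o phi).
  by apply: contrapT => /phi_not_integrable h; move: KLle; rewrite h.
have ratio1 : 1 <= \int[P']_x (ratio x)%:E.
  have : \int[P']_x (psi x)%:E <= (\int[P']_x lnp x)%:E.
    by apply: le_trans KLle; apply: le_integral => // x _; rewrite lee_fin.
  rewrite int_psi; move: int_ratio_fin.
  by case: (\int[P']_x (ratio x)%:E) => // s _; rewrite !lee_fin; lra.
have phi_psi : {ae P', forall x, (phi x - psi x = 0)%R}.
  have mdiff : measurable_fun setT (fun x => (phi x - psi x)%:E).
    by apply/measurable_EFinP; exact: measurable_funB.
  have : \int[P']_x `|(phi x - psi x)%:E| = 0.
    apply/eqP; rewrite eq_le integral_ge0 ?andbT//.
    under eq_integral do rewrite /= ger0_norm ?subr_ge0// EFinB.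
    rewrite integralB//; apply: (@le_trans _ _ ((\int[P']_x lnp x)%:E - \int[P']_x (psi x)%:E)).
      by rewrite leeB.
    rewrite int_psi; move: ratio1 int_ratio_le1 int_ratio_fin.
    by case: (\int[P']_x (ratio x)%:E) => // s; rewrite !lee_fin => s1 s2 _; lra.
  move/(@ae_eq_integral_abs _ _ _ P' _ measurableT _ mdiff).
  by apply: filterS => x /= /(_ I) [].
have rp : {ae P', forall x, r x = p x}.
  apply: filterS2 phi_psi r_pos => x + rx.
  rewrite /phi (max_idPl (psi_le rx).1) => /eqP; rewrite subr_eq0 eq_sym.
  by rewrite (psi_le rx).2 => /eqP.
have mne : measurable [set x | r x != p x].
  rewrite -[X in measurable X]setTI.
  have -> : [set x | r x != p x] = (fun x => r x - p x)%R @^-1` (~` [set 0%R]).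
    by apply/seteqP; split=> x /=; [move=> /eqP h /eqP; rewrite subr_eq0 => /eqP|
      move=> h; apply/eqP => h'; apply: h; rewrite h' subrr].
  apply: measurable_funB => //; exact: measurableC.
have P'ne : P' [set x | r x != p x] = 0.
  have [B [mB B0 sB]] := rp; apply/eqP; rewrite eq_le measure_ge0 andbT -B0.
  by apply: le_measure; rewrite ?inE// => x /= /eqP; exact: sB.
have mneg : measurable (~` [set x | (0 < r x)%R]) by exact: measurableC.
have Q_zero : Q (~` [set x | (0 < r x)%R]) = 0.
  have tpos : tilt [set x | (0 < r x)%R] = 1.
    have := ratio1; rewrite int_ratio => tge.
    apply/eqP; rewrite eq_le tge andbT -intpE.
    by apply: ge0_subset_integral => // x _; rewrite lee_fin ltW.
  have tneg : tilted (~` [set x | (0 < r x)%R]) = 0.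
    by rewrite probability_setC// [X in 1 - X]tpos subee.
  apply/eqP; rewrite eq_le measure_ge0 andbT.
  have : lo%:E * Q (~` [set x | (0 < r x)%R]) <= 0.
    rewrite -tneg -integral_cst// /= /tilt; apply: ge0_le_integral => //.
    - by move=> x _; rewrite lee_fin ltW.
    - exact: measurable_funTS.
    - by move=> x _; rewrite lee_fin.
  by rewrite pmule_rle0 ?lte_fin.
have Qpos : {ae Q, forall x, (0 < r x)%R}.
  by exists (~` [set x | (0 < r x)%R]); split.
have Qrp : {ae Q, forall x, r x = p x}.
  have mrE : measurable_fun [set x | r x != p x] (EFin \o r).
    by apply: measurable_funTS; exact/measurable_EFinP.
  have : \int[Q]_(x in [set x | r x != p x]) `|(EFin \o r) x| = 0.
    by under eq_integral do rewrite /= ger0_norm//; rewrite -density.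
  move/(@ae_eq_integral_abs _ _ _ Q _ mne _ mrE) => h.
  apply: filterS2 h Qpos => x h rx; apply/eqP/negPn/negP => ne.
  by have [r0] := h ne; rewrite r0 ltxx in rx.
move=> A mA; rewrite density// /tilt; apply: ae_eq_integral => //.
- by apply: measurable_funTS; exact/measurable_EFinP.
- exact: measurable_funTS.
- by apply: filterS Qrp => x -> _.
Qed.

Section equal_tilt.
Hypothesis P'E : forall A, measurable A -> P' A = tilt A.

Let Qrp : ae_eq Q setT (EFin \o r) (EFin \o p).
Proof.
apply: integral_ae_eq => //.
- rewrite (_ : EFin \o r = Radon_Nikodym_SigmaFinite.f P' Q).
    exact: (Radon_Nikodym_SigmaFinite.f_integrable P'Q).
  by apply/funext => x /=; rewrite rE.
- by move=> A _ mA; rewrite -density// P'E.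
Qed.

Lemma KL_tilt : KL P' Q = (\int[P']_x ln (p x))%:E.
Proof.
rewrite KL_density intE//; apply: ae_eq_integral => //.
- exact/measurable_EFinP.
- by apply/measurable_EFinP; case: blnp.
- have := null_dominates_ae_eq measurableT P'Q Qrp.
  by apply: filterS => x /= h _; have [->] := h I.
Qed.

Let int_tilt_ge0 (h : T -> R) : (forall x, 0 <= h x)%R -> bm h ->
  (\int[P']_x h x = \int[Q]_x (h x * p x))%R.
Proof.
move=> h0 bh; apply: EFin_inj; rewrite !intE//; last exact: bmM.
rewrite change//; last by case: bh.
apply: ae_eq_integral => //.
- by apply/measurable_EFinP/measurable_funM => //; case: bh.
- by apply/measurable_EFinP/measurable_funM => //; case: bh.
- by apply: filterS Qrp => x /= hx _; have [->] := hx I.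
Qed.

Lemma int_tilt (h : T -> R) : bm h ->
  (\int[P']_x h x = \int[Q]_x (h x * p x))%R.
Proof.
move=> bh; case: (bh) => mh [M hM].
have bhM : bm (fun x => h x + M)%R by apply: bmD => //; exact: bm_cst.
have hM0 x : (0 <= h x + M)%R.
  by rewrite -lerBlDr sub0r; have := hM x; rewrite ler_norml => /andP[].
have := int_tilt_ge0 hM0 bhM; rewrite intD//; last exact: bm_cst.
rewrite int_cst (_ : \int[Q]_x _ = \int[Q]_x (h x * p x + M * p x))%R; last first.
  by apply: eq_Rintegral => x _; rewrite mulrDl.
rewrite intD; [|exact: bmM|exact: bmZ].
by rewrite intZ// intp mulr1 => /addIr.
Qed.

End equal_tilt.

End dominated.

End density.

(** * The Schroedinger plan *)

Section support.
Context d (T : measurableType d) (R : realType) (m : nat).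

Lemma box_full (P : probability (m.-tuple T) R) (A : set T) : measurable A ->
  (forall j, P ((fun x => tnth x j) @^-1` A) = 1%E) ->
  {ae P, forall z, box (fun=> A) z}.
Proof.
move=> mA h; apply: ae_forall => j.
exact: (ae_prob1 (measurable_pre (@measurable_tnth _ T m j) mA) (h j)).
Qed.

End support.

Section cost_bounds.
Context (R : realType) (m d : nat) (alpha : 'I_m -> R).
Hypothesis alpha_ge0 : forall j, 0 <= alpha j.
Hypothesis alpha1 : \sum_(j < m) alpha j = 1.
Local Notation V := 'rV[R]_d.

Lemma alpha_le1 j : alpha j <= 1.
Proof. by rewrite -alpha1 (bigD1 j)//= lerDl sumr_ge0. Qed.

Lemma enorm_sqr (x : V) : enorm x ^+ 2 = \sum_(i < d) x 0 i ^+ 2.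
Proof. by rewrite sqr_sqrtr// sumr_ge0// => i _; exact: sqr_ge0. Qed.

Definition cost_max : R := m%:R * (m%:R * (4 * d%:R)).

Lemma cost_max_ge0 : 0 <= cost_max.
Proof. by rewrite !mulr_ge0. Qed.

Lemma cost_ge0 (z : m.-tuple V) : 0 <= cost alpha z.
Proof. by do 2 apply: sumr_ge0 => ? _; exact: sqr_ge0. Qed.

Lemma cost_le (z : m.-tuple V) : box (fun=> @cube R d) z -> cost alpha z <= cost_max.
Proof.
move=> zc; rewrite /cost /cost_max.
have le1 i k : `|alpha i * tnth z i 0 k| <= 1.
  rewrite normrM (ger0_norm (alpha_ge0 i)).
  have := zc i k; rewrite -ler_norml => h.
  by rewrite -[leRHS]mulr1 ler_pM ?alpha_le1.
have le4 i j : enorm (alpha i *: tnth z i - alpha j *: tnth z j) ^+ 2 <= 4 * d%:R.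
  rewrite enorm_sqr; apply: (@le_trans _ _ (\sum_(k < d) 4)); last first.
    by rewrite sumr_const card_ord mulr_natr.
  apply: ler_sum => k _; rewrite !mxE.
  have h : `|alpha i * tnth z i 0 k - alpha j * tnth z j 0 k| <= 2.
    by rewrite (le_trans (ler_normB _ _))// (_ : 2 = 1 + 1)// lerD.
  by rewrite (le_trans (sqr_le_norm h))// -natrX.
apply: (@le_trans _ _ (\sum_(i < m) \sum_(j < m) 4 * d%:R)).
  apply: ler_sum => i _; rewrite [leRHS](bigID (fun j : 'I_m => (i < j)%N))/=.
  rewrite -[leLHS]addr0; apply: lerD; first by apply: ler_sum => j _; exact: le4.
  by apply: sumr_ge0 => j _; rewrite mulr_ge0.
by rewrite !sumr_const !card_ord -[leLHS]mulr_natl -[(_ * _) *+ m]mulr_natl.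
Qed.

Lemma average_cube (z : m.-tuple V) : box (fun=> @cube R d) z -> @cube R d (average alpha z).
Proof.
move=> zc i; rewrite -ler_norml /average summxE.
rewrite (le_trans (ler_norm_sum _ _ _))// -alpha1; apply: ler_sum => j _.
rewrite mxE normrM (ger0_norm (alpha_ge0 j)) ler_piMr//.
by have := zc j i; rewrite -ler_norml.
Qed.

Lemma measurable_cube : measurable (@cube R d).
Proof.
rewrite (_ : @cube R d = \bigcap_(i in [set: 'I_d]) (fun x : V => x 0 i) @^-1` `[-1, 1]).
  apply: fin_bigcap_measurable => // i _.
  exact: measurable_pre (measurable_coord 0 i) (measurable_itv _).
apply/seteqP; split=> [x xc i _|x xc i]; rewrite /= ?in_itv/=; first exact: xc.
by have := xc i I; rewrite /= in_itv.
Qed.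

Lemma measurable_cost : measurable_fun [set: m.-tuple V] (cost alpha).
Proof.
have mt l k : measurable_fun [set: m.-tuple V] (fun z => tnth z l 0 k).
  exact: (measurableT_comp (measurable_coord 0 k) (measurable_tnth l)).
apply: (@eq_measurable_fun _ _ _ _ _ (fun z : m.-tuple V => \sum_(i < m) \sum_(j < m)
    if (i < j)%N then \sum_(k < d) (alpha i * tnth z i 0 k - alpha j * tnth z j 0 k) ^+ 2
    else 0)).
  move=> z _; apply: eq_bigr => i _; rewrite [RHS]big_mkcond; apply: eq_bigr => j _.
  by case: ifP => // _; rewrite enorm_sqr; apply: eq_bigr => k _; rewrite !mxE.
apply: measurable_sum => i; apply: measurable_sum => j; case: (i < j)%N => //.
apply: measurable_sum => k; apply: measurable_funX.
by apply: measurable_funB; apply: measurable_funM.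
Qed.

(** Truncation at the maximum over the cube makes the cost bounded everywhere
    without changing it where the couplings live. *)
Definition tcost (z : m.-tuple V) : R := Num.min (cost alpha z) cost_max.

Lemma bm_tcost : bm tcost.
Proof.
apply: (@bmI _ _ _ _ cost_max).
  by apply: measurable_minr => //; exact: measurable_cost.
move=> z; rewrite ger0_norm ?le_min ?cost_ge0 ?cost_max_ge0//.
by rewrite ge_min lexx orbT.
Qed.

Lemma tcostE z : box (fun=> @cube R d) z -> tcost z = cost alpha z.
Proof. by move=> zc; rewrite /tcost; apply/min_idPl; exact: cost_le. Qed.

End cost_bounds.

Section plan.
Context (R : realType) (m d : nat) (alpha : 'I_m -> R) (eps : R).
Hypothesis alpha_ge0 : forall j, 0 <= alpha j.
Hypothesis alpha1 : \sum_(j < m) alpha j = 1.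
Hypothesis eps0 : 0 < eps.
Local Notation V := 'rV[R]_d.

Definition gibbs_kernel (z : m.-tuple V) : R := expR (- (tcost alpha z / eps)).
Definition kernel_bound : R := cost_max R m d / eps.

Lemma kernel_bound_ge0 : 0 <= kernel_bound.
Proof. by rewrite divr_ge0 ?cost_max_ge0// ltW. Qed.

Lemma measurable_gibbs_kernel : measurable_fun setT gibbs_kernel.
Proof.
apply: bm_meas; apply: bm_expR; apply: bmN.
by apply: bmM; [exact: bm_tcost|exact: bm_cst].
Qed.

Lemma gibbs_kernel_ge z : expR (- kernel_bound) <= gibbs_kernel z.
Proof.
by rewrite ler_expR lerN2 ler_pM2r ?invr_gt0// ge_min lexx orbT.
Qed.

Lemma gibbs_kernel_le z : gibbs_kernel z <= 1.
Proof.
rewrite -[leRHS]expR0 ler_expR oppr_le0 divr_ge0//; last exact: ltW.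
by rewrite le_min cost_ge0 cost_max_ge0.
Qed.

Variable mu : 'I_m -> probability V R.
Hypothesis mu_cube : forall j, mu j (@cube R d) = 1%E.

Let K := gibbs_kernel.
Let b0 := kernel_bound_ge0.
Let mK := measurable_gibbs_kernel.
Let K_ge := gibbs_kernel_ge.
Let K_le := gibbs_kernel_le.

Variable p : R * ('I_m -> V -> R).
Hypothesis ap : admissible mu kernel_bound p.
Hypothesis sp : forall j, {ae mu j, forall y, marginal mu K p j y = 1}.

Let g := gibbs K p.
Let bg : bm g. Proof. exact: (bm_gibbs mK K_ge K_le ap). Qed.
Let lo := expR (- (kernel_bound + 2 * m%:R * kernel_bound)).
Let lo0 : 0 < lo. Proof. exact: expR_gt0. Qed.
Let g_ge z : lo <= g z. Proof. exact: (gibbs_ge K_ge ap z). Qed.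

Hypothesis m_gt0 : (0 < m)%N.

Lemma int_gibbs1 : \int[tensor mu]_z g z = 1.
Proof.
rewrite (int_upd mu (Ordinal m_gt0) bg) -[RHS](int_cst (mu (Ordinal m_gt0))).
by apply: int_ae; [exact: bm_int_upd|exact: bm_cst|exact: sp].
Qed.

Let ln_gibbs z : ln (g z) = - (tcost alpha z / eps) + totpot p z.
Proof. by rewrite /g /gibbs lnM ?posrE ?expR_gt0// !expRK. Qed.

Lemma coupling_ae_cube P : couplings mu P -> {ae P, forall z, box (fun=> @cube R d) z}.
Proof.
move=> cP; apply: box_full => [|j]; first exact: measurable_cube.
by rewrite cP//; exact: measurable_cube.
Qed.

Lemma coupling_int P j (f : V -> R) : couplings mu P -> bm f ->
  \int[P]_z f (tnth z j) = \int[mu j]_y f y.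
Proof.
move=> cP bf; have mt := @measurable_tnth _ V m j.
rewrite -(@int_distribution _ _ _ _ _ P (mfun_Sub (mem_set mt)))//.
rewrite /Rintegral; congr fine; apply: eq_measure_integral => A mA _.
exact: cP.
Qed.

(** A coupling sees the potentials only through its marginals, so for every
    coupling the cost and the mean of [ln g] add up to the same constant. *)
Let int_lng P : couplings mu P ->
  \int[P]_z tcost alpha z + eps * \int[P]_z ln (g z) = eps * p.1.
Proof.
move=> cP; have [_ _ _ g0] := ap.
have bt := bm_totpot ap; have bc := @bm_tcost R m d alpha.
have bce : bm (fun z : m.-tuple V => - (tcost alpha z / eps)).
  by apply: bmN; apply: bmM => //; exact: bm_cst.
under [X in eps * X]eq_Rintegral do rewrite ln_gibbs.
rewrite intD//; have -> : \int[P]_z totpot p z = p.1.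
  rewrite /totpot intD; [|exact: bm_cst|]; last first.
    by apply: bm_sum => j; apply: bm_tnth; exact: (bm_potential ap j).
  rewrite int_cst int_sum; last by move=> j; apply: bm_tnth; exact: (bm_potential ap j).
  rewrite big1 ?addr0// => j _.
  by rewrite coupling_int ?g0//; exact: (bm_potential ap j).
rewrite mulrDr addrA -[X in _ + X + _]intZ// -intD//; last exact: bmZ.
rewrite (_ : \int[P]_z _ = 0) ?add0r// -[RHS](int_cst P).
by apply: eq_Rintegral => z _; field; rewrite gt_eqF.
Qed.

Let cost_int P : couplings mu P ->
  (\int[P]_z (cost alpha z)%:E = (\int[P]_z tcost alpha z)%:E)%E.
Proof.
move=> cP; rewrite intE; last exact: bm_tcost.
apply: ae_eq_integral => //.
- by apply/measurable_EFinP; exact: measurable_cost.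
- by apply/measurable_EFinP; apply: bm_meas; exact: bm_tcost.
- apply: filterS (coupling_ae_cube cP) => z zc _.
  by rewrite tcostE.
Qed.

Let g_ge0 z : 0 <= g z. Proof. exact: le_trans (ltW lo0) (g_ge z). Qed.

Let tilted_plan := tilted g_ge0 bg int_gibbs1.

Let tiltedE A : measurable A -> tilted_plan A = tilt (tensor mu) g A. Proof. by []. Qed.

Lemma tilted_coupling : couplings mu tilted_plan.
Proof.
move=> j A mA.
have mpA := measurable_pre (@measurable_tnth _ V m j) mA.
have dom := tilted_dominates g_ge0 bg int_gibbs1.
rewrite (prob_int _ mpA) (int_tilt bg int_gibbs1 dom tiltedE (bm_indic R mpA)).
have bA := bm_indic R mA.
rewrite (int_upd mu j); last by apply: bmM => //; exact: bm_indic.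
rewrite (prob_int _ mA); congr EFin; transitivity (\int[mu j]_y (\1_A y * marginal mu K p j y)).
  apply: eq_Rintegral => y _; rewrite -intZ; last exact: bm_updz.
  apply: eq_Rintegral => z _; congr (_ * _).
  rewrite !indicE; congr (nat_of_bool _)%:R.
  by apply/idP/idP; rewrite !inE/= tnth_upd eqxx.
apply: int_ae => //; first by apply: bmM => //; exact: bm_int_upd.
by apply: filterS (sp j) => y /= ->; rewrite mulr1.
Qed.

Let entropic_ge P : couplings mu P -> ((eps * p.1)%:E <= entropic_cost alpha eps mu P)%E.
Proof.
move=> cP; rewrite /entropic_cost cost_int// -(int_lng cP) EFinD leeD2l// EFinM.
rewrite lee_pmul2l ?lte_fin//.
have [dom|ndom] := pselect (P `<< tensor mu).
  exact: (KL_ge lo0 g_ge bg int_gibbs1 dom).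
by rewrite /KL asboolF// leey.
Qed.

Let entropic_tilted : entropic_cost alpha eps mu tilted_plan = (eps * p.1)%:E.
Proof.
rewrite /entropic_cost cost_int; last exact: tilted_coupling.
rewrite -(int_lng tilted_coupling) EFinD EFinM; congr (_ + _ * _)%E.
have dom := tilted_dominates g_ge0 bg int_gibbs1.
exact: (KL_tilt lo0 g_ge bg dom tiltedE).
Qed.

Let valueE : schroedinger_value alpha eps mu = (eps * p.1)%:E.
Proof.
apply/eqP; rewrite eq_le; apply/andP; split.
  rewrite -entropic_tilted; apply: ereal_inf_lbound.
  by exists tilted_plan => //; exact: tilted_coupling.
by apply: le_ereal_inf_tmp => _ [P cP <-]; exact: entropic_ge.
Qed.

(** The coupling with density [gibbs] is the only minimizer: for every coupling
    the entropic cost exceeds its value by [eps] times a relative entropy. *)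
Lemma schroedinger_plan_gibbs A : measurable A ->
  schroedinger_plan alpha eps mu A = tilt (tensor mu) g A.
Proof.
rewrite /schroedinger_plan; set S := [set pi | _]; set P := get S.
have [cP] : S P.
  by apply: (@getI _ S tilted_plan); split; [exact: tilted_coupling|rewrite valueE entropic_tilted].
rewrite valueE => eP; move: A.
have [dom|ndom] := pselect (P `<< tensor mu); last first.
  by move: eP; rewrite /entropic_cost cost_int// /KL asboolF// mulry gtr0_sg// mul1e.
apply: (KL_le_unique lo0 g_ge bg int_gibbs1 dom).
move: eP; rewrite /entropic_cost cost_int// -(int_lng cP) EFinD EFinM => h.
rewrite -(@lee_pmul2l _ eps%:E)// ?lte_fin//.
by rewrite -(@leeD2lE _ (\int[P]_z tcost alpha z)%:E)// h.
Qed.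

Lemma int_MSB (h : V -> R) : bm h ->
  \int[MSB alpha eps mu]_x h x = \int[tensor mu]_z (h (average alpha z) * g z).
Proof.
move=> bh; rewrite /MSB int_distribution//.
have dom := tilt_eq_dominates g_ge0 bg int_gibbs1 schroedinger_plan_gibbs.
apply: (int_tilt bg int_gibbs1 dom schroedinger_plan_gibbs).
apply: bm_comp => //; exact: measurable_funPT.
Qed.

Lemma schroedinger_plan_coupling : couplings mu (schroedinger_plan alpha eps mu).
Proof.
move=> j A mA; rewrite schroedinger_plan_gibbs; first exact: tilted_coupling.
exact: measurable_pre (measurable_tnth j) mA.
Qed.

Lemma MSB_cube : MSB alpha eps mu (@cube R d) = 1%E.
Proof.
have [A [mA A0 sA]] := coupling_ae_cube schroedinger_plan_coupling.
apply/eqP; rewrite eq_le probability_le1/=; last exact: measurable_cube.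
have mav : measurable (@average R m d alpha @^-1` @cube R d).
  by rewrite -[_ @^-1` _]setTI; apply: measurable_funPT => //; exact: measurable_cube.
have : schroedinger_plan alpha eps mu (~` A) = 1%E.
  by rewrite probability_setC// A0 sube0.
move=> <-; apply: le_measure; rewrite ?inE//; first exact: measurableC.
move=> z Az; apply: average_cube => //.
by apply: contrapT => nz; apply: Az; exact: sA.
Qed.

End plan.

(** * Stability of the Schroedinger potentials *)

Section stability.
Context d (T : measurableType d) (R : realType) (m : nat).
Variables (nu nu' : 'I_m -> probability T R) (K : m.-tuple T -> R) (b : R).
Hypothesis b0 : 0 <= b.
Hypothesis mK : measurable_fun setT K.
Hypothesis K_ge : forall z, expR (- b) <= K z.
Hypothesis K_le : forall z, K z <= 1.
Hypothesis m_gt0 : (0 < m)%N.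
Variables (p q : R * ('I_m -> T -> R)).
Hypothesis ap : admissible nu b p.
Hypothesis aq : admissible nu' b q.
Hypothesis sq : forall j, {ae nu' j, forall y, marginal nu' K q j y = 1}.

Let M := 2 * m%:R * b.
Let S z := totpot q z - totpot p z.
Let gp := gibbs K p.
Let gq := gibbs K q.
Let bS : bm S. Proof. exact: (bmB (bm_totpot aq) (bm_totpot ap)). Qed.
Let bgp : bm gp. Proof. exact: (bm_gibbs mK K_ge K_le ap). Qed.
Let bgq : bm gq. Proof. exact: (bm_gibbs mK K_ge K_le aq). Qed.

Definition marginal_error (j : 'I_m) (y : T) : R := 1 - marginal nu' K p j y.

Let bs j : bm (marginal nu' K p j). Proof. exact: (bm_int_upd nu' j bgp). Qed.

Lemma bm_marginal_error j : bm (marginal_error j).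
Proof. by apply: bmB => //; exact: bm_cst. Qed.

Let total_error := \sum_(j < m) \int[nu' j]_y (marginal_error j y ^+ 2).

(* [S] is the constant [tau] plus centred functions [v j] of one coordinate each.
   They are defined as conditional means, which bounds them by [S] in mean
   square. *)
Let tau := \int[tensor nu']_z S z.
Let w j y := \int[tensor nu']_z S (upd z j y).
Let v j y := w j y - tau.

Let bw j : bm (w j). Proof. exact: bm_int_upd. Qed.
Let bv j : bm (v j). Proof. by apply: bmB => //; exact: bm_cst. Qed.

Let int_w j : \int[nu' j]_y w j y = tau.
Proof. by rewrite /tau (int_upd nu' j bS). Qed.

Let int_v j : \int[nu' j]_y v j y = 0.
Proof. by rewrite intB ?int_w ?int_cst ?subrr//; exact: bm_cst. Qed.

Let I2 := \int[tensor nu']_z (S z ^+ 2).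

Let tau_sqr : tau ^+ 2 <= I2. Proof. exact: sqr_int_le. Qed.

Let v_sqr j : \int[nu' j]_y (v j y ^+ 2) <= I2.
Proof.
have -> : \int[nu' j]_y (v j y ^+ 2) = \int[nu' j]_y (w j y ^+ 2) - tau ^+ 2.
  by have := int_sqr_centered (nu' j) (bw j); rewrite int_w => <-.
apply: (@le_trans _ _ (\int[nu' j]_y (w j y ^+ 2))); first by rewrite gerBl sqr_ge0.
rewrite /I2 (int_upd nu' j (bmX 2 bS)); apply: le_int; first exact: bmX.
  exact: (bm_int_upd nu' j (bmX 2 bS)).
by move=> y; apply: sqr_int_le; exact: bm_updz.
Qed.

Let u j y := q.2 j y - p.2 j y.

Let bu j : bm (u j). Proof. exact: (bmB (bm_potential aq j) (bm_potential ap j)). Qed.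

Let u_mean j := \int[nu' j]_y u j y.

Let SE z : S z = (q.1 - p.1) + \sum_j u j (tnth z j).
Proof. by rewrite /S /totpot /u sumrB; ring. Qed.

Let tauE : tau = (q.1 - p.1) + \sum_j u_mean j.
Proof.
rewrite /tau; under eq_Rintegral do rewrite SE.
have bt j : bm (fun z : m.-tuple T => u j (tnth z j)) by exact: bm_tnth.
rewrite intD; [|exact: bm_cst|exact: bm_sum].
rewrite int_cst int_sum//; congr (_ + _); apply: eq_bigr => j _.
by rewrite (int_tnth nu' j (bu j)).
Qed.

Let vE j y : v j y = u j y - u_mean j.
Proof.
rewrite /v /w tauE.
transitivity (\int[tensor nu']_z (((q.1 - p.1) + u j y) +
    \sum_(i < m | i != j) u i (tnth z i)) - (q.1 - p.1 + \sum_j u_mean j)).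
  congr (_ - _); apply: eq_Rintegral => z _; rewrite SE (bigD1 j)//= tnth_upd eqxx addrA.
  by congr (_ + _); apply: eq_bigr => i ij; rewrite tnth_upd (negbTE ij).
have bt i : bm (fun z : m.-tuple T => u i (tnth z i)) by exact: bm_tnth.
rewrite intD; [|exact: bm_cst|exact: bm_sum].
have -> : \sum_j u_mean j = u_mean j + \sum_(i < m | i != j) u_mean i by rewrite (bigD1 j).
rewrite int_cst int_sum// (eq_bigr u_mean); last by move=> i _; rewrite (int_tnth nu' i (bu i)).
by ring.
Qed.

Let S_split z : S z = tau + \sum_j v j (tnth z j).
Proof.
rewrite SE tauE.
have -> : \sum_j v j (tnth z j) = \sum_j u j (tnth z j) - \sum_j u_mean j.
  by rewrite -sumrB; apply: eq_bigr => j _; rewrite vE.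
by ring.
Qed.

Let int_prod j (f : T -> R) (g : m.-tuple T -> R) : bm f -> bm g ->
  \int[tensor nu']_z (g z * f (tnth z j)) =
  \int[nu' j]_y (f y * \int[tensor nu']_z g (upd z j y)).
Proof.
move=> bf bg; rewrite (int_upd nu' j); last by apply: bmM => //; exact: bm_tnth.
apply: eq_Rintegral => y _; rewrite -intZ; last exact: bm_updz.
by apply: eq_Rintegral => z _; rewrite tnth_upd eqxx mulrC.
Qed.

Let int_against (g : m.-tuple T -> R) : bm g ->
  \int[tensor nu']_z (g z * S z) = tau * \int[tensor nu']_z g z +
    \sum_j \int[nu' j]_y (v j y * \int[tensor nu']_z g (upd z j y)).
Proof.
move=> bg; transitivity (\int[tensor nu']_z (tau * g z + \sum_j g z * v j (tnth z j))).
  by apply: eq_Rintegral => z _; rewrite S_split mulrDr mulr_sumr mulrC.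
have bt j : bm (fun z => g z * v j (tnth z j)) by apply: bmM => //; exact: bm_tnth.
rewrite intD; [|exact: bmZ|exact: bm_sum].
rewrite intZ// int_sum//; congr (_ + _); apply: eq_bigr => j _.
exact: int_prod.
Qed.

Let int_gq1 : \int[tensor nu']_z gq z = 1.
Proof.
rewrite (int_upd nu' (Ordinal m_gt0) bgq) -[RHS](int_cst (nu' (Ordinal m_gt0))).
by apply: int_ae; [exact: (bm_int_upd nu' _ bgq)|exact: bm_cst|exact: sq].
Qed.

Let against_gq : \int[tensor nu']_z (gq z * S z) = tau.
Proof.
rewrite int_against// int_gq1 mulr1 big1 ?addr0// => j _.
rewrite -(int_v j); apply: int_ae => //; first by apply: bmM => //; exact: bm_int_upd.
by apply: filterS (sq j) => y; rewrite /marginal -/gq => ->; rewrite mulr1.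
Qed.

Let j0 := Ordinal m_gt0.
Let err := \int[nu' j0]_y marginal_error j0 y.

Let int_gp : \int[tensor nu']_z gp z = 1 - err.
Proof.
rewrite /err intB ?int_cst//; last exact: bm_cst.
by rewrite /marginal -(int_upd nu' j0 bgp); ring.
Qed.

Let against_gp : \int[tensor nu']_z (gp z * S z) =
  tau * (1 - err) - \sum_j \int[nu' j]_y (v j y * marginal_error j y).
Proof.
rewrite int_against// int_gp; congr (_ + _); rewrite -sumrN; apply: eq_bigr => j _.
have be := bm_marginal_error j.
rewrite -[RHS]add0r -(int_v j) -intB//; last exact: bmM.
by apply: eq_Rintegral => y _; rewrite /marginal_error /marginal -/gp; ring.
Qed.

Let delta := expR (- b) * expR (- M).

Let delta0 : 0 < delta. Proof. by rewrite mulr_gt0 ?expR_gt0. Qed.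

(** Monotonicity of the exponential bounds [S ^+ 2] by [(gq - gp) * S]. As [S] is a
    sum of functions of one coordinate, the integral of the latter involves only
    the marginals of [gq], which are exact, and those of [gp], whose defect is
    [marginal_error]. *)
Let coercive : delta * I2 <= tau * err + \sum_j \int[nu' j]_y (v j y * marginal_error j y).
Proof.
have -> : tau * err + \sum_j \int[nu' j]_y (v j y * marginal_error j y) =
    \int[tensor nu']_z ((gq z - gp z) * S z).
  transitivity (\int[tensor nu']_z (gq z * S z) - \int[tensor nu']_z (gp z * S z)).
    by rewrite against_gq against_gp; ring.
  by rewrite -intB; [apply: eq_Rintegral => z _; ring|exact: bmM..].
rewrite /I2 -intZ; last exact: bmX.
apply: le_int; [by apply: bmZ; exact: bmX|by apply: bmM => //; exact: bmB|].
move=> z; have lp : - M <= totpot p z.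
  by have := totpot_bound ap z; rewrite ler_norml => /andP[].
have lq : - M <= totpot q z.
  by have := totpot_bound aq z; rewrite ler_norml => /andP[].
have h := expR_monotone lq lp.
have Kz := K_ge z; rewrite /gq /gp /gibbs -mulrBr -mulrA /delta -mulrA.
apply: ler_pM; [exact: expR_ge0| |exact: Kz|exact: h].
by rewrite mulr_ge0 ?expR_ge0 ?sqr_ge0.
Qed.

Let amgm (x y c : R) : 0 < c -> x * y <= c / 2 * x ^+ 2 + y ^+ 2 / (2 * c).
Proof.
move=> c0; rewrite -subr_ge0.
have -> : c / 2 * x ^+ 2 + y ^+ 2 / (2 * c) - x * y = (c * x - y) ^+ 2 / (2 * c).
  by field; rewrite gt_eqF.
by rewrite divr_ge0 ?sqr_ge0// mulr_ge0// ltW.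
Qed.

(** Empirical and population potentials differ, in mean square, by at most the
    defect of the population potentials in the empirical marginal constraints. *)
Lemma potential_stability :
  \int[tensor nu']_z ((totpot q z - totpot p z) ^+ 2) <=
  2 * m.+1%:R / (expR (- b) * expR (- M)) ^+ 2 *
  \sum_(j < m) \int[nu' j]_y (marginal_error j y ^+ 2).
Proof.
rewrite -/I2 -/delta -/total_error.
pose c := delta / m.+1%:R.
have c0 : 0 < c by rewrite divr_gt0.
have e2 j : 0 <= \int[nu' j]_y (marginal_error j y ^+ 2) by apply: int_ge0 => y; exact: sqr_ge0.
have err2 : err ^+ 2 <= total_error.
  apply: le_trans (sqr_int_le _ (bm_marginal_error j0)) _.
  by rewrite /total_error (bigD1 j0)//= lerDl sumr_ge0.
have h1 : tau * err <= c / 2 * I2 + total_error / (2 * c).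
  apply: le_trans (amgm _ _ c0) _; apply: lerD; first by rewrite ler_pM2l ?divr_gt0.
  by apply: ler_wpM2r => //; rewrite invr_ge0 mulr_ge0// ltW.
have h2 : \sum_j \int[nu' j]_y (v j y * marginal_error j y) <=
    m%:R * (c / 2 * I2) + total_error / (2 * c).
  rewrite /total_error mulr_suml.
  have -> : m%:R * (c / 2 * I2) = \sum_(j < m) c / 2 * I2.
    by rewrite sumr_const card_ord mulr_natl.
  rewrite -big_split/=; apply: ler_sum => j _.
  have be := bm_marginal_error j.
  apply: (@le_trans _ _ (\int[nu' j]_y (c / 2 * v j y ^+ 2 + (2 * c)^-1 * marginal_error j y ^+ 2))).
    apply: le_int; [exact: bmM|by apply: bmD; apply: bmZ; exact: bmX|].
    by move=> y; rewrite [X in _ + X]mulrC; exact: amgm.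
  rewrite intD; [|by apply: bmZ; exact: bmX..].
  rewrite !intZ; [|exact: bmX..].
  apply: lerD; first by rewrite ler_pM2l ?divr_gt0.
  by rewrite mulrC.
have h3 := coercive.
have hm : m.+1%:R = m%:R + 1 :> R by rewrite -natr1.
have hm1 : m%:R + 1 != 0 :> R by rewrite natr1 pnatr_eq0.
have h4 : delta * I2 <= delta / 2 * I2 + total_error / c.
  apply: le_trans h3 _; apply: le_trans (lerD h1 h2) _.
  rewrite le_eqVlt; apply/orP; left; apply/eqP.
  by rewrite /c hm; field; rewrite hm1 gt_eqF.
have h5 : I2 <= 2 / delta * (total_error / c).
  by rewrite mulrAC ler_pdivlMr// mulrC; move: h4; lra.
apply: le_trans h5 _; rewrite le_eqVlt; apply/orP; left; apply/eqP.
by rewrite /c hm; field; rewrite hm1 gt_eqF.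
Qed.

Lemma gibbs_diff_le eta : 0 < eta ->
  \int[tensor nu']_z `|gq z - gp z| <=
  expR M * (eta / 2 + I2 / (2 * eta)).
Proof.
move=> eta0; apply: (@le_trans _ _ (\int[tensor nu']_z
    (expR M * (eta / 2 + (2 * eta)^-1 * S z ^+ 2)))); last first.
  rewrite intZ; last by apply: bmD; [exact: bm_cst|apply: bmZ; exact: bmX].
  rewrite intD; [|exact: bm_cst|by apply: bmZ; exact: bmX].
  rewrite int_cst intZ; last exact: bmX.
  by rewrite -/I2 [I2 / _]mulrC.
apply: le_int; first by apply: bm_norm; exact: bmB.
  by apply: bmZ; apply: bmD; [exact: bm_cst|apply: bmZ; exact: bmX].
move=> z; rewrite /gq /gp /gibbs -mulrBr normrM.
have K1 : `|K z| <= 1.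
  by rewrite ger0_norm// (le_trans _ (K_ge z)) ?expR_ge0.
have uq : totpot q z <= M by rewrite (le_trans (ler_norm _))// (totpot_bound aq).
have up : totpot p z <= M by rewrite (le_trans (ler_norm _))// (totpot_bound ap).
apply: (@le_trans _ _ (1 * (expR M * `|totpot q z - totpot p z|))).
  by apply: ler_pM => //; exact: expRB_le.
rewrite mul1r ler_pM2l ?expR_gt0//.
have := amgm 1 `|S z| eta0; rewrite real_normK ?num_real// mul1r expr1n mulr1.
by rewrite [X in _ + X]mulrC.
Qed.

End stability.

(** * Fluctuation of a finite family of test functions *)

Section deviation.
Context (R : realType) (m d : nat) (alpha : 'I_m -> R) (eps : R).
Hypothesis m_gt0 : (0 < m)%N.
Hypothesis alpha_ge0 : forall j, 0 <= alpha j.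
Hypothesis alpha1 : \sum_(j < m) alpha j = 1.
Hypothesis eps0 : 0 < eps.
Local Notation V := 'rV[R]_d.

Let b := kernel_bound m d eps.
Let M := 2 * m%:R * b.
Let K := gibbs_kernel alpha eps : m.-tuple V -> R.
Let b0 : 0 <= b. Proof. exact: kernel_bound_ge0. Qed.
Let mK : measurable_fun setT K. Proof. exact: measurable_gibbs_kernel. Qed.
Let K_ge z : expR (- b) <= K z. Proof. exact: gibbs_kernel_ge. Qed.
Let K_le z : K z <= 1. Proof. exact: gibbs_kernel_le. Qed.

Let gibbs_bound (mu : 'I_m -> probability V R) p : admissible mu b p ->
  forall z, `|gibbs K p z| <= expR M.
Proof.
move=> ap z; rewrite ger0_norm; last exact/ltW/(gibbs_gt0 K_ge).
rewrite -[leRHS]mul1r ler_pM ?expR_ge0 ?ler_expR//.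
by rewrite (le_trans (ler_norm _))// (totpot_bound ap).
Qed.

Variable nu : 'I_m -> probability V R.
Hypothesis nu_cube : forall j, nu j (@cube R d) = 1%E.
Context dO (O : measurableType dO) (P : probability O R) (N : nat).
Variable X : 'I_m -> 'I_N -> {RV P >-> V}.
Hypothesis N2 : (2 <= N)%N.
Hypothesis iX : independent_samples nu X.

Definition in_cube (w : O) := forall j l, @cube R d (X j l w).

Lemma ae_in_cube : {ae P, forall w, in_cube w}.
Proof.
apply: ae_forall => j; apply: ae_forall => l; apply: ae_prob1.
  by apply: measurable_pre; [exact: measurable_funPT|exact: measurable_cube].
by have [dX _] := iX; rewrite -(nu_cube j) -(dX j l _ (@measurable_cube R d)).
Qed.

Let N0 : (0 < N)%N. Proof. exact: ltnW. Qed.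

Lemma emp_cube w j : in_cube w -> emp X w j (@cube R d) = 1%E.
Proof.
move=> wc; rewrite /emp [LHS](empiricalE R (sample X w j) _ N0).
rewrite (eq_bigr (fun=> 1)); last by move=> k _; rewrite indicE mem_set//; exact: wc.
by rewrite sumr_const card_ord mulVf// pnatr_eq0 -lt0n.
Qed.

(* The constant of [potential_stability]. *)
Let stab := 2 * m.+1%:R / (expR (- b) * expR (- M)) ^+ 2.

Let stab_ge0 : 0 <= stab.
Proof. by rewrite divr_ge0 ?mulr_ge0// sqr_ge0. Qed.

Definition rate_const := (1 + m%:R * expR M ^+ 2) / 2 +
  expR M * (1 + stab * (m%:R * (m%:R * (1 + expR M) ^+ 2))) / 2.

(** For each test function, the fluctuation of the samples under the population
    density is an average over index tuples; the change of density is controlled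
    by stability, once for the whole family since only its total size [Lam]
    matters. *)
Lemma family_deviation (I : finType) (phi : I -> V -> R) (Lam : R) :
  (0 < #|I|)%N -> 0 < Lam -> (forall i, bm (phi i)) ->
  (forall x, \sum_i `|phi i x| <= Lam) ->
  exists G : O -> R, [/\ bm G, forall w, 0 <= G w,
    forall w, in_cube w ->
      \sum_i `|\int[MSB alpha eps nu]_x phi i x - \int[MSB alpha eps (emp X w)]_x phi i x| <= G w &
    \int[P]_w G w <= rate_const * Lam * Num.sqrt (#|I|%:R / N%:R)].
Proof.
move=> I0 Lam0 bphi phiL.
have [p ap sp] := schroedinger_system_solvable nu b0 mK K_ge K_le.
have bg := bm_gibbs mK K_ge K_le ap.
have gM := gibbs_bound ap.
pose F i z := phi i (average alpha z) * gibbs K p z.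
have bpa i : bm (fun z : m.-tuple V => phi i (average alpha z)).
  by apply: bm_comp => //; exact: measurable_funPT.
have bF i : bm (F i) by exact: bmM.
pose dev i w := \int[tensor (emp X w)]_z F i z - \int[tensor nu]_z F i z.
have bdev i : bm (dev i) by apply: bmB; [exact: bm_int_emp|exact: bm_cst].
pose err j w := \int[emp X w j]_y (marginal_error (emp X w) K p j y ^+ 2).
have errE j w : err j w = N%:R^-1 * \sum_(l < N)
    (\int[tensor (emp X w)]_z (1 - gibbs K p (upd z j (sample X w j l)))) ^+ 2.
  rewrite /err /emp int_empirical//; last first.
    by apply: bmX; exact: (bm_marginal_error (emp X w) mK K_ge K_le ap).
  congr (_ * _); apply: eq_bigr => l _; congr (_ ^+ 2).
  rewrite /marginal_error /marginal intB; [|exact: bm_cst|exact: bm_updz].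
  by rewrite int_cst.
have bF1 : bm (fun z => 1 - gibbs K p z) by apply: bmB => //; exact: bm_cst.
have berr j : bm (err j).
  rewrite (_ : err j = fun w => N%:R^-1 * \sum_(l < N)
    (\int[tensor (emp X w)]_z (1 - gibbs K p (upd z j (sample X w j l)))) ^+ 2);
    last by apply/funext => w; exact: errE.
  apply: bmZ; apply: bm_sum => l; apply: bmX.
  exact: (bm_slice X N2 j l bF1).
have err_ge0 j w : 0 <= err j w by apply: int_ge0 => y; exact: sqr_ge0.
have N0r : 0 < N%:R :> R by rewrite ltr0n.
have I0r : 0 < #|I|%:R :> R by rewrite ltr0n.
pose s : R := Num.sqrt N%:R; pose t : R := Num.sqrt #|I|%:R.
have s0 : 0 < s by rewrite sqrtr_gt0.
have t0 : 0 < t by rewrite sqrtr_gt0.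
have s2 : s ^+ 2 = N%:R by rewrite sqr_sqrtr// ltW.
have t2 : t ^+ 2 = #|I|%:R by rewrite sqr_sqrtr// ltW.
(* [theta] and [eta] are the expected sizes of one fluctuation and of the change of
   density; the inequality between arithmetic and geometric means at these
   values replaces first moments by second moments at no loss in the order. *)
pose eta := s^-1; pose theta := Lam / (s * t).
have eta0 : 0 < eta by rewrite invr_gt0.
have theta0 : 0 < theta by rewrite divr_gt0// mulr_gt0.
pose G w := \sum_i (theta / 2 + (2 * theta)^-1 * dev i w ^+ 2) +
  Lam * (expR M * (eta / 2 + (stab / (2 * eta)) * \sum_j err j w)).
have bG : bm G.
  apply: bmD.
    by apply: bm_sum => i; apply: bmD; [exact: bm_cst|apply: bmZ; exact: bmX].
  apply: bmZ; apply: bmZ; apply: bmD; first exact: bm_cst.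
  by apply: bmZ; exact: bm_sum.
exists G; split => //.
- move=> w; rewrite addr_ge0//.
    apply: sumr_ge0 => i _; have th2 : 0 <= (2 * theta)^-1 by rewrite invr_ge0 mulr_ge0// ltW.
    by rewrite addr_ge0 ?(mulr_ge0 th2) ?sqr_ge0// divr_ge0// ltW.
  rewrite mulr_ge0 ?ltW// mulr_gt0 ?expR_gt0// ltr_wpDr ?divr_gt0//.
  by rewrite mulr_ge0 ?sumr_ge0// divr_ge0// mulr_ge0// ltW.
- move=> w wc.
  have [q aq sq] := schroedinger_system_solvable (emp X w) b0 mK K_ge K_le.
  have bgq := bm_gibbs mK K_ge K_le aq.
  have ec j := emp_cube j wc.
  have diff i : `|\int[MSB alpha eps nu]_x phi i x - \int[MSB alpha eps (emp X w)]_x phi i x| <=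
     `|dev i w| + \int[tensor (emp X w)]_z (`|phi i (average alpha z)| * `|gibbs K q z - gibbs K p z|).
    have -> : \int[MSB alpha eps nu]_x phi i x - \int[MSB alpha eps (emp X w)]_x phi i x =
      - dev i w - \int[tensor (emp X w)]_z (phi i (average alpha z) * (gibbs K q z - gibbs K p z)).
      transitivity (\int[tensor nu]_z F i z -
          \int[tensor (emp X w)]_z (phi i (average alpha z) * gibbs K q z)).
        by congr (_ - _); [exact: (int_MSB alpha_ge0 alpha1 eps0 nu_cube ap sp m_gt0)|
          exact: (int_MSB alpha_ge0 alpha1 eps0 ec aq sq m_gt0)].
      rewrite /dev; under [X in _ = _ - X]eq_Rintegral do rewrite mulrBr.
      by rewrite intB; [rewrite /F; ring|exact: bmM|exact: bmM].
    rewrite (le_trans (ler_normB _ _))// normrN lerD2l.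
    have bd : bm (fun z => phi i (average alpha z) * (gibbs K q z - gibbs K p z)).
      by apply: bmM => //; exact: bmB.
    rewrite (le_trans (le_norm_int _ bd))//.
    by under eq_Rintegral do rewrite normrM.
  apply: (le_trans (ler_sum _ (fun i _ => diff i))); rewrite big_split/=; apply: lerD.
    apply: ler_sum => i _; rewrite -subr_ge0.
    have -> : theta / 2 + (2 * theta)^-1 * dev i w ^+ 2 - `|dev i w| =
        (theta - `|dev i w|) ^+ 2 / (2 * theta).
      by rewrite -[dev i w ^+ 2]real_normK ?num_real//; field; rewrite gt_eqF.
    by rewrite divr_ge0 ?sqr_ge0// mulr_ge0// ltW.
  have bn : bm (fun z => `|gibbs K q z - gibbs K p z|) by apply: bm_norm; exact: bmB.
  rewrite -int_sum; last by move=> i; apply: bmM => //; exact: bm_norm.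
  apply: (@le_trans _ _ (\int[tensor (emp X w)]_z (Lam * `|gibbs K q z - gibbs K p z|))).
    apply: le_int; [by apply: bm_sum => i; apply: bmM => //; exact: bm_norm|exact: bmZ|].
    by move=> z; rewrite -mulr_suml ler_wpM2r.
  rewrite intZ// ler_pM2l//.
  apply: le_trans (gibbs_diff_le mK K_ge K_le ap aq eta0) _.
  rewrite ler_pM2l ?expR_gt0// lerD2l.
  have := potential_stability mK K_ge K_le m_gt0 ap aq sq.
  rewrite -/b -/M -/stab -/K => h; rewrite mulrAC ler_wpM2r//.
  by rewrite invr_ge0 mulr_ge0// ltW.
- have Edev i : \int[P]_w (dev i w ^+ 2) <= m%:R * (\int[tensor nu]_z (F i z ^+ 2)) / N%:R.
    exact: sqr_deviation.
  have SF : \sum_i \int[tensor nu]_z (F i z ^+ 2) <= (Lam * expR M) ^+ 2.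
    rewrite -int_sum; last by move=> i; exact: bmX.
    apply: le_int_cst; first by apply: bm_sum => i; exact: bmX.
    move=> z; apply: (@le_trans _ _ ((\sum_i `|F i z|) ^+ 2)).
      rewrite expr2 mulr_suml; apply: ler_sum => i _.
      rewrite -real_normK ?num_real// expr2 ler_wpM2l//.
      by rewrite (bigD1 i)//= lerDl sumr_ge0.
    apply: sqr_le_norm; rewrite ger0_norm ?sumr_ge0//.
    under eq_bigr do rewrite normrM.
    rewrite -mulr_suml ler_pM ?sumr_ge0//; exact: gM.
  have Eerr j : \int[P]_w err j w <= m%:R * (1 + expR M) ^+ 2 / N%:R.
    under eq_Rintegral do rewrite errE.
    rewrite intZ; last by apply: bm_sum => l; apply: bmX; exact: (bm_slice X N2 j l bF1).
    rewrite int_sum; last by move=> l; apply: bmX; exact: (bm_slice X N2 j l bF1).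
    rewrite mulrC ler_pdivrMr//.
    apply: (@le_trans _ _ (\sum_(l < N) m%:R * (1 + expR M) ^+ 2 / N%:R)); last first.
      by rewrite sumr_const card_ord mulr_natr.
    apply: ler_sum => l _.
    apply: (sqr_deviation_slice N2 iX (j := j) l bF1).
      by move=> z; rewrite (le_trans (ler_normB _ _))// normr1 lerD2l.
    apply: filterS (sp j) => y; rewrite /marginal => h.
    rewrite intB; [|exact: bm_cst|exact: bm_updz].
    by rewrite int_cst h subrr.
  have iG : \int[P]_w G w = #|I|%:R * (theta / 2) + (2 * theta)^-1 * \sum_i \int[P]_w (dev i w ^+ 2) +
      Lam * (expR M * (eta / 2 + stab / (2 * eta) * \sum_j \int[P]_w err j w)).
    have bi i : bm (fun w => theta / 2 + (2 * theta)^-1 * dev i w ^+ 2).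
      by apply: bmD; [exact: bm_cst|apply: bmZ; exact: bmX].
    have be : bm (fun w => eta / 2 + stab / (2 * eta) * \sum_j err j w).
      by apply: bmD; [exact: bm_cst|apply: bmZ; exact: bm_sum].
    rewrite intD; [|exact: bm_sum|by apply: bmZ; exact: bmZ].
    congr (_ + _).
      rewrite int_sum//.
      under eq_bigr => i _.
        rewrite intD; [|exact: bm_cst|by apply: bmZ; exact: bmX].
        rewrite int_cst intZ; last exact: bmX.
        over.
      transitivity (\sum_(i : I) (theta / 2 + (2 * theta)^-1 * \int[P]_x (dev i x ^+ 2))).
        by [].
      by rewrite big_split/= sumr_const -[(theta / 2) *+ _]mulr_natl -mulr_sumr.
    rewrite intZ; last exact: bmZ.
    rewrite intZ//; congr (_ * (_ * _)).
    rewrite intD; [|exact: bm_cst|by apply: bmZ; exact: bm_sum].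
    by rewrite int_cst intZ ?int_sum//; exact: bm_sum.
  rewrite iG.
  have h1 : \sum_i \int[P]_w (dev i w ^+ 2) <= m%:R * (Lam * expR M) ^+ 2 / N%:R.
    apply: le_trans (ler_sum _ (fun i _ => Edev i)) _.
    by rewrite -mulr_suml -mulr_sumr ler_pM2r ?invr_gt0// ler_wpM2l.
  have h2 : \sum_(j < m) \int[P]_w err j w <= m%:R * (m%:R * (1 + expR M) ^+ 2 / N%:R).
    apply: le_trans (ler_sum _ (fun j _ => Eerr j)) _.
    by rewrite sumr_const card_ord -[_ *+ m]mulr_natl.
  apply: (@le_trans _ _ (#|I|%:R * (theta / 2) + (2 * theta)^-1 * (m%:R * (Lam * expR M) ^+ 2 / N%:R) +
      Lam * (expR M * (eta / 2 + stab / (2 * eta) * (m%:R * (m%:R * (1 + expR M) ^+ 2 / N%:R)))))).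
    apply: lerD.
      by rewrite lerD2l ler_wpM2l// invr_ge0 mulr_ge0// ltW.
    rewrite ler_pM2l// ler_pM2l ?expR_gt0// lerD2l ler_wpM2l//.
    by rewrite divr_ge0// mulr_ge0// ltW.
  have sqE : Num.sqrt (#|I|%:R / N%:R) = t / s :> R by rewrite sqrtrM ?sqrtrV// ltW.
  rewrite sqE -t2 -s2 /theta /eta /rate_const.
  have t1 : 1 <= t by rewrite -[leLHS]sqrtr1 ler_sqrt ?ler1n// ltW.
  set B := stab * (m%:R * (m%:R * (1 + expR M) ^+ 2)).
  have B0 : 0 <= B by rewrite /B !mulr_ge0// sqr_ge0.
  apply: (@le_trans _ _ ((1 + m%:R * expR M ^+ 2) / 2 * Lam * (t / s) +
     expR M * (1 + B) / 2 * Lam * (1 / s))).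
    rewrite le_eqVlt; apply/orP; left; apply/eqP; rewrite /B.
    move: (lt0r_neq0 s0) (lt0r_neq0 t0) (lt0r_neq0 Lam0).
    move: (stab) (expR M) (m%:R : R) (s) (t) (Lam) => S E m' s' t' L s'0 t'0 L0.
    by field; rewrite s'0 t'0 L0.
  rewrite [leRHS](_ : _ = (1 + m%:R * expR M ^+ 2) / 2 * Lam * (t / s) +
     expR M * (1 + B) / 2 * Lam * (t / s)); last first.
    by move: (B) (expR M) (m%:R : R) (t / s) => *; ring.
  rewrite lerD2l ler_wpM2l//.
    by rewrite !mulr_ge0 ?expR_ge0 ?invr_ge0 ?addr_ge0// ltW.
  by rewrite ler_pM2r ?invr_gt0.
Qed.

Lemma rate_const_gt0 : 0 < rate_const.
Proof.
rewrite /rate_const; apply: ltr_pwDl.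
  by rewrite divr_gt0//; apply: ltr_pwDl => //; rewrite mulr_ge0// sqr_ge0.
by rewrite divr_ge0// mulr_ge0 ?expR_ge0// addr_ge0// mulr_ge0// mulr_ge0// mulr_ge0// sqr_ge0.
Qed.

End deviation.

(** * Taylor polynomials along coordinate lines *)

Section line_taylor.
Context (R : realType) (d : nat).
Implicit Types (x : 'rV[R]_d) (i : 'I_d) (f : 'rV[R]_d -> R).
Local Notation cube := (@cube R d).

Definition setc x i (t : R) : 'rV[R]_d := \row_j (if j == i then t else x 0 j).

Lemma setcE x i t j : setc x i t 0 j = if j == i then t else x 0 j.
Proof. by rewrite mxE. Qed.

Lemma setc_id x i : setc x i (x 0 i) = x.
Proof. by apply/rowP => j; rewrite setcE; case: eqP => [->|]. Qed.

Lemma setc_setc x i s t : setc (setc x i s) i t = setc x i t.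
Proof. by apply/rowP => j; rewrite !setcE; case: eqP. Qed.

Lemma setcD x i s t : setc x i s + t *: delta_mx 0 i = setc x i (s + t).
Proof.
apply/rowP => j; rewrite mxE !setcE !mxE eqxx/=.
by case: eqP => _; rewrite ?mulr1 ?mulr0 ?addr0.
Qed.

Lemma cube_setc x i t : cube x -> -1 <= t <= 1 -> cube (setc x i t).
Proof. by move=> xc t1 j; rewrite setcE; case: eqP. Qed.

Lemma continuous_setc x i : continuous (setc x i : R -> 'rV[R]_d).
Proof.
move=> t; apply/cvg_ballP => e e0; near=> s; split=> // k j.
rewrite /ball/= !mxE; case: eqP => _; last by rewrite subrr normr0.
by near: s; apply: (@cvgr_dist_lt _ _ _ (nbhs t) _ id).
Unshelve. all: by end_near. Qed.

Lemma line_continuous f x i : cube x -> {within cube, continuous f} ->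
  {within `[-1, 1], continuous (fun t => f (setc x i t))}.
Proof.
move=> xc /subspace_continuousP cf; apply/subspace_continuousP => t /=.
rewrite in_itv/= => t1.
apply: cvg_trans (cf _ (cube_setc i xc t1)).
apply: (@cvg_comp _ _ _ (setc x i) f) => //.
move=> A nA; have {}nA : \forall y \near setc x i t, cube y -> A (f y) := nA.
change (\forall s \near t, `[-1, 1]%classic s -> A (f (setc x i s))).
have := continuous_setc (x := x) (i := i) nA.
by apply: (@filterS R (nbhs t)) => s As s1; apply: As; exact: cube_setc.
Qed.

(** Away from the endpoints of a line of the cube, the increments allowed in the
    definition of the partial derivative are all the small ones. *)
Lemma line_is_derive f x i t : cube x -> -1 < t < 1 ->
  cvg (partial_quotient i f (setc x i t) @ partial_filter cube i (setc x i t)) ->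
  is_derive t 1 (fun s => f (setc x i s)) (partial cube i f (setc x i t)).
Proof.
move=> xc /andP[t1 t2] cf.
have fE : partial_filter cube i (setc x i t) = 0^'.
  apply/seteqP; split=> A; rewrite /partial_filter /within/=.
    move=> nA; have near1 : \forall s \near (0:R)^', `|s| < Num.min (1 - t) (t + 1).
      apply: dnbhs0_lt; rewrite lt_min !subr_gt0 t2/=; lra.
    apply: filterS2 nA near1 => s As; rewrite lt_min => /andP[s1 s2].
    apply: As => /=; rewrite setcD; apply: cube_setc => //.
    by move: s1 s2; rewrite !ltr_norml => /andP[a b] /andP[a' b']; lra.
  by apply: filterS => s As _.
have qE : partial_quotient i f (setc x i t) =
    (fun h => h^-1 *: (f (setc x i (h *: 1 + t)) - f (setc x i t))).
  apply/funext => h; rewrite /partial_quotient setcD.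
  by rewrite /GRing.scale/= mulr1 (addrC h).
by split; [rewrite /derivable|rewrite /derive /partial]; rewrite -?qE -?fE.
Qed.

(** Taylor's formula in one direction, by induction on the order: the difference
    between [f] and a primitive of the polynomial found for its derivative has a
    small derivative. Only iterated derivatives in that direction enter. *)
Lemma taylor_line n f x i (a r E : R) : cube x -> 0 <= r -> -1 <= a -> a + r <= 1 ->
  class_C cube n f ->
  (forall t : R, a <= t <= a + r -> `|iter n (partial cube i) f (setc x i t) -
     iter n (partial cube i) f (setc x i a)| <= E) ->
  exists2 p : {poly R}, (size p <= n.+1)%N &
    forall t : R, a <= t <= a + r -> `|f (setc x i t) - p.[t]| <= E * r ^+ n.
Proof.
move=> xc r0 a1 ar1; elim: n f => [|n IH] f /=.
  move=> _ hE; exists (f (setc x i a))%:P; first by rewrite size_polyC; case: eqP.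
  by move=> t /hE; rewrite hornerC expr0 mulr1.
move=> [cf /(_ i)[df cdf]] hE.
have [p sp hp] : exists2 p : {poly R}, (size p <= n.+1)%N & forall t : R, a <= t <= a + r ->
    `|partial cube i f (setc x i t) - p.[t]| <= E * r ^+ n.
  apply: IH => // t /hE; by rewrite -!iterSr.
pose q0 : {poly R} := \poly_(k < n.+2) (p`_k.-1 / k%:R).
have q0p : q0^`() = p.
  apply/polyP => k; rewrite coef_deriv coef_poly/= ltnS.
  case: ltnP => h; first by rewrite -[_ *+ _]mulr_natr divfK// pnatr_eq0.
  by rewrite mul0rn nth_default// (leq_trans sp).
pose q := q0 + (f (setc x i a) - q0.[a])%:P.
have qp : q^`() = p by rewrite derivD derivC addr0.
exists q.
  by rewrite (leq_trans (size_polyD _ _))// geq_max size_poly (leq_trans (size_polyC_leq1 _)).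
move=> t /andP[at1 tr]; pose w s := f (setc x i s) - q.[s].
have wa : w a = 0 by rewrite /w /q hornerD hornerC; ring.
have sub : `[a, t] `<=` `[-1, 1].
  by move=> s; rewrite /= !in_itv/= => /andP[? ?]; apply/andP; split; lra.
have cfx := continuous_subspaceW sub (line_continuous (i := i) xc cf).
have cq : {within `[a, t], continuous (horner q)}.
  by apply: continuous_subspaceT; exact: continuous_horner.
have cw : {within `[a, t], continuous w} by move=> s; apply: cvgB; [exact: cfx|exact: cq].
have dw s : s \in `]a, t[%R -> is_derive s 1 w (partial cube i f (setc x i s) - p.[s]).
  rewrite in_itv/= => /andP[s1 s2]; apply: is_deriveB.
    apply: line_is_derive => //; first by apply/andP; split; lra.
    by apply: df; apply: cube_setc => //; apply/andP; split; lra.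
  have := @derivable_horner R q s; move=> /derivableP; rewrite -derive1E -derivE qp.
  by [].
have [c cat] := MVT_segment at1 dw cw.
rewrite wa subr0 /w => ->; move: cat; rewrite in_itv/= => /andP[c1 c2].
rewrite normrM exprSr mulrA ler_pM//; first by apply: hp; apply/andP; split; lra.
by rewrite ger0_norm; lra.
Qed.

End line_taylor.

(** * Tensor Lagrange interpolation on a box *)

Section lagrange_interpolation.
Context (R : realType) (d n : nat).
Implicit Types (r a t y : R) (q : 'I_n.+1).
Implicit Types (x lo : 'rV[R]_d) (i : 'I_d) (g : 'rV[R]_d -> R) (k : {ffun 'I_d -> 'I_n.+1}).

(** Equally spaced nodes; dividing by [n.+1] rather than [n] also covers [n = 0]. *)
Definition node (q : nat) : R := q%:R / n.+1%:R.

Lemma node_inj : injective node.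
Proof.
move=> q r /(congr1 (fun t => t * n.+1%:R)); rewrite !divfK ?pnatr_eq0//.
by move=> /eqP; rewrite eqr_nat => /eqP.
Qed.

Lemma node_itv (q : 'I_n.+1) : 0 <= node q <= 1.
Proof.
by rewrite divr_ge0//= ler_pdivrMr ?ltr0n// mul1r ler_nat ltnW.
Qed.

Let localK a r t : r != 0 -> (a + r * t - a) / r = t.
Proof. by move=> r0; field. Qed.

Definition node_basis (q : 'I_n.+1) : {poly R} := tnth (lagrange n.+1 node) q.

Lemma basis_node (q q' : 'I_n.+1) : (node_basis q).[node q'] = (q == q')%:R.
Proof. by apply: lagrange_sample => //; exact: node_inj. Qed.

Lemma size_basis q : size (node_basis q) = n.+1.
Proof. by apply: size_lagrange_ => //; exact: node_inj. Qed.

Lemma basis_reproduce (p : {poly R}) (a r y : R) : (size p <= n.+1)%N -> r != 0 ->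
  p.[y] = \sum_q (node_basis q).[(y - a) / r] * p.[a + r * node q].
Proof.
move=> sp r0; pose l : {poly R} := r%:P * 'X + a%:P.
have le t : l.[t] = a + r * t by rewrite hornerD hornerC hornerCM hornerX addrC.
have spl : (size (p \Po l) <= n.+1)%N.
  have [p0|p0] := eqVneq p 0; first by rewrite p0 comp_poly0 size_poly0.
  have sl : (size l).-1 = 1%N.
    by rewrite size_polyDl ?size_Cmul ?size_polyX// (leq_ltn_trans (size_polyC_leq1 _)).
  rewrite (leq_trans (leqSpred _))// size_comp_poly sl muln1.
  by rewrite prednK// size_poly_gt0.
have -> : p.[y] = (p \Po l).[(y - a) / r].
  by rewrite horner_comp le mulrC divfK// addrC subrK.
rewrite {1}(lagrange_gen (x := node) _ _ spl)//; last exact: node_inj.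
rewrite horner_sum; apply: eq_bigr => q _.
by rewrite hornerM hornerC horner_comp le mulrC.
Qed.

Lemma sum_basis t : \sum_q (node_basis q).[t] = 1.
Proof.
have := @basis_reproduce 1 0 1 t; rewrite size_poly1 hornerC => /(_ isT (oner_neq0 _)) ->.
by apply: eq_bigr => q _; rewrite hornerC mulr1 subr0 divr1.
Qed.

(** A bound for the Lebesgue constant of the nodes. *)
Definition lebesgue : R := \sum_(q < n.+1) \sum_(j < n.+1) `|(node_basis q)`_j|.

Lemma sum_norm_basis t : 0 <= t <= 1 -> \sum_q `|(node_basis q).[t]| <= lebesgue.
Proof.
move=> /andP[t0 t1]; apply: ler_sum => q _; rewrite horner_coef size_basis.
apply: le_trans (ler_norm_sum _ _ _) _; apply: ler_sum => j _.
by rewrite normrM ler_piMr// normrX exprn_ile1// ger0_norm.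
Qed.

Lemma lebesgue_ge1 : 1 <= lebesgue.
Proof.
apply: le_trans (@sum_norm_basis 0 _); last by rewrite lexx ler01.
by rewrite -[leLHS](normr1 R) -(sum_basis 0); exact: ler_norm_sum.
Qed.

Definition weight lo (r : R) k x := \prod_i (node_basis (k i)).[(x 0 i - lo 0 i) / r].

Definition gridpoint lo (r : R) k : 'rV[R]_d := \row_i (lo 0 i + r * node (k i)).

Definition interp lo (r : R) g x := \sum_k weight lo r k x * g (gridpoint lo r k).

Definition in_box lo (r : R) x := forall i, lo 0 i <= x 0 i <= lo 0 i + r.

Lemma in_box_local lo r x i : 0 < r -> in_box lo r x -> 0 <= (x 0 i - lo 0 i) / r <= 1.
Proof.
move=> r0 /(_ i)/andP[h1 h2].
apply/andP; split; first by rewrite divr_ge0 ?subr_ge0 ?(ltW r0).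
by rewrite ler_pdivrMr// mul1r lerBlDl.
Qed.

Lemma in_box_gridpoint lo r k : 0 < r -> in_box lo r (gridpoint lo r k).
Proof.
move=> r0 i; rewrite mxE; have /andP[h0 h1] := node_itv (k i).
by rewrite lerDl mulr_ge0 ?(ltW r0)//= lerD2l ler_piMr// ltW.
Qed.

Lemma in_box_setc lo r x i t : in_box lo r x -> lo 0 i <= t <= lo 0 i + r ->
  in_box lo r (setc x i t).
Proof. by move=> xb tb j; rewrite setcE; case: eqP => [->|]. Qed.

Lemma node_box (a r : R) (q : 'I_n.+1) : 0 < r -> a <= a + r * node q <= a + r.
Proof.
move=> r0; have /andP[h0 h1] := node_itv q.
by rewrite lerDl mulr_ge0 ?(ltW r0)//= lerD2l ler_piMr// ltW.
Qed.

Lemma sum_weight lo r x : \sum_k weight lo r k x = 1.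
Proof.
rewrite /weight -(bigA_distr_bigA (fun i q => (node_basis q).[(x 0 i - lo 0 i) / r])).
by rewrite big1// => i _; exact: sum_basis.
Qed.

Lemma sum_norm_weight lo r x : 0 < r -> in_box lo r x ->
  \sum_k `|weight lo r k x| <= lebesgue ^+ d.
Proof.
move=> r0 xb; under eq_bigr do rewrite /weight normr_prod.
rewrite -(bigA_distr_bigA (fun i q => `|(node_basis q).[(x 0 i - lo 0 i) / r]|)).
rewrite -[in leRHS](card_ord d) -prodr_const; apply: ler_prod => i _.
rewrite sumr_ge0//=; apply: sum_norm_basis; exact: in_box_local.
Qed.

Lemma interp_weight lo lo' r r' k' x : r != 0 -> r' != 0 ->
  interp lo r (weight lo' r' k') x = weight lo' r' k' x.
Proof.
move=> r0 r'0; rewrite /interp /weight.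
transitivity (\sum_(k : {ffun 'I_d -> 'I_n.+1}) \prod_(i < d) ((node_basis (k i)).[(x 0 i - lo 0 i) / r] *
    (node_basis (k' i)).[(lo 0 i + r * node (k i) - lo' 0 i) / r'])).
  apply: eq_bigr => k _; rewrite big_split/=; congr (_ * _).
  by apply: eq_bigr => i _; rewrite mxE.
rewrite -(bigA_distr_bigA (fun i q => (node_basis q).[(x 0 i - lo 0 i) / r] *
    (node_basis (k' i)).[(lo 0 i + r * node q - lo' 0 i) / r'])).
apply: eq_bigr => i _.
pose l : {poly R} := (r'^-1)%:P * ('X - (lo' 0 i)%:P).
have lE t : l.[t] = (t - lo' 0 i) / r'.
  by rewrite hornerCM hornerD hornerN hornerX hornerC mulrC.
have r'V : r'^-1 != 0 by rewrite invr_eq0.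
have sl : (size (node_basis (k' i) \Po l) <= n.+1)%N.
  have [p0|p0] := eqVneq (node_basis (k' i)) 0; first by rewrite p0 comp_poly0 size_poly0.
  rewrite (leq_trans (leqSpred _))// size_comp_poly size_Cmul// size_XsubC muln1.
  by rewrite prednK ?size_poly_gt0// size_basis.
rewrite -lE -horner_comp [RHS](basis_reproduce (lo 0 i) _ sl r0).
by apply: eq_bigr => q _; rewrite horner_comp lE.
Qed.

(** Polynomials of degree at most [n] in each variable are reproduced on any box,
    so the difference of two interpolants can be expanded on the finer grid. *)
Lemma interp_interp lo lo' r r' g x : r != 0 -> r' != 0 ->
  interp lo r (interp lo' r' g) x = interp lo' r' g x.
Proof.
move=> r0 r'0; rewrite {1}/interp /interp.
under eq_bigr do rewrite mulr_sumr.
rewrite exchange_big/=; apply: eq_bigr => k' _.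
rewrite -(interp_weight lo lo' k' x r0 r'0) /interp mulr_suml.
by apply: eq_bigr => k _; rewrite mulrA.
Qed.

(** Interpolation in the coordinates of [s] only. *)
Let hybrid lo r (s : seq 'I_d) x k : 'rV[R]_d :=
  \row_i (if i \in s then lo 0 i + r * node (k i) else x 0 i).
Let pinterp lo r s g x := \sum_k weight lo r k x * g (hybrid lo r s x k).

(* The sum over grid indices always runs over all coordinates. At a node only one
   basis polynomial is nonzero, which makes the index of the new coordinate
   agree with the node where it was frozen. *)
Let pinterp_cons lo r i s g x : r != 0 -> i \notin s ->
  pinterp lo r (i :: s) g x =
  \sum_q (node_basis q).[(x 0 i - lo 0 i) / r] *
    pinterp lo r s g (setc x i (lo 0 i + r * node q)).
Proof.
move=> r0 is_; under [RHS]eq_bigr do rewrite mulr_sumr.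
rewrite exchange_big/=; apply: eq_bigr => k _.
rewrite (bigD1 (k i))//= big1 ?addr0.
  rewrite mulrA; congr (_ * g _).
    rewrite /weight (bigD1 i)//= [X in _ = _ * X](bigD1 i)//= setcE eqxx.
    rewrite localK// basis_node eqxx mul1r; congr (_ * _).
    by apply: eq_bigr => j ji; rewrite setcE (negPf ji).
  apply/rowP => j; rewrite !mxE inE; case: eqP => [->|] //=.
  by rewrite (negPf is_).
move=> q qk; rewrite /weight (bigD1 i)//= setcE eqxx localK//.
by rewrite basis_node eq_sym (negPf qk) !(mul0r, mulr0).
Qed.

Variables (lo : 'rV[R]_d) (r E : R) (g : 'rV[R]_d -> R).
Hypothesis r0 : 0 < r.
Hypothesis E0 : 0 <= E.
Hypothesis line_approx : forall x i, in_box lo r x ->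
  exists2 p : {poly R}, (size p <= n.+1)%N &
    forall t, lo 0 i <= t <= lo 0 i + r -> `|g (setc x i t) - p.[t]| <= E.

Let line_error x i : in_box lo r x ->
  `|g x - \sum_q (node_basis q).[(x 0 i - lo 0 i) / r] * g (setc x i (lo 0 i + r * node q))| <=
  (1 + lebesgue) * E.
Proof.
move=> xb; have [p sp hp] := line_approx i xb.
have -> : g x - \sum_q (node_basis q).[(x 0 i - lo 0 i) / r] * g (setc x i (lo 0 i + r * node q)) =
  (g (setc x i (x 0 i)) - p.[x 0 i]) - \sum_q (node_basis q).[(x 0 i - lo 0 i) / r] *
   (g (setc x i (lo 0 i + r * node q)) - p.[lo 0 i + r * node q]).
  under [X in _ = _ - X]eq_bigr do rewrite mulrBr.
  rewrite sumrB -(basis_reproduce (lo 0 i) (x 0 i) sp (lt0r_neq0 r0)) setc_id.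
  by move: (\sum_q _) => S; ring.
apply: le_trans (ler_normB _ _) _; rewrite [leRHS]mulrDl [1 * E]mul1r; apply: lerD; first by apply: hp; exact: xb.
apply: le_trans (ler_norm_sum _ _ _) _.
apply: (@le_trans _ _ (\sum_q `|(node_basis q).[(x 0 i - lo 0 i) / r]| * E)).
  by apply: ler_sum => q _; rewrite normrM ler_wpM2l//; apply: hp; exact: node_box.
by rewrite -mulr_suml ler_wpM2r// sum_norm_basis// in_box_local.
Qed.

Let pinterp_error s x : uniq s -> in_box lo r x ->
  `|g x - pinterp lo r s g x| <= (size s)%:R * (1 + lebesgue) ^+ size s * E.
Proof.
have L1 := lebesgue_ge1; have L0 : 0 <= lebesgue by rewrite (le_trans ler01).
elim: s x => [|i s IH] x /=.
  move=> _ _; rewrite /pinterp.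
  under eq_bigr => k _.
    rewrite (_ : hybrid lo r [::] x k = x); last by apply/rowP => j; rewrite mxE.
    over.
  by rewrite -mulr_suml sum_weight mul1r subrr normr0 !mul0r.
move=> /andP[is_ us] xb; rewrite pinterp_cons ?gt_eqF//.
pose z q := setc x i (lo 0 i + r * node q).
have -> : g x - \sum_q (node_basis q).[(x 0 i - lo 0 i) / r] * pinterp lo r s g (z q) =
  (g x - \sum_q (node_basis q).[(x 0 i - lo 0 i) / r] * g (z q)) +
  \sum_q (node_basis q).[(x 0 i - lo 0 i) / r] * (g (z q) - pinterp lo r s g (z q)).
  under [X in _ = _ + X]eq_bigr do rewrite mulrBr.
  by rewrite sumrB addrA subrK.
apply: le_trans (ler_normD _ _) _.
set e := (size s)%:R * _ * E in IH.
have e0 : 0 <= e by rewrite !mulr_ge0 ?exprn_ge0 ?addr_ge0.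
apply: (@le_trans _ _ ((1 + lebesgue) * E + lebesgue * e)).
  apply: lerD; first exact: line_error.
  apply: le_trans (ler_norm_sum _ _ _) _.
  apply: (@le_trans _ _ (\sum_q `|(node_basis q).[(x 0 i - lo 0 i) / r]| * e)).
    apply: ler_sum => q _; rewrite normrM ler_wpM2l//; apply: IH => //.
    by apply: in_box_setc => //; exact: node_box.
  by rewrite -mulr_suml ler_wpM2r// sum_norm_basis// in_box_local.
rewrite -natr1 [leRHS](_ : _ = (1 + lebesgue) ^+ (size s).+1 * E +
  (size s)%:R * (1 + lebesgue) ^+ (size s).+1 * E); last by ring.
apply: lerD; last first.
  rewrite /e exprS; apply: (@le_trans _ _ ((1 + lebesgue) * ((size s)%:R * (1 + lebesgue) ^+ size s * E))).
    by rewrite ler_wpM2r// lerDr.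
  by rewrite le_eqVlt; apply/orP; left; apply/eqP; ring.
by rewrite ler_wpM2r// exprS ler_peMr ?addr_ge0// exprn_ege1// lerDl.
Qed.

(** Coordinates are interpolated one at a time; each step adds the error along a
    line and multiplies the previous one by the Lebesgue constant. Hence only
    approximation along coordinate lines is needed. *)
Lemma interp_error x : in_box lo r x ->
  `|g x - interp lo r g x| <= d%:R * (1 + lebesgue) ^+ d * E.
Proof.
move=> xb; have := pinterp_error (enum_uniq 'I_d) xb.
rewrite size_enum_ord; congr (`|_ - _| <= _); apply: eq_bigr => k _.
by congr (_ * g _); apply/rowP => j; rewrite !mxE mem_enum.
Qed.

End lagrange_interpolation.

(** * Dyadic cells of the cube *)

Section dyadic_cells.
Context (R : realType) (d : nat).
Local Notation V := 'rV[R]_d.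
Local Notation cube := (@cube R d).

(** The endpoint [1] is put in the last interval, so that the cells cover the
    closed cube. *)
Definition dyadic l (t : R) : nat := minn (Num.truncn ((t + 1) / 2 * 2 ^+ l)) (2 ^ l).-1.

Lemma dyadic_lt l t : (dyadic l t < 2 ^ l)%N.
Proof. by rewrite gtn_min ltn_predL expn_gt0 orbT. Qed.

Definition dyadic_index l := {ffun 'I_d -> 'I_(2 ^ l)}.

Definition cell l (x : V) : dyadic_index l := [ffun i => Ordinal (dyadic_lt l (x 0 i))].

Definition side l : R := 2 / 2 ^+ l.

Lemma side_gt0 l : 0 < side l. Proof. by rewrite divr_gt0 ?exprn_gt0. Qed.

Lemma sideS l : side l.+1 = side l / 2.
Proof. by rewrite /side exprS; field; rewrite expf_neq0. Qed.

Definition corner l (q : dyadic_index l) : V := \row_i (-1 + side l * (q i)%:R).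

Lemma dyadic_itv l (t : R) : -1 <= t <= 1 ->
  -1 + side l * (dyadic l t)%:R <= t <= -1 + side l * (dyadic l t)%:R + side l.
Proof.
move=> /andP[t1 t2]; have p0 : 0 < 2 ^+ l :> R by rewrite exprn_gt0.
pose y := (t + 1) / 2 * 2 ^+ l.
have y0 : 0 <= y by rewrite mulr_ge0 ?(ltW p0)// divr_ge0//; lra.
have yl : y <= 2 ^+ l by rewrite -[leRHS]mul1r ler_wpM2r ?(ltW p0)//; lra.
have tE : t = -1 + side l * y by rewrite /side /y; field; rewrite gt_eqF.
have /andP[h1 h2] := truncn_itv y0.
have -> : -1 + side l * (dyadic l t)%:R + side l = -1 + side l * ((dyadic l t).+1)%:R.
  by rewrite -natr1; ring.
rewrite [X in _ <= X <= _]tE [X in X && _]lerD2l lerD2l !ler_pM2l ?side_gt0//.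
rewrite /dyadic -/y; apply/andP; split.
  by apply: le_trans h1; rewrite ler_nat geq_minl.
have [hh|hh] := leqP (Num.truncn y) (2 ^ l).-1; first exact: ltW.
by rewrite prednK ?expn_gt0// natrX.
Qed.

Lemma in_box_cell l x : cube x -> in_box (corner (cell l x)) (side l) x.
Proof. by move=> xc i; rewrite !mxE ffunE/=; apply: dyadic_itv; exact: xc. Qed.

Lemma in_box_cube l (q : dyadic_index l) x : in_box (corner q) (side l) x -> cube x.
Proof.
move=> h i; have := h i; rewrite mxE => /andP[h1 h2].
have s0 := side_gt0 l; apply/andP; split.
  by apply: le_trans h1; rewrite lerDl mulr_ge0// ltW.
apply: le_trans h2 _; have := ltn_ord (q i); rewrite -(ler_nat R) natrX => h3.
have -> : -1 + side l * (q i)%:R + side l = -1 + side l * ((q i).+1)%:R by rewrite -natr1; ring.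
apply: (@le_trans _ _ (-1 + side l * 2 ^+ l)); first by rewrite lerD2l ler_pM2l.
by rewrite /side divfK ?expf_neq0//; lra.
Qed.

Lemma half_lt l (k : 'I_(2 ^ l.+1)) : (k./2 < 2 ^ l)%N.
Proof. by rewrite ltn_half_double -mul2n -expnS. Qed.

Definition parent l (q : dyadic_index l.+1) : dyadic_index l :=
  [ffun i => Ordinal (half_lt (q i))].

Lemma dyadic_half l (t : R) : -1 <= t -> (dyadic l.+1 t)./2 = dyadic l t.
Proof.
move=> t1; pose y := (t + 1) / 2 * 2 ^+ l; rewrite /dyadic.
have y0 : 0 <= y by rewrite mulr_ge0 ?exprn_ge0// divr_ge0//; lra.
have -> : (t + 1) / 2 * 2 ^+ l.+1 = 2 * y by rewrite /y exprS; ring.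
rewrite -/y; have /andP[h1 h2] := truncn_itv y0.
have y20 : 0 <= 2 * y by rewrite mulr_ge0.
have /andP[h3 h4] := truncn_itv y20.
have : (Num.truncn (2 * y))./2 = Num.truncn y.
  have a1 : ((Num.truncn y).*2 <= Num.truncn (2 * y))%N.
    by rewrite truncn_ge_nat// -mul2n natrM ler_pM2l.
  have a2 : (Num.truncn (2 * y) < (Num.truncn y).+1.*2)%N.
    by rewrite truncn_lt_nat// -mul2n natrM ltr_pM2l.
  lia.
have p2 : (0 < 2 ^ l)%N by rewrite expn_gt0.
rewrite expnS; move: (Num.truncn _) (Num.truncn _) => a b; lia.
Qed.

Lemma parent_cell l x : cube x -> parent (cell l.+1 x) = cell l x.
Proof.
move=> xc; apply/ffunP => i; rewrite !ffunE; apply: val_inj => /=.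
by apply: dyadic_half; have /andP[] := xc i.
Qed.

Lemma in_box_parent l (q : dyadic_index l.+1) x :
  in_box (corner q) (side l.+1) x -> in_box (corner (parent q)) (side l) x.
Proof.
move=> h i; have := h i; rewrite !mxE ffunE/= sideS => /andP[h1 h2].
have s0 := side_gt0 l.
have e1 : (q i)./2%:R * 2 <= (q i)%:R :> R by rewrite -natrM ler_nat; lia.
have e2 : (q i)%:R <= (q i)./2%:R * 2 + 1 :> R by rewrite -natrM natr1 ler_nat; lia.
have f1 := ler_wpM2l (ltW s0) e1; have f2 := ler_wpM2l (ltW s0) e2.
by apply/andP; split; nra.
Qed.

Lemma le_dyadic l k (t : R) : (0 < k)%N ->
  (k <= dyadic l t)%N = (k%:R <= (t + 1) / 2 * 2 ^+ l) && (k <= (2 ^ l).-1)%N.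
Proof. by case: k => // k _; rewrite leq_min truncn_gt_nat. Qed.

Lemma measurable_dyadic l k : measurable [set t : R | dyadic l t = k].
Proof.
have mle j : measurable [set t : R | (j <= dyadic l t)%N].
  case: j => [|j]; first by rewrite (_ : [set _ | _] = setT)//; apply/seteqP; split.
  have [h|h] := boolP (j.+1 <= (2 ^ l).-1)%N; last first.
    rewrite (_ : [set _ | _] = set0)//; apply/seteqP; split=> // t/=.
    by rewrite le_dyadic// (negPf h) andbF.
  rewrite (_ : [set _ | _] = `[side l * j.+1%:R - 1, +oo[%classic); first exact: measurable_itv.
  have p0 : 0 < 2 ^+ l :> R by rewrite exprn_gt0.
  have E t : (t + 1) / 2 * 2 ^+ l = (t + 1) / side l by rewrite /side; field; rewrite gt_eqF.
  apply/seteqP; split=> t; rewrite /= le_dyadic// h andbT in_itv/= andbT E ler_pdivlMr ?side_gt0//;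
    by rewrite mulrC lerBlDr.
rewrite (_ : [set _ | _] = [set t | (k <= dyadic l t)%N] `\` [set t | (k.+1 <= dyadic l t)%N]).
  exact: measurableD.
apply/seteqP; split=> t /=; first by move=> ->; split=> //; rewrite ltnn.
by move=> [h1] /negP; rewrite -leqNgt => h2; apply/eqP; rewrite eqn_leq h1 h2.
Qed.

Lemma measurable_cell l (q : dyadic_index l) : measurable [set x : V | cell l x = q].
Proof.
rewrite (_ : [set _ | _] = \bigcap_(i in [set: 'I_d])
    ((fun x : V => x 0 i) @^-1` [set t | dyadic l t = q i])).
  apply: fin_bigcap_measurable => // i _; rewrite -[_ @^-1` _]setTI.
  by apply: measurable_coord => //; exact: measurable_dyadic.
apply/seteqP; split=> x /=; first by move=> <- i _ /=; rewrite ffunE.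
by move=> h; apply/ffunP => i; rewrite ffunE; apply: val_inj; exact: (h i I).
Qed.

End dyadic_cells.

(** * Multiscale expansion of Hoelder functions *)

Section hoelder_lines.
Context (R : realType) (d : nat) (beta L : R).
Hypothesis d_gt0 : (0 < d)%N.
Hypothesis beta_gt0 : 0 < beta.
Local Notation V := 'rV[R]_d.
Local Notation cube := (@cube R d).
Local Notation n := (strict_floor beta).

Lemma strict_floor_le : n%:R <= beta.
Proof.
have c0 : (0 < Num.ceil beta)%R by rewrite ceil_gt0.
apply: ltW; rewrite /strict_floor.
have := ceilB1_lt beta; case: (Num.ceil beta) c0 => [[|k]|k]//= _.
by rewrite -addn1 PoszD addrK.
Qed.

Let pure (i : 'I_d) : 'I_d -> nat := fun j => if j == i then n else 0%N.

(* Of all the multi-indices in the Hoelder norm, only the multiples of a basis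
   vector are needed. *)
Let mderiv_pure i h : mderiv cube (pure i) h = iter n (partial cube i) h.
Proof.
have aux s : uniq s -> foldr (fun j g => iter (pure i j) (partial cube j) g) h s =
    if i \in s then iter n (partial cube i) h else h.
  elim: s => [//|j s IH] /= /andP[js us]; rewrite IH// inE /pure.
  by case: eqVneq => [<-|]//=; rewrite ?(negPf js)//.
by rewrite /mderiv aux ?enum_uniq// mem_enum.
Qed.

Let morder_pure i : morder (pure i) = n.
Proof. by rewrite /morder /pure -big_mkcond big_pred1_eq. Qed.

Let mderiv0 h : mderiv cube (fun=> 0%N) h = h.
Proof. by rewrite /mderiv; elim: (enum _). Qed.

Let seminorm (h : V -> R) : \bar R := ereal_sup [set ereal_sup
        [set (`|mderiv cube k h xy.1 - mderiv cube k h xy.2| /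
              enorm (xy.1 - xy.2) `^ (beta - n%:R))%:E
        | xy in [set xy | cube xy.1 /\ cube xy.2 /\ xy.1 <> xy.2]]
      | k in [set k | morder k = n]].

Let supnorm (h : V -> R) : \bar R := ereal_sup [set ereal_sup
  [set `|mderiv cube k h x|%:E | x in cube] | k in [set k | (morder k <= n)%N]].

Let supnorm_ge h x : cube x -> (`|h x|%:E <= supnorm h)%E.
Proof.
move=> xc; apply: (@le_trans _ _ (ereal_sup [set `|mderiv cube (fun=> 0%N) h x|%:E | x in cube])).
  by apply: ereal_sup_ubound; exists x => //; rewrite mderiv0.
apply: ereal_sup_ubound; exists (fun=> 0%N) => //=.
by rewrite /morder big1.
Qed.

Let seminorm_ge h i x t : cube x -> -1 <= t <= 1 -> t != x 0 i ->
  ((`|iter n (partial cube i) h (setc x i t) - iter n (partial cube i) h x| /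
    `|t - x 0 i| `^ (beta - n%:R))%:E <= seminorm h)%E.
Proof.
move=> xc t1 tx; apply: (@le_trans _ _ (ereal_sup
        [set (`|mderiv cube (pure i) h xy.1 - mderiv cube (pure i) h xy.2| /
              enorm (xy.1 - xy.2) `^ (beta - n%:R))%:E
        | xy in [set xy | cube xy.1 /\ cube xy.2 /\ xy.1 <> xy.2]])); last first.
  by apply: ereal_sup_ubound; exists (pure i) => //=.
apply: ereal_sup_ubound; exists (setc x i t, x) => /=.
  split; first exact: cube_setc.
  split=> // /(congr1 (fun y : V => y 0 i)); rewrite setcE eqxx => tE.
  by rewrite tE eqxx in tx.
rewrite mderiv_pure; congr (_ / _ `^ _)%:E.
rewrite /enorm (bigD1 i)//= big1 ?addr0.
  by rewrite !mxE eqxx sqrtr_sqr.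
by move=> j ji; rewrite !mxE (negPf ji) subrr expr0n.
Qed.

Variable h : V -> R.
Hypothesis hh : hoelder_class cube beta L h.

Let cube0 : cube 0. Proof. by move=> i; rewrite mxE; apply/andP; split; lra. Qed.

Let supnorm_ge0 : (0 <= supnorm h)%E.
Proof. by apply: le_trans (supnorm_ge h cube0); rewrite lee_fin. Qed.

Let seminorm_ge0 : (0 <= seminorm h)%E.
Proof.
apply: (@le_trans _ _ _ _ _ _ (@seminorm_ge h (Ordinal d_gt0) 0 1 cube0 _ _)).
- by rewrite lee_fin divr_ge0// powR_ge0.
- by apply/andP; split; lra.
- by rewrite mxE oner_eq0.
Qed.

Lemma hoelder_sup x : cube x -> `|h x| <= L.
Proof.
move=> xc; rewrite -lee_fin; apply: le_trans (supnorm_ge h xc) _.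
by apply: le_trans hh.2; rewrite leeDl.
Qed.

Lemma hoelder_L_ge0 : 0 <= L.
Proof. exact: le_trans (hoelder_sup cube0). Qed.

Lemma hoelder_line i x t : cube x -> -1 <= t <= 1 ->
  `|iter n (partial cube i) h (setc x i t) - iter n (partial cube i) h x| <=
  L * `|t - x 0 i| `^ (beta - n%:R).
Proof.
move=> xc t1; have [->|tx] := eqVneq t (x 0 i).
  by rewrite setc_id subrr normr0 mulr_ge0 ?powR_ge0 ?hoelder_L_ge0.
have p0 : 0 < `|t - x 0 i| `^ (beta - n%:R) by rewrite powR_gt0// normr_gt0 subr_eq0.
rewrite -ler_pdivrMr// -lee_fin; apply: le_trans (seminorm_ge h xc t1 tx) _.
by apply: le_trans hh.2; rewrite leeDr.
Qed.

Lemma hoelder_line_approx l (q : dyadic_index d l) x i :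
  in_box (corner R q) (side R l) x ->
  exists2 p : {poly R}, (size p <= n.+1)%N &
    forall t, corner R q 0 i <= t <= corner R q 0 i + side R l ->
      `|h (setc x i t) - p.[t]| <= L * side R l `^ beta.
Proof.
move=> xb; have xc := in_box_cube xb; set a := corner R q 0 i; set r := side R l.
have r0 : 0 < r by exact: side_gt0.
have tb (t : R) : a <= t <= a + r -> -1 <= t <= 1.
  by move=> tar; have := in_box_cube (in_box_setc xb tar) i; rewrite setcE eqxx.
have aa : a <= a <= a + r by rewrite lexx lerDl ltW.
have aar : a <= a + r <= a + r by rewrite lexx lerDl ltW.
have /andP[a1 _] := tb _ aa; have /andP[_ a2] := tb _ aar.
have [|p sp hp] := @taylor_line R d n h x i a r (L * r `^ (beta - n%:R)) xc (ltW r0) a1 a2 hh.1.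
  move=> t tar; have := hoelder_line i (cube_setc i xc (tb _ aa)) (tb _ tar).
  rewrite setc_setc setcE eqxx => /le_trans; apply.
  rewrite ler_wpM2l ?hoelder_L_ge0// ge0_ler_powR ?nnegrE ?subr_ge0 ?strict_floor_le ?(ltW r0)//.
  by move: tar => /andP[? ?]; rewrite ger0_norm; lra.
exists p => // t /hp; rewrite -mulrA -powR_mulrn ?(ltW r0)// -powRD ?subrK//.
by rewrite gt_eqF// implybT.
Qed.

Lemma bm_hoelder : bm (h \_ cube).
Proof.
apply: (@bmI _ _ _ _ L); last first.
  move=> x; rewrite patchE; case: ifPn => [|_]; first by rewrite inE; exact: hoelder_sup.
  by rewrite normr0 hoelder_L_ge0.
have ch : {within cube, continuous h}.
  by have := hh.1; case: (strict_floor _) => [|k] [].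
have mh : measurable_fun cube h.
  apply: (measurability _ (RGenOpens.measurableE R)).
  move=> _ [_ [a [b ->] <-]].
  have oI : open (`]a, b[%classic : set R) by exact: interval_open.
  have /continuousP/(_ _ oI)/open_subspaceP[U oU UE] := ch.
  rewrite setIC -UE; apply: measurableI; last exact: measurable_cube.
  exact: sub_sigma_algebra.
by apply/(measurable_restrictT h (measurable_cube (R := R) (d := d))).
Qed.

End hoelder_lines.

Section multiscale.
Context (R : realType) (d n : nat).
Local Notation V := 'rV[R]_d.
Local Notation cube := (@cube R d).
Local Notation grid_index := ({ffun 'I_d -> 'I_n.+1}).

Definition cell_set l (q : dyadic_index d l) : set V := cube `&` [set x | cell l x = q].

Lemma measurable_cell_set l (q : dyadic_index d l) : measurable (cell_set q).
Proof. by apply: measurableI; [exact: measurable_cube|exact: measurable_cell]. Qed.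

Lemma indic_cell_set l (q : dyadic_index d l) x :
  \1_(cell_set q) x = \1_cube x * (cell l x == q)%:R :> R.
Proof.
rewrite !indicE in_setI -natrM mulnb; congr (nat_of_bool (_ && _))%:R.
by apply/idP/eqP; rewrite inE.
Qed.

(** The test functions: they depend on the scale but not on the function to be
    expanded. *)
Definition cell_weight l (qk : dyadic_index d l * grid_index) (x : V) : R :=
  \1_(cell_set qk.1) x * weight (corner R qk.1) (side R l) qk.2 x.

Lemma sum_cells l (F : dyadic_index d l -> grid_index -> R) x :
  \sum_(qk : dyadic_index d l * grid_index) \1_(cell_set qk.1) x * F qk.1 qk.2 =
  \1_cube x * \sum_k F (cell l x) k.
Proof.
rewrite -(pair_bigA _ (fun q k => \1_(cell_set q) x * F q k))/=.
rewrite (bigD1 (cell l x))//= [X in _ + X]big1 ?addr0.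
  rewrite mulr_sumr; apply: eq_bigr => k _.
  by rewrite indic_cell_set eqxx mulr1.
move=> q qx; apply: big1 => k _.
by rewrite indic_cell_set eq_sym (negPf qx) mulr0 mul0r.
Qed.

Let indic_norm (A : set V) x : `|\1_A x| = \1_A x :> R.
Proof. by rewrite ger0_norm// indicE. Qed.

Lemma sum_norm_cell_weight l x :
  \sum_(qk : dyadic_index d l * grid_index) `|cell_weight qk x| <= lebesgue R n ^+ d.
Proof.
have L0 : 0 <= lebesgue R n ^+ d by rewrite exprn_ge0// (le_trans ler01)// lebesgue_ge1.
under eq_bigr do rewrite /cell_weight normrM indic_norm.
rewrite (sum_cells (fun q k => `|weight (corner R q) (side R l) k x|)) indicE.
have [|xc] := boolP (x \in cube); last by rewrite mul0r.
rewrite inE => xc; rewrite mul1r; apply: sum_norm_weight; first exact: side_gt0.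
exact: in_box_cell.
Qed.

Lemma bm_cell_weight l (qk : dyadic_index d l * grid_index) : bm (cell_weight qk).
Proof.
apply: (@bmI _ _ _ _ (lebesgue R n ^+ d)).
  apply: measurable_funM; first by apply: measurable_indic; exact: measurable_cell_set.
  apply: measurable_prod => i _.
  have mb : measurable_fun setT (horner (node_basis R (qk.2 i))).
    by apply: continuous_measurable_fun; exact: continuous_horner.
  apply: (measurableT_comp mb).
  by apply: measurable_funM => //; apply: measurable_funB => //; exact: measurable_coord.
move=> x; apply: le_trans (sum_norm_cell_weight l x).
by rewrite (bigD1 qk)//= lerDl sumr_ge0.
Qed.

Definition cellwise_interp l (h : V -> R) (x : V) : R :=
  \1_cube x * interp n (corner R (cell l x)) (side R l) h x.

Lemma cellwise_interpE l h x : cellwise_interp l h x =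
  \sum_(qk : dyadic_index d l * grid_index)
    h (gridpoint (corner R qk.1) (side R l) qk.2) * cell_weight qk x.
Proof.
under eq_bigr do rewrite /cell_weight mulrCA.
rewrite (sum_cells (fun q k => h (gridpoint (corner R q) (side R l) k) *
   weight (corner R q) (side R l) k x)).
by congr (_ * _); apply: eq_bigr => k _; rewrite mulrC.
Qed.

(** Between consecutive levels the coefficients are errors of the coarser
    interpolant at the finer grid points, so they decay with the scale. *)
Lemma cellwise_interpB l h x : cellwise_interp l.+1 h x - cellwise_interp l h x =
  \sum_(qk : dyadic_index d l.+1 * grid_index)
    (h (gridpoint (corner R qk.1) (side R l.+1) qk.2) -
     interp n (corner R (parent qk.1)) (side R l) h
       (gridpoint (corner R qk.1) (side R l.+1) qk.2)) * cell_weight qk x.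
Proof.
under [RHS]eq_bigr do rewrite /cell_weight mulrCA.
rewrite (sum_cells (fun q k => (h (gridpoint (corner R q) (side R l.+1) k) -
     interp n (corner R (parent q)) (side R l) h
       (gridpoint (corner R q) (side R l.+1) k)) *
   weight (corner R q) (side R l.+1) k x)).
rewrite /cellwise_interp -mulrBr indicE.
have [|xc] := boolP (x \in cube); last by rewrite !mul0r.
rewrite inE => xc; rewrite !mul1r.
rewrite -(parent_cell l xc).
rewrite -[X in _ - X](interp_interp n (corner R (cell l.+1 x)) _ h x
  (lt0r_neq0 (side_gt0 R l.+1)) (lt0r_neq0 (side_gt0 R l))).
by rewrite /interp -sumrB; apply: eq_bigr => k _; rewrite mulrBl !(mulrC (weight _ _ _ x)).
Qed.

End multiscale.

Section hoelder_multiscale.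
Context (R : realType) (d : nat) (beta L : R).
Hypothesis d_gt0 : (0 < d)%N.
Hypothesis beta_gt0 : 0 < beta.
Local Notation V := 'rV[R]_d.
Local Notation cube := (@cube R d).
Local Notation n := (strict_floor beta).

Let interp_const : R := d%:R * (1 + lebesgue R n) ^+ d.

(** The power of 2 pays for comparing the side of a cell with that of its parent. *)
Definition multiscale_const : R := (1 + interp_const) * 2 `^ beta.

Let interp_const_ge0 : 0 <= interp_const.
Proof.
by rewrite mulr_ge0// exprn_ge0// addr_ge0// (le_trans ler01)// lebesgue_ge1.
Qed.

Let two_ge1 : 1 <= 2 `^ beta :> R.
Proof. by rewrite -[leLHS](powRr0 2); apply: ler_powR; [rewrite ler1n|exact: ltW]. Qed.

Lemma multiscale_const_gt0 : 0 < multiscale_const.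
Proof. by rewrite mulr_gt0 ?powR_gt0// ltr_pwDl. Qed.

Lemma sidebeta l : side R l `^ beta = 2 `^ beta * side R l.+1 `^ beta.
Proof.
have s0 := side_gt0 R l.
by rewrite -powRM// ?sideS; [congr (_ `^ _); field|rewrite divr_ge0// ltW].
Qed.

Variable h : V -> R.
Hypothesis hh : hoelder_class cube beta L h.

Let L0 : 0 <= L. Proof. exact: (hoelder_L_ge0 d_gt0 hh). Qed.

Let box_error l (q : dyadic_index d l) x : in_box (corner R q) (side R l) x ->
  `|h x - interp n (corner R q) (side R l) h x| <= interp_const * (L * side R l `^ beta).
Proof.
move=> xb; apply: interp_error => //; first exact: side_gt0.
- by rewrite mulr_ge0// powR_ge0.
- by move=> y i yb; exact: hoelder_line_approx.
Qed.

Let dev (mu mu' : probability V R) (f : V -> R) := \int[mu]_x f x - \int[mu']_x f x.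

Let dev_sum mu mu' (I : finType) (c : I -> R) (f : I -> V -> R) (A : R) :
  (forall i, bm (f i)) -> (forall i, `|c i| <= A) ->
  `|dev mu mu' (fun x => \sum_i c i * f i x)| <= A * \sum_i `|dev mu mu' (f i)|.
Proof.
move=> bf cA; rewrite /dev !int_sum; [|by move=> i; exact: bmZ..].
rewrite -sumrB mulr_sumr (le_trans (ler_norm_sum _ _ _))//; apply: ler_sum => i _.
by rewrite !intZ// -mulrBr normrM ler_wpM2r.
Qed.

Let S mu mu' l := \sum_(qk : dyadic_index d l * {ffun 'I_d -> 'I_n.+1})
  `|dev mu mu' (cell_weight qk)|.

Let bm_cellwise l : bm (cellwise_interp n l h).
Proof.
rewrite (_ : cellwise_interp n l h = fun x => \sum_(qk : dyadic_index d l * {ffun 'I_d -> 'I_n.+1})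
    h (gridpoint (corner R qk.1) (side R l) qk.2) * cell_weight qk x).
  by apply: bm_sum => qk; apply: bmZ; exact: bm_cell_weight.
by apply/funext => x; exact: cellwise_interpE.
Qed.

Let dev_cellwise mu mu' J : `|dev mu mu' (cellwise_interp n J h)| <=
  multiscale_const * L * \sum_(l < J.+1) side R l `^ beta * S mu mu' l.
Proof.
elim: J => [|J IH].
  rewrite big_ord1/=.
  have -> : cellwise_interp n 0 h = fun x => \sum_(qk : dyadic_index d 0 * {ffun 'I_d -> 'I_n.+1})
    h (gridpoint (corner R qk.1) (side R 0) qk.2) * cell_weight qk x.
    by apply/funext => x; exact: cellwise_interpE.
  apply: le_trans (@dev_sum mu mu' _ _ _ L _ _) _.
  - by move=> qk; exact: bm_cell_weight.
  - move=> qk; apply: (hoelder_sup d_gt0 hh); apply: (@in_box_cube _ _ 0 qk.1).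
    by apply: in_box_gridpoint; exact: side_gt0.
  rewrite mulrA ler_wpM2r ?sumr_ge0// mulrAC -[leLHS]mul1r ler_wpM2r//.
  rewrite /side expr0 divr1 -[leLHS]mulr1 ler_pM// /multiscale_const -[leLHS]mulr1 ler_pM//.
  by rewrite lerDl.
have -> : dev mu mu' (cellwise_interp n J.+1 h) =
  dev mu mu' (cellwise_interp n J h) +
  dev mu mu' (fun x => \sum_(qk : dyadic_index d J.+1 * {ffun 'I_d -> 'I_n.+1})
    (h (gridpoint (corner R qk.1) (side R J.+1) qk.2) -
     interp n (corner R (parent qk.1)) (side R J) h
       (gridpoint (corner R qk.1) (side R J.+1) qk.2)) * cell_weight qk x).
  rewrite /dev; have E (m0 : probability V R) : \int[m0]_x cellwise_interp n J.+1 h x =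
     \int[m0]_x cellwise_interp n J h x + \int[m0]_x (\sum_(qk : dyadic_index d J.+1 * {ffun 'I_d -> 'I_n.+1})
    (h (gridpoint (corner R qk.1) (side R J.+1) qk.2) -
     interp n (corner R (parent qk.1)) (side R J) h
       (gridpoint (corner R qk.1) (side R J.+1) qk.2)) * cell_weight qk x).
    rewrite -intD; [|exact: bm_cellwise|by apply: bm_sum => qk; apply: bmZ; exact: bm_cell_weight].
    by apply: eq_Rintegral => x _; rewrite -cellwise_interpB addrC subrK.
  by rewrite !E; ring.
rewrite big_ord_recr/= mulrDr (le_trans (ler_normD _ _))// lerD//.
apply: le_trans (@dev_sum mu mu' _ _ _ (interp_const * (L * side R J `^ beta)) _ _) _.
- by move=> qk; exact: bm_cell_weight.
- move=> qk; apply: box_error; apply: in_box_parent.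
  by apply: in_box_gridpoint; exact: side_gt0.
rewrite [leRHS]mulrA ler_wpM2r ?sumr_ge0// sidebeta /multiscale_const.
rewrite [leLHS](_ : _ = interp_const * (2 `^ beta * L * side R J.+1 `^ beta)); last by ring.
rewrite [leRHS](_ : _ = (1 + interp_const) * (2 `^ beta * L * side R J.+1 `^ beta)); last by ring.
by rewrite ler_wpM2r ?lerDr// !mulr_ge0 ?powR_ge0.
Qed.

(** Telescoping over the levels up to [J]. The right-hand side does not involve
    [h], so it also bounds the supremum over the Hoelder class. *)
Lemma hoelder_multiscale (mu mu' : probability V R) J :
  `|\int[mu]_(x in cube) h x - \int[mu']_(x in cube) h x| <=
  2 * multiscale_const * L * (side R J `^ beta + \sum_(l < J.+1) side R l `^ beta *
    \sum_(qk : dyadic_index d l * {ffun 'I_d -> 'I_n.+1})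
      `|\int[mu]_x cell_weight qk x - \int[mu']_x cell_weight qk x|).
Proof.
have E (m0 : probability V R) : \int[m0]_(x in cube) h x = \int[m0]_x (h \_ cube) x.
  exact: Rintegral_mkcond.
rewrite !E {E} -/(dev mu mu' (h \_ cube)).
have bh := bm_hoelder d_gt0 hh.
pose rem x := (h \_ cube) x - cellwise_interp n J h x.
have brem : bm rem by apply: bmB.
have remle x : `|rem x| <= interp_const * (L * side R J `^ beta).
  rewrite /rem patchE /cellwise_interp indicE; case: ifPn => xc.
    by rewrite mul1r; apply: box_error; apply: in_box_cell; exact: set_mem.
  rewrite mul0r [X in `|X|](_ : _ = 0); last exact: subr0.
  by rewrite normr0; apply: mulr_ge0 => //; apply: mulr_ge0 => //; exact: powR_ge0.
have -> : dev mu mu' (h \_ cube) = dev mu mu' rem + dev mu mu' (cellwise_interp n J h).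
  by rewrite /dev !(intB _ bh (bm_cellwise J)); ring.
have := dev_cellwise mu mu' J; set T := \sum_(l < J.+1) _ => hT.
have T0 : 0 <= T by apply: sumr_ge0 => l _; rewrite mulr_ge0 ?powR_ge0 ?sumr_ge0.
rewrite -/T (le_trans (ler_normD _ _))// mulrDr lerD//; last first.
  apply: le_trans hT _; rewrite ler_wpM2r// -[leLHS]mul1r -mulrA ler_wpM2r ?ler1n//.
  by rewrite mulr_ge0// ltW// multiscale_const_gt0.
rewrite /dev (le_trans (ler_normB _ _))//.
apply: (@le_trans _ _ (2 * (interp_const * (L * side R J `^ beta)))).
  by rewrite mulr_natl mulr2n lerD// int_bound.
rewrite -[2 * multiscale_const * L]mulrA -[leRHS]mulrA ler_pM2l// -[leRHS]mulrA.
rewrite ler_wpM2r ?mulr_ge0 ?powR_ge0//.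
by rewrite /multiscale_const -[leLHS]mulr1 ler_pM// lerDr.
Qed.

End hoelder_multiscale.

(** * Couplings built from nested partitions *)

Section greedy_matching.
Context (R : realType) (T : finType).
Implicit Types (u v a b : T -> R) (H G c : T -> T -> R).

(** One round of matching inside the classes of [f]: in each class as much mass
    as possible is matched, proportionally to [u] and [v]. *)
Lemma match_classes (K : finType) (f : T -> K) u v c (D : R) :
  (forall q, 0 <= u q) -> (forall q, 0 <= v q) ->
  (forall q q', f q = f q' -> c q q' <= D) -> 0 <= D ->
  exists H, [/\ forall q q', 0 <= H q q',
    (forall q, \sum_q' H q q' <= u q) /\ (forall q', \sum_q H q q' <= v q'),
    forall Q, \sum_(q | f q == Q) (u q - \sum_q' H q q') =
      Num.max (\sum_(q | f q == Q) (u q - v q)) 0,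
    forall Q, \sum_(q | f q == Q) (v q - \sum_q' H q' q) =
      Num.max (- \sum_(q | f q == Q) (u q - v q)) 0 &
    \sum_q \sum_q' H q q' * c q q' <= D * \sum_q u q].
Proof.
move=> u0 v0 cD D0.
pose U Q := \sum_(q | f q == Q) u q; pose W Q := \sum_(q | f q == Q) v q.
have U0 Q : 0 <= U Q by exact: sumr_ge0.
have W0 Q : 0 <= W Q by exact: sumr_ge0.
pose M Q := Num.max (U Q) (W Q).
have M0 Q : 0 <= M Q by rewrite le_max U0.
pose H q q' := (f q == f q')%:R * (u q * v q' / M (f q)).
have rowE q : \sum_q' H q q' = u q * (W (f q) / M (f q)).
  transitivity (\sum_(q' | f q' == f q) u q * v q' / M (f q)).
    rewrite [RHS]big_mkcond; apply: eq_bigr => q' _; rewrite /H eq_sym.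
    by case: eqP => _; rewrite ?mul1r ?mul0r.
  by rewrite -mulr_suml -mulr_sumr mulrA.
have colE q' : \sum_q H q q' = v q' * (U (f q') / M (f q')).
  transitivity (\sum_(q | f q == f q') v q' * u q / M (f q')).
    rewrite [RHS]big_mkcond; apply: eq_bigr => q _; rewrite /H.
    by case: eqP => [->|_]; rewrite ?mul1r ?mul0r// mulrC [u q * _]mulrC mulrC.
  by rewrite -mulr_suml -mulr_sumr mulrA.
have ratio x Q : 0 <= x -> x <= M Q -> 0 <= x / M Q <= 1.
  move=> x0 xM; rewrite divr_ge0//=; have := M0 Q; rewrite le_eqVlt => /predU1P[<-|Mp].
    by rewrite invr0 mulr0 ler01.
  by rewrite ler_pdivrMr// mul1r.
have WM Q : 0 <= W Q / M Q <= 1 by apply: ratio => //; rewrite le_max lexx orbT.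
have UM Q : 0 <= U Q / M Q <= 1 by apply: ratio => //; rewrite le_max lexx.
have UWM Q : U Q - U Q * (W Q / M Q) = Num.max (U Q - W Q) 0 /\
             W Q - W Q * (U Q / M Q) = Num.max (- (U Q - W Q)) 0.
  have h : 0 < M Q -> U Q - U Q * (W Q / M Q) = U Q * (M Q - W Q) / M Q /\
      W Q - W Q * (U Q / M Q) = W Q * (M Q - U Q) / M Q.
    by move=> Mp; split; field; rewrite gt_eqF.
  have := M0 Q; rewrite le_eqVlt => /predU1P[M00|Mp].
    have U00 : U Q = 0.
      by apply/eqP; rewrite eq_le U0 andbT M00 le_max lexx.
    have W00 : W Q = 0.
      by apply/eqP; rewrite eq_le W0 andbT M00 le_max lexx orbT.
    by rewrite U00 W00 !mul0r !subr0 oppr0 maxxx.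
  have [-> ->] := h Mp; move: Mp; rewrite /M.
  case: (leP (U Q) (W Q)) => UWQ Mp.
    rewrite subrr mulr0 mul0r (max_idPr _) ?subr_le0// (max_idPl _); last by rewrite opprB subr_ge0.
    by split => //; rewrite mulrAC divff ?gt_eqF// mul1r opprB.
  rewrite subrr mulr0 mul0r (max_idPl _) ?subr_ge0 ?(ltW UWQ)// (max_idPr _); last first.
    by rewrite opprB subr_le0 ltW.
  by split => //; rewrite mulrAC divff ?gt_eqF// mul1r.
exists H; split.
- move=> q q'; rewrite /H mulr_ge0// divr_ge0// mulr_ge0//.
- split=> q; first by rewrite rowE ler_piMr//; have /andP[] := WM (f q).
  by rewrite colE ler_piMr//; have /andP[] := UM (f q).
- move=> Q; rewrite [X in Num.max X _]sumrB -/(U Q) -/(W Q) -(UWM Q).1 sumrB -/(U Q).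
  congr (_ - _); rewrite /U mulr_suml; apply: eq_bigr => q /eqP fq.
  by rewrite rowE fq.
- move=> Q; rewrite [X in Num.max (- X) _]sumrB -/(U Q) -/(W Q) -(UWM Q).2 sumrB -/(W Q).
  congr (_ - _); rewrite /W mulr_suml; apply: eq_bigr => q /eqP fq.
  by rewrite colE fq.
- rewrite mulr_sumr; apply: ler_sum => q _.
  apply: (@le_trans _ _ (\sum_q' H q q' * D)).
    apply: ler_sum => q' _; rewrite /H; case: eqP => [ff|_]; last by rewrite !mul0r.
    by rewrite mul1r ler_wpM2l ?cD// divr_ge0// mulr_ge0.
  rewrite -mulr_suml mulrC ler_wpM2l// rowE ler_piMr//.
  by have /andP[] := WM (f q).
Qed.

Variables (K : nat -> finType) (f : forall l, T -> K l).
Hypothesis coarser : forall l q q', f l.+1 q = f l.+1 q' -> f l q = f l q'.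
Variables (a b : T -> R).
Hypothesis a_ge0 : forall q, 0 <= a q.
Hypothesis b_ge0 : forall q, 0 <= b q.
Variables (c : T -> T -> R) (D : nat -> R).
Hypothesis D_ge0 : forall l, 0 <= D l.
Variable J : nat.
Hypothesis c_le : forall l q q', (l <= J)%N -> f l q = f l q' -> c q q' <= D l.

Let excess l := \sum_(Q : K l) `|\sum_(q | f l q == Q) (a q - b q)|.

Let sum_coarser l (F : T -> R) (Q : K l) :
  (forall Q' : K l.+1, \sum_(q | f l.+1 q == Q') F q = 0) ->
  \sum_(q | f l q == Q) F q = 0.
Proof.
move=> F0; rewrite (partition_big (f l.+1) predT)//=; apply: big1 => Q' _.
have [/existsP[q0 /andP[/eqP q0Q /eqP q0Q']]|/existsPn none] :=
  boolP [exists q, (f l q == Q) && (f l.+1 q == Q')].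
  rewrite -[RHS](F0 Q'); apply: eq_bigl => q.
  apply/andP/idP => [[]//|/eqP qQ']; rewrite qQ' eqxx; split=> //.
  by rewrite -q0Q; apply/eqP/coarser; rewrite qQ'.
by apply: big_pred0 => q; exact/negbTE/none.
Qed.

Let partial_matching l : (l <= J)%N -> exists G,
  [/\ forall q q', 0 <= G q q',
    (forall q, \sum_q' G q q' <= a q) /\ (forall q', \sum_q G q q' <= b q'),
    forall Q : K l, \sum_(q | f l q == Q) (a q - \sum_q' G q q') =
      Num.max (\sum_(q | f l q == Q) (a q - b q)) 0,
    forall Q : K l, \sum_(q | f l q == Q) (b q - \sum_q' G q' q) =
      Num.max (- \sum_(q | f l q == Q) (a q - b q)) 0 &
    \sum_q \sum_q' G q q' * c q q' <=
      D J * \sum_q a q + \sum_(l <= k < J) D k * excess k.+1].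
Proof.
move=> lJ; rewrite -(subKn lJ); elim: (J - l)%N => [|s IH].
  rewrite subn0 big_geq// addr0.
  exact: (match_classes a_ge0 b_ge0 (fun q q' => @c_le J q q' (leqnn J)) (D_ge0 J)).
have [sJ|sJ] := ltnP s J; last first.
  have E : (J - s.+1 = J - s)%N by lia.
  by rewrite E.
have E : (J - s = (J - s.+1).+1)%N by lia.
move: IH; rewrite E; set k := (J - s.+1)%N => -[G [G0 [Ga Gb] Ga' Gb' Gc]].
pose u q := a q - \sum_q' G q q'; pose v q := b q - \sum_q' G q' q.
have u0 q : 0 <= u q by rewrite subr_ge0.
have v0 q : 0 <= v q by rewrite subr_ge0.
have [H [H0 [Hu Hv] Hu' Hv' Hc]] := match_classes u0 v0 (fun q q' => @c_le k q q' (leq_subr _ _)) (D_ge0 k).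
have uv Q : \sum_(q | f k q == Q) (u q - v q) = \sum_(q | f k q == Q) (a q - b q).
  apply/eqP; rewrite -subr_eq0 -sumrB; apply/eqP/sum_coarser => Q'.
  rewrite sumrB [X in X - _]sumrB Ga' Gb'; set e := \sum_(q | _) _.
  by case: (leP 0 e) => h; [rewrite (max_idPr _) ?oppr_le0//|rewrite (max_idPl _) ?oppr_ge0 ?(ltW h)//]; ring.
exists (fun q q' => G q q' + H q q'); split.
- by move=> q q'; rewrite addr_ge0.
- split=> q; rewrite big_split/=; first by rewrite -lerBrDl; exact: Hu.
  by rewrite -lerBrDl; exact: Hv.
- move=> Q; rewrite -uv -Hu'; apply: eq_bigr => q _.
  by rewrite big_split/= opprD addrA.
- move=> Q; rewrite -uv -Hv'; apply: eq_bigr => q _.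
  by rewrite big_split/= opprD addrA.
under eq_bigr do under eq_bigr do rewrite mulrDl.
under eq_bigr do rewrite big_split/=.
rewrite big_split/= big_ltn; last by rewrite /k; lia.
rewrite addrCA addrC lerD//; apply: le_trans Hc _; rewrite ler_wpM2l//.
rewrite /excess (partition_big (f k.+1) predT)//=; apply: ler_sum => Q _.
by rewrite Ga' ge_max normr_ge0 ler_norm.
Qed.

(** Matching first inside the smallest classes, then inside larger ones, only
    the excess of one weight over the other in a class has to leave it. *)
Lemma multiscale_matching : (forall q q', f 0 q = f 0 q') ->
  \sum_q a q = \sum_q b q ->
  exists G, [/\ forall q q', 0 <= G q q',
    (forall q, \sum_q' G q q' = a q), (forall q', \sum_q G q q' = b q') &
    \sum_q \sum_q' G q q' * c q q' <=
      D J * \sum_q a q + \sum_(k < J) D k * \sum_(Q : K k.+1) `|\sum_(q | f k.+1 q == Q) (a q - b q)|].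
Proof.
move=> f0 ab; have [G [G0 [Ga Gb] Ga' Gb' Gc]] := partial_matching (leq0n J).
have all0 (F : T -> R) : (forall q, 0 <= F q) ->
    (forall Q : K 0, \sum_(q | f 0 q == Q) F q = 0) -> forall q, F q = 0.
  move=> F0 FQ q; apply/eqP.
  by have /eqP := FQ (f 0 q); rewrite psumr_eq0// => /allP/(_ q); rewrite mem_index_enum eqxx => /(_ isT).
have abQ Q : \sum_(q | f 0 q == Q) (a q - b q) = 0.
  have [/existsP[q0 /eqP q0Q]|/existsPn none] := boolP [exists q, f 0 q == Q].
    rewrite (eq_bigl predT); last by move=> q; rewrite -q0Q (f0 q q0) eqxx.
    by rewrite sumrB ab subrr.
  by apply: big_pred0 => q; exact/negbTE/none.
exists G; split => //.
- move=> q; apply/eqP; rewrite eq_sym -subr_eq0; apply/eqP.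
  apply: (all0 (fun q => a q - \sum_q' G q q')) => [r|Q]; first by rewrite subr_ge0.
  by rewrite Ga' abQ maxxx.
- move=> q; apply/eqP; rewrite eq_sym -subr_eq0; apply/eqP.
  apply: (all0 (fun q => b q - \sum_q' G q' q)) => [r|Q]; first by rewrite subr_ge0.
  by rewrite Gb' abQ oppr0 maxxx.
by move: Gc; rewrite big_mkord.
Qed.

End greedy_matching.

Section wasserstein_bound.
Context (R : realType) (d : nat).
Local Notation V := 'rV[R]_d.
Local Notation cube := (@cube R d).

Lemma in_box_corner l (q : dyadic_index d l) : in_box (corner R q) (side R l) (corner R q).
Proof. by move=> i; rewrite lexx lerDl ltW// side_gt0. Qed.

Lemma cube_corner l (q : dyadic_index d l) : cube (corner R q).
Proof. exact: in_box_cube (in_box_corner q). Qed.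

Lemma cell_corner l (q : dyadic_index d l) : cell l (corner R q) = q.
Proof.
apply/ffunP => i; rewrite ffunE; apply: val_inj => /=; rewrite /dyadic mxE.
have -> : (-1 + side R l * (q i)%:R + 1) / 2 * 2 ^+ l = (q i)%:R.
  by rewrite /side; field; rewrite expf_neq0.
rewrite natrK; apply/minn_idPl; have := ltn_ord (q i); lia.
Qed.

Lemma cell_coarser l (x y : V) : cube x -> cube y ->
  cell l.+1 x = cell l.+1 y -> cell l x = cell l y.
Proof. by move=> xc yc xy; rewrite -parent_cell// xy parent_cell. Qed.

Lemma cell_corner_cell J l (x : V) : cube x -> (l <= J)%N ->
  cell l (corner R (cell J x)) = cell l x.
Proof.
move=> xc lJ; rewrite -(subKn lJ); elim: (J - l)%N => [|s IH].
  by rewrite subn0 cell_corner.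
have [sJ|sJ] := ltnP s J; last by rewrite (_ : J - s.+1 = J - s)%N//; lia.
apply: cell_coarser => //; first exact: cube_corner.
by rewrite (_ : (J - s.+1).+1 = J - s)%N//; lia.
Qed.

Lemma measurable_enorm : measurable_fun setT (fun z : V * V => enorm (z.1 - z.2)).
Proof.
have ms : measurable_fun setT (@Num.sqrt R).
  by apply: nondecreasing_measurable => // s t; exact: ler_wsqrtr.
apply: (measurableT_comp ms); apply: measurable_sum => i; apply: measurable_funX.
rewrite (_ : (fun _ => _) = fun z : V * V => z.1 0 i - z.2 0 i); last first.
  by apply/funext => z; rewrite !mxE.
apply: measurable_funB; apply: (measurableT_comp (measurable_coord 0 i)).
  exact: measurable_fst.
exact: measurable_snd.
Qed.

Lemma enorm_le (x : V) : enorm x <= \sum_i `|x 0 i|.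
Proof.
have s0 : 0 <= \sum_i `|x 0 i| by exact: sumr_ge0.
rewrite /enorm -[leRHS]ger0_norm// -sqrtr_sqr ler_wsqrtr// expr2 mulr_suml.
apply: ler_sum => i _; rewrite -real_normK ?num_real// expr2 ler_wpM2l//.
by rewrite (bigD1 i)//= lerDl sumr_ge0.
Qed.

Variables (mu nu : probability V R) (J p : nat).
Hypothesis mu_cube : mu cube = 1%E.
Hypothesis nu_cube : nu cube = 1%E.
Local Notation T := (dyadic_index d J).

(* Functions on pairs of cells, as functions on pairs of points. *)
Let step (F : T -> T -> R) (z : V * V) : R :=
  \sum_q \sum_q' F q q' * (\1_(cell_set q) z.1 * \1_(cell_set q') z.2).

Let bm1 (A : set V) : measurable A -> bm (fun z : V * V => \1_A z.1 : R).
Proof. by move=> mA; apply: (bm_comp (bm_indic R mA)). Qed.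

Let bm2 (A : set V) : measurable A -> bm (fun z : V * V => \1_A z.2 : R).
Proof. by move=> mA; apply: (bm_comp (bm_indic R mA)). Qed.

Let bm_step F : bm (step F).
Proof.
apply: bm_sum => q; apply: bm_sum => q'; apply: bmZ; apply: bmM.
  by apply: bm1; exact: measurable_cell_set.
by apply: bm2; exact: measurable_cell_set.
Qed.

Let stepE F z : step F z = \1_cube z.1 * \1_cube z.2 * F (cell J z.1) (cell J z.2).
Proof.
rewrite /step (bigD1 (cell J z.1))//= [X in _ + X]big1 ?addr0; last first.
  move=> q qz; apply: big1 => q' _.
  by rewrite indic_cell_set eq_sym (negPf qz) mulr0 mul0r mulr0.
rewrite (bigD1 (cell J z.2))//= [X in _ + X]big1 ?addr0; last first.
  by move=> q qz; rewrite !indic_cell_set [_ == q]eq_sym (negPf qz) !mulr0.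
by rewrite !indic_cell_set !eqxx !mulr1 mulrC.
Qed.

Let Q := product_prob mu nu.

Let int_step F (f g : V -> R) : bm f -> bm g ->
  \int[Q]_z (f z.1 * g z.2 * step F z) =
  \sum_q \sum_q' F q q' * (\int[mu]_x (f x * \1_(cell_set q) x) *
                           \int[nu]_x (g x * \1_(cell_set q') x)).
Proof.
move=> bf bg.
have bfq q : bm (fun x => f x * \1_(@cell_set R d J q) x).
  by apply: bmM => //; apply: bm_indic; exact: measurable_cell_set.
have bgq q : bm (fun x => g x * \1_(@cell_set R d J q) x).
  by apply: bmM => //; apply: bm_indic; exact: measurable_cell_set.
have bfq1 q : bm (fun z : V * V => f z.1 * \1_(@cell_set R d J q) z.1).
  by apply: (bm_comp (bfq q)).
have bgq2 q : bm (fun z : V * V => g z.2 * \1_(@cell_set R d J q) z.2).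
  by apply: (bm_comp (bgq q)).
transitivity (\int[Q]_z (\sum_q \sum_q' F q q' *
    ((f z.1 * \1_(cell_set q) z.1) * (g z.2 * \1_(cell_set q') z.2)))).
  apply: eq_Rintegral => z _; rewrite /step mulr_sumr; apply: eq_bigr => q _.
  by rewrite mulr_sumr; apply: eq_bigr => q' _; ring.
rewrite int_sum; last by move=> q; apply: bm_sum => q'; apply: bmZ; exact: bmM.
apply: eq_bigr => q _.
rewrite int_sum; last by move=> q'; apply: bmZ; exact: bmM.
apply: eq_bigr => q' _.
rewrite intZ; last exact: bmM.
congr (_ * _); rewrite int_product; last exact: bmM.
transitivity (\int[mu]_x ((\int[nu]_y (g y * \1_(cell_set q') y)) * (f x * \1_(cell_set q) x))).
  by apply: eq_Rintegral => x _; rewrite [RHS]mulrC; exact: (intZ nu (f x * \1_(cell_set q) x) (bgq q')).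
by rewrite intZ// mulrC.
Qed.

Let a (q : T) := \int[mu]_x (\1_(cell_set q) x : R).
Let b (q : T) := \int[nu]_x (\1_(cell_set q) x : R).

Let part (m0 : probability V R) l (P : dyadic_index d l) : (l <= J)%N ->
  \sum_(q : T | cell l (corner R q) == P) \int[m0]_x (\1_(cell_set q) x : R) =
  \int[m0]_x (\1_(cell_set P) x : R).
Proof.
move=> lJ; rewrite -int_sum; last by move=> q; apply: bm_indic; exact: measurable_cell_set.
apply: eq_Rintegral => x _; rewrite indic_cell_set.
under eq_bigr do rewrite indic_cell_set.
rewrite -mulr_sumr indicE; have [|_] := boolP (x \in cube); last by rewrite !mul0r.
rewrite inE => xc; rewrite !mul1r.
have [xP|xP] := eqVneq (cell l x) P.
  rewrite (bigD1 (cell J x)) ?cell_corner_cell ?xP//= eqxx big1 ?addr0// => q /andP[_ qx].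
  by rewrite eq_sym (negPf qx).
apply: big1 => q /eqP qP; case: eqP => // xq; move: xP.
by rewrite -qP -xq cell_corner_cell// eqxx.
Qed.

Let total (m0 : probability V R) : m0 cube = 1%E ->
  \sum_(q : T) \int[m0]_x (\1_(cell_set q) x : R) = 1.
Proof.
move=> m0c; rewrite -int_sum; last by move=> q; apply: bm_indic; exact: measurable_cell_set.
transitivity (\int[m0]_x (\1_cube x : R)).
  apply: eq_Rintegral => x _; under eq_bigr do rewrite indic_cell_set.
  rewrite -mulr_sumr (bigD1 (cell J x))//= eqxx big1 ?addr0 ?mulr1// => q qx.
  by rewrite eq_sym (negPf qx).
by rewrite int_indic ?m0c//; exact: measurable_cube.
Qed.

(* An upper bound of the transport cost between two cells. *)
Let c (q q' : T) : R := (\sum_i (`|corner R q 0 i - corner R q' 0 i| + side R J)) ^+ p.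
Let D l : R := (2 * d%:R * side R l) ^+ p.

Let side_le l : (l <= J)%N -> side R J <= side R l.
Proof.
move=> lJ; rewrite /side ler_pM2l// lef_pV2 ?posrE ?exprn_gt0//.
by rewrite ler_weXn2l// ler1n.
Qed.

Let same_cell l (x y : V) i : cube x -> cube y -> cell l x = cell l y ->
  `|x 0 i - y 0 i| <= side R l.
Proof.
move=> xc yc xy; have := in_box_cell l xc i; have := in_box_cell l yc i.
rewrite -xy ler_norml => /andP[h1 h2] /andP[h3 h4].
by apply/andP; split; lra.
Qed.

Let c_le l q q' : (l <= J)%N -> cell l (corner R q) = cell l (corner R q') -> c q q' <= D l.
Proof.
move=> lJ qq'; have s0 := side_gt0 R J.
rewrite /c /D lerXn2r ?nnegrE ?sumr_ge0//.
- by move=> i _; rewrite addr_ge0// ltW.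
- by rewrite !mulr_ge0// ltW// side_gt0.
apply: (@le_trans _ _ (\sum_(i < d) 2 * side R l)); last first.
  by rewrite sumr_const card_ord -[_ *+ d]mulr_natl mulrA [_ * 2]mulrC.
apply: ler_sum => i _; rewrite mulr_natl mulr2n lerD ?side_le//.
by apply: same_cell => //; exact: cube_corner.
Qed.

Let enorm_cell x y : cube x -> cube y -> enorm (x - y) ^+ p <= c (cell J x) (cell J y).
Proof.
move=> xc yc; rewrite /c lerXn2r ?nnegrE ?sqrtr_ge0 ?sumr_ge0//.
  by move=> i _; rewrite addr_ge0// ltW// side_gt0.
apply: le_trans (enorm_le _) _; apply: ler_sum => i _.
have := in_box_cell J xc i; have := in_box_cell J yc i; rewrite !mxE.
set u := -1 + _; set v := -1 + _; move=> /andP[h1 h2] /andP[h3 h4].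
have := ler_norm (v - u); have := ler_norm (u - v); rewrite (distrC u v) => h5 h6.
by rewrite ler_norml; apply/andP; split; lra.
Qed.

(** The matching of the cell masses becomes a coupling by spreading the mass
    [G q q'] proportionally to [mu] on [q] and to [nu] on [q']: its density with
    respect to the product measure is [G q q' / (a q * b q')]. Mass matched inside
    a cell of level [k] travels at most a multiple of its side. *)
Lemma wasserstein_multiscale : (wasserstein_pow p mu nu <=
  (D J + \sum_(k < J) D k * \sum_(P : dyadic_index d k.+1)
     `|\int[mu]_x (\1_(cell_set P) x : R) - \int[nu]_x (\1_(cell_set P) x : R)|)%:E)%E.
Proof.
have a0 q : 0 <= a q by apply: int_ge0 => x; rewrite indicE.
have b0 q : 0 <= b q by apply: int_ge0 => x; rewrite indicE.
have D0 l : 0 <= D l by rewrite exprn_ge0// !mulr_ge0// ltW// side_gt0.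
have asum : \sum_q a q = 1 by exact: total.
have bsum : \sum_q b q = 1 by exact: total.
have [|q q'||G [G0 Ga Gb Gc]] := @multiscale_matching R T (dyadic_index d)
  (fun l q => cell l (corner R q)) _ a b a0 b0 c D D0 J c_le.
- by move=> l q q'; apply: cell_coarser; exact: cube_corner.
- apply/ffunP => i; apply: val_inj.
  by case: (cell _ _ i) (cell _ _ i) => [[]//] ? [[]].
- by rewrite asum bsum.
have Ga0 q q' : a q = 0 -> G q q' = 0.
  move=> aq; apply/eqP; have /eqP := Ga q; rewrite aq psumr_eq0//.
  by move=> /allP/(_ q'); rewrite mem_index_enum => /(_ isT).
have Gb0 q q' : b q' = 0 -> G q q' = 0.
  move=> bq; apply/eqP; have /eqP := Gb q'; rewrite bq psumr_eq0//.
  by move=> /allP/(_ q); rewrite mem_index_enum => /(_ isT).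
pose F q q' := G q q' / (a q * b q').
pose g := step F.
have F0 q q' : 0 <= F q q' by rewrite divr_ge0// mulr_ge0.
have g0 z : 0 <= g z by rewrite /g stepE mulr_ge0// mulr_ge0// indicE.
have Fab q q' : F q q' * (a q * b q') = G q q'.
  have [aq|aq] := eqVneq (a q) 0; first by rewrite /F (Ga0 _ _ aq) !mul0r.
  have [bq|bq] := eqVneq (b q') 0; first by rewrite /F (Gb0 _ _ bq) !mul0r.
  by rewrite /F divfK// mulf_neq0.
have int_step1 H : \int[Q]_z step H z = \sum_q \sum_q' H q q' * (a q * b q').
  have b1 : bm (fun _ : V => 1 : R) by exact: bm_cst.
  have := int_step H b1 b1 => E.
  transitivity (\int[Q]_z (1 * 1 * step H z)); first by apply: eq_Rintegral => z _; rewrite !mul1r.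
  rewrite [LHS]E; apply: eq_bigr => q _; apply: eq_bigr => q' _.
  by congr (_ * (_ * _)); apply: eq_Rintegral => x _; rewrite mul1r.
have g1 : \int[Q]_z g z = 1.
  rewrite int_step1 -asum; apply: eq_bigr => q _; rewrite -[RHS]Ga.
  by apply: eq_bigr => q' _; exact: Fab.
have bg : bm g by exact: bm_step.
pose gam : probability (V * V)%type R := tilted g0 bg g1.
have gamE A : measurable A -> gam A = tilt Q g A by [].
have dom := tilt_eq_dominates g0 bg g1 gamE.
have gam_int h : bm h -> \int[gam]_z h z = \int[Q]_z (h z * g z).
  exact: (int_tilt bg g1 dom gamE).
have cube_part (m0 : probability V R) A : measurable A -> m0 cube = 1%E ->
    \sum_(q : T) \int[m0]_x (\1_A x * \1_(cell_set q) x) = \int[m0]_x (\1_A x : R).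
  move=> mA m0c; have bA := bm_indic R mA.
  rewrite -int_sum; last by move=> q; apply: bmM => //; apply: bm_indic; exact: measurable_cell_set.
  transitivity (\int[m0]_x (\1_A x * \1_cube x : R)).
    apply: eq_Rintegral => x _; rewrite -mulr_sumr; congr (_ * _).
    under eq_bigr do rewrite indic_cell_set.
    rewrite -mulr_sumr (bigD1 (cell J x))//= eqxx big1 ?addr0 ?mulr1// => q qx.
    by rewrite eq_sym (negPf qx).
  apply: int_ae => //; first by apply: bmM => //; apply: bm_indic; exact: measurable_cube.
  apply: filterS (ae_prob1 (@measurable_cube R d) m0c) => x xc.
  by rewrite [\1_cube x]indicE mem_set// mulr1.
have small (m0 : probability V R) A (q : T) : measurable A ->
    \int[m0]_x (\1_(cell_set q) x : R) = 0 -> \int[m0]_x (\1_A x * \1_(cell_set q) x : R) = 0.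
  move=> mA E; apply/eqP; rewrite eq_le; apply/andP; split; last first.
    by apply: int_ge0 => x; rewrite mulr_ge0// indicE.
  rewrite -E; apply: le_int.
  - by apply: bmM; apply: bm_indic => //; exact: measurable_cell_set.
  - by apply: bm_indic; exact: measurable_cell_set.
  - by move=> x; rewrite ler_piMl// !indicE//; case: (_ \in _).
have marg1 A : measurable A -> gam (fst @^-1` A) = mu A.
  move=> mA; rewrite (prob_int _ (measurable_pre measurable_fst mA)) (prob_int _ mA).
  congr EFin; rewrite gam_int; last exact: bm1.
  have b1 : bm (fun _ : V => 1 : R) by exact: bm_cst.
  transitivity (\int[Q]_z (\1_A z.1 * 1 * step F z)).
    by apply: eq_Rintegral => z _; rewrite mulr1.
  rewrite (int_step F (bm_indic R mA) b1) -(cube_part mu A mA mu_cube).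
  apply: eq_bigr => q _; have [aq|aq] := eqVneq (a q) 0.
    by rewrite (small _ _ _ mA aq) big1// => q' _; rewrite mul0r mulr0.
  transitivity (\sum_q' G q q' * (\int[mu]_x (\1_A x * \1_(cell_set q) x) / a q)).
    apply: eq_bigr => q' _; have -> : \int[nu]_x (1 * \1_(cell_set q') x : R) = b q'.
      by apply: eq_Rintegral => x _; rewrite mul1r.
    by rewrite -Fab; move: (F q q') (\int[mu]_x _) (b q') (a q) aq => *; field.
  by rewrite -mulr_suml Ga mulrC divfK.
have marg2 A : measurable A -> gam (snd @^-1` A) = nu A.
  move=> mA; rewrite (prob_int _ (measurable_pre measurable_snd mA)) (prob_int _ mA).
  congr EFin; rewrite gam_int; last exact: bm2.
  have b1 : bm (fun _ : V => 1 : R) by exact: bm_cst.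
  transitivity (\int[Q]_z (1 * \1_A z.2 * step F z)).
    by apply: eq_Rintegral => z _; rewrite mul1r.
  rewrite (int_step F b1 (bm_indic R mA)) -(cube_part nu A mA nu_cube) exchange_big/=.
  apply: eq_bigr => q' _; have [bq|bq] := eqVneq (b q') 0.
    by rewrite (small _ _ _ mA bq) big1// => q _; rewrite mulr0 mulr0.
  transitivity (\sum_q G q q' * (\int[nu]_x (\1_A x * \1_(cell_set q') x) / b q')).
    apply: eq_bigr => q _; have -> : \int[mu]_x (1 * \1_(cell_set q) x : R) = a q.
      by apply: eq_Rintegral => x _; rewrite mul1r.
    by rewrite -Fab; move: (F q q') (\int[nu]_x _) (b q') (a q) bq => *; field.
  by rewrite -mulr_suml Gb mulrC divfK.
have gcoup : wasserstein_couplings mu nu gam.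
  by move=> A mA; split; [exact: marg1|exact: marg2].
apply: (@le_trans _ _ (\int[gam]_z (enorm (z.1 - z.2) ^+ p)%:E)%E).
  by apply: ereal_inf_lbound; exists gam.
have mcube := @measurable_cube R d.
have ae_cube : {ae gam, forall z, cube z.1 /\ cube z.2}.
  have h1 := ae_prob1 (measurable_pre measurable_fst mcube) (etrans (marg1 _ mcube) mu_cube).
  have h2 := ae_prob1 (measurable_pre measurable_snd mcube) (etrans (marg2 _ mcube) nu_cube).
  by apply: filterS2 h1 h2.
apply: (@le_trans _ _ (\int[gam]_z (step c z)%:E)%E).
  apply: ae_ge0_le_integral => //.
  - by move=> z _; rewrite lee_fin exprn_ge0// sqrtr_ge0.
  - by apply/measurable_EFinP; apply: measurable_funX; exact: measurable_enorm.
  - move=> z _; rewrite lee_fin stepE; rewrite !mulr_ge0 ?indicE//.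
    by rewrite /c exprn_ge0// sumr_ge0// => i _; rewrite addr_ge0// ltW// side_gt0.
  - by apply/measurable_EFinP; apply: bm_meas; exact: bm_step.
  apply: filterS ae_cube => z [z1 z2] _; rewrite lee_fin stepE !indicE !mem_set//.
  by rewrite !mul1r; exact: enorm_cell.
rewrite -intE; last exact: bm_step.
rewrite gam_int; last exact: bm_step.
rewrite lee_fin.
have -> : \int[Q]_z (step c z * g z) = \sum_q \sum_q' G q q' * c q q'.
  transitivity (\int[Q]_z step (fun q q' => c q q' * F q q') z).
    apply: eq_Rintegral => z _; rewrite /g !stepE !indicE.
    by case: (_ \in _); case: (_ \in _); rewrite /=; ring.
  rewrite int_step1; apply: eq_bigr => q _; apply: eq_bigr => q' _.
  by rewrite -mulrA Fab mulrC.
apply: le_trans Gc _; rewrite asum mulr1 lerD2l; apply: ler_sum => k _.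
rewrite ler_wpM2l//; apply: ler_sum => P _.
by rewrite sumrB -!(part _ P (ltn_ord k)).
Qed.

End wasserstein_bound.

(** * Summation of the errors over the scales *)

Section rates.
Context (R : realType) (d : nat) (beta : R).
Hypothesis d_gt0 : (0 < d)%N.
Hypothesis beta_gt0 : 0 < beta.

Let two0 : 2 != 0 :> R. Proof. by rewrite pnatr_eq0. Qed.

Let pow2D (s t : R) : 2 `^ s * 2 `^ t = 2 `^ (s + t).
Proof. by rewrite powRD// two0 implybT. Qed.

Let rho : R := 2 `^ (d%:R / 2 - beta).

Let term l N : (0 < N)%N ->
  side R l `^ beta * Num.sqrt (((2 ^ l) ^ d)%:R / N%:R) =
  2 `^ beta * N%:R `^ (- (1 / 2)) * rho ^+ l.
Proof.
move=> N0; have N0r : 0 < N%:R :> R by rewrite ltr0n.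
have -> : side R l `^ beta = 2 `^ beta * 2 `^ (- l%:R * beta).
  by rewrite /side powRM// ?powRrM ?powR_invn// invr_ge0 exprn_ge0.
have -> : Num.sqrt (((2 ^ l) ^ d)%:R / N%:R) = 2 `^ (l%:R * d%:R / 2) * N%:R `^ (- (1 / 2)) :> R.
  rewrite sqrtrM// sqrtrV ?ltW// -!powR12_sqrt// powRN div1r; congr (_ * _).
  by rewrite -expnM natrX powRrM -natrM powR_mulrn.
have -> : rho ^+ l = 2 `^ ((d%:R / 2 - beta) * l%:R).
  by rewrite powRrM powR_mulrn// powR_ge0.
rewrite [LHS](_ : _ = 2 `^ beta * N%:R `^ (- (1 / 2)) *
  (2 `^ (- l%:R * beta) * 2 `^ (l%:R * d%:R / 2))); last by ring.
by rewrite pow2D; congr (_ * _ `^ _); ring.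
Qed.

Let geometric n : rho != 1 -> \sum_(l < n) rho ^+ l = (rho ^+ n - 1) / (rho - 1).
Proof. by move=> r1; rewrite subrX1 mulrAC divff ?mul1r// subr_eq0. Qed.

Let level N := trunc_log (2 ^ d) N.

Let base_gt1 : (1 < 2 ^ d)%N.
Proof. by rewrite -[1%N](expn0 2) ltn_exp2l. Qed.

Let level_le N : (0 < N)%N -> 2 ^+ level N <= N%:R `^ (d%:R^-1) :> R.
Proof.
move=> N0; have := trunc_logP base_gt1 N0; rewrite -/(level N) -expnM mulnC expnM => h.
have dr : d%:R != 0 :> R by rewrite pnatr_eq0 -lt0n.
have -> : 2 ^+ level N = (((2 ^ level N) ^ d)%:R : R) `^ d%:R^-1.
  by rewrite natrX -(powR_mulrn d) ?ler0n// -powRrM divff// powRr1// natrX.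
by rewrite ge0_ler_powR ?nnegrE ?invr_ge0// ler_nat.
Qed.

Let level_ge N : (0 < N)%N -> N%:R `^ (d%:R^-1) <= 2 * 2 ^+ level N :> R.
Proof.
move=> N0; have := trunc_log_ltn N base_gt1; rewrite -/(level N) -expnM mulnC expnM => /ltnW h.
have dr : d%:R != 0 :> R by rewrite pnatr_eq0 -lt0n.
have -> : 2 * 2 ^+ level N = (((2 ^ (level N).+1) ^ d)%:R : R) `^ d%:R^-1.
  by rewrite natrX -(powR_mulrn d) ?ler0n// -powRrM divff// powRr1// natrX exprS.
by rewrite ge0_ler_powR ?nnegrE ?invr_ge0// ler_nat.
Qed.

Let last_term N : (0 < N)%N -> side R (level N) `^ beta <= 4 `^ beta * N%:R `^ (- (beta / d%:R)).
Proof.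
move=> N0; have N0r : 0 < N%:R :> R by rewrite ltr0n.
have y0 : 0 < N%:R `^ (d%:R^-1) :> R by rewrite powR_gt0.
have p0 : 0 < 2 ^+ level N :> R by rewrite exprn_gt0.
have -> : N%:R `^ (- (beta / d%:R)) = ((N%:R `^ (d%:R^-1))^-1) `^ beta.
  by rewrite -powRN -powRrM; congr (_ `^ _); ring.
rewrite -powRM ?invr_ge0 ?(ltW y0)// ge0_ler_powR ?(ltW beta_gt0) ?nnegrE ?(ltW (side_gt0 _ _))//.
rewrite /side ler_pdivrMr// mulrAC ler_pdivlMr//; have := level_ge N0; lra.
Qed.

Let N_ge N : (2 <= N)%N -> 1 <= ln N%:R / ln 2 :> R.
Proof.
move=> N2; rewrite ler_pdivlMr ?ln_gt0 ?ltr1n// mul1r ler_ln ?posrE ?ltr0n ?ler_nat//.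
exact: ltnW.
Qed.

(** The scale [J] at which the cells number about [N] balances the two errors;
    the three cases are those of the geometric series of ratio
    [2 `^ (d / 2 - beta)]. *)
Lemma rate_bound : exists2 C : R, 0 < C & forall N, (2 <= N)%N ->
  let J := trunc_log (2 ^ d) N in
  side R J `^ beta + \sum_(l < J.+1) side R l `^ beta * Num.sqrt (((2 ^ l) ^ d)%:R / N%:R)
    <= C * rate d beta N.
Proof.
have d0 : 0 < d%:R :> R by rewrite ltr0n.
have p4 : 0 < 4 `^ beta :> R by rewrite powR_gt0.
have p2 : 0 < 2 `^ beta :> R by rewrite powR_gt0.
have ln2 : 0 < ln 2 :> R by rewrite ln_gt0// ltr1n.
have sumE N : (2 <= N)%N ->
  \sum_(l < (level N).+1) side R l `^ beta * Num.sqrt (((2 ^ l) ^ d)%:R / N%:R) =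
  2 `^ beta * N%:R `^ (- (1 / 2)) * \sum_(l < (level N).+1) rho ^+ l.
  by move=> N2; rewrite mulr_sumr; apply: eq_bigr => l _; rewrite term// ltnW.
have rho0 : 0 < rho by rewrite powR_gt0.
have [lt2|ge2] := ltP d%:R (2 * beta); [|have [eq2|ne2] := eqVneq d%:R (2 * beta)].
- have rho1 : rho < 1.
    rewrite /rho -[ltRHS](powRr0 2) lt_neqAle; apply/andP; split.
      rewrite powRr0 powR_eq1 !negb_or; apply/and3P; split; [|by rewrite -leNgt|];
      by rewrite ?(eqr_nat R 2 1)//; apply/eqP; lra.
    by apply: ler_powR; [rewrite ler1n|lra].
  exists (4 `^ beta + 2 `^ beta / (1 - rho)).
    by rewrite addr_gt0// divr_gt0// subr_gt0.
  move=> N N2 /=; rewrite sumE// /rate lt2 mulrDl.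
  have N0r : 0 < N%:R :> R by rewrite ltr0n ltnW.
  apply: lerD.
    apply: le_trans (last_term (ltnW N2)) _; rewrite ler_wpM2l ?(ltW p4)//.
    apply: ler_powR; first by rewrite ler1n ltnW.
    by rewrite lerN2 ler_pdivlMr//; lra.
  rewrite [leRHS]mulrAC ler_wpM2l ?mulr_ge0 ?powR_ge0//.
  have n1 : rho - 1 != 0 by rewrite subr_eq0 lt_eqF.
  have n2 : 1 - rho != 0 by rewrite subr_eq0 gt_eqF.
  rewrite geometric ?lt_eqF// [leLHS](_ : _ = (1 - rho ^+ (level N).+1) / (1 - rho)); last first.
    by field; rewrite n1 n2.
  rewrite -[leRHS]mul1r.
  by rewrite ler_wpM2r ?invr_ge0 ?subr_ge0 ?(ltW rho1)// gerBl exprn_ge0// ltW.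
- have rho1 : rho = 1 by rewrite /rho eq2 (_ : _ - _ = 0) ?powRr0//; field.
  exists ((4 `^ beta + 2 `^ beta * 2) / ln 2).
    by rewrite divr_gt0// addr_gt0// mulr_gt0.
  move=> N N2 /=; rewrite sumE// /rate ltNge ge2/= eq2 eqxx rho1.
  have N0r : 0 < N%:R :> R by rewrite ltr0n ltnW.
  have n0 : 0 <= N%:R `^ (- (1 / 2)) :> R by exact: powR_ge0.
  have lN := N_ge N2.
  rewrite [leRHS](_ : _ = 4 `^ beta * (N%:R `^ (- (1 / 2)) * (ln N%:R / ln 2)) +
    2 `^ beta * N%:R `^ (- (1 / 2)) * (2 * (ln N%:R / ln 2))); last by field; rewrite gt_eqF.
  apply: lerD.
    apply: le_trans (last_term (ltnW N2)) _; rewrite ler_wpM2l ?(ltW p4)//.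
    rewrite (_ : beta / d%:R = 1 / 2); last by rewrite eq2; field; rewrite gt_eqF.
    by rewrite ler_peMr.
  rewrite ler_wpM2l ?mulr_ge0 ?(ltW p2)//.
  under eq_bigr do rewrite expr1n.
  rewrite sumr_const card_ord -[_ *+ _]mulr_natl mulr1 -natr1 mulr_natl mulr2n lerD//.
  rewrite ler_pdivlMr// mulrC mulr_natr -lnXn// ler_ln ?posrE ?exprn_gt0//.
  have := trunc_logP base_gt1 (ltnW N2); rewrite -/(level N) => h.
  by rewrite -natrX ler_nat (leq_trans _ h)// -expnM leq_exp2l// leq_pmull.
- have lt2 : 2 * beta < d%:R by rewrite lt_neqAle eq_sym ne2.
  have rho1 : 1 < rho.
    rewrite /rho -[ltLHS](powRr0 2) lt_neqAle; apply/andP; split.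
      rewrite powRr0 eq_sym powR_eq1 !negb_or; apply/and3P; split; [|by rewrite -leNgt|];
      by rewrite ?(eqr_nat R 2 1)//; apply/eqP; lra.
    by apply: ler_powR; [rewrite ler1n|lra].
  have rm : 0 < rho - 1 by rewrite subr_gt0.
  exists (4 `^ beta + 2 `^ beta * (rho / (rho - 1))).
    by rewrite addr_gt0// mulr_gt0// divr_gt0.
  move=> N N2 /=; rewrite sumE// /rate ltNge ge2/= (negPf ne2) mulrDl.
  have N0r : 0 < N%:R :> R by rewrite ltr0n ltnW.
  apply: lerD; first exact: last_term (ltnW N2).
  rewrite -mulrA -[leRHS]mulrA ler_wpM2l ?(ltW p2)//.
  rewrite geometric ?gt_eqF//.
  apply: (@le_trans _ _ (N%:R `^ (- (1 / 2)) * (rho ^+ (level N).+1 / (rho - 1)))).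
    by rewrite ler_wpM2l ?powR_ge0// ler_wpM2r ?invr_ge0 ?(ltW rm)// lerBlDr lerDl.
  rewrite [leLHS](_ : _ = rho / (rho - 1) * (N%:R `^ (- (1 / 2)) * rho ^+ level N)); last first.
    by rewrite exprS; ring.
  rewrite ler_wpM2l ?divr_ge0 ?(ltW rm) ?(ltW rho0)//.
  have -> : rho ^+ level N = (2 ^+ level N) `^ (d%:R / 2 - beta).
    by rewrite /rho -powR_mulrn ?powR_ge0// -powRrM mulrC powRrM powR_mulrn.
  apply: (@le_trans _ _ (N%:R `^ (- (1 / 2)) * (N%:R `^ (d%:R^-1)) `^ (d%:R / 2 - beta))).
    rewrite ler_wpM2l ?powR_ge0// ge0_ler_powR ?nnegrE ?powR_ge0 ?exprn_ge0//; first lra.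
    exact: level_le (ltnW N2).
  rewrite -powRrM -powRD; last by apply/implyP => _; rewrite gt_eqF.
  by rewrite le_eqVlt; apply/orP; left; apply/eqP; congr (_ `^ _); field; rewrite gt_eqF.
Qed.

End rates.

(** * Expected error of the empirical barycenter *)

Section domination.
Import HBNNSimple.

(** The integral of a nonnegative function is a supremum over the simple functions
    below it, so domination bounds it also when [f] is not measurable. *)
Lemma integral_le_ae dO (O : measurableType dO) (R : realType) (P : probability O R)
    (f : O -> \bar R) (G : O -> R) : bm G -> (forall w, 0 <= G w) ->
  {ae P, forall w, (f w <= (G w)%:E)%E} ->
  (\int[P]_w f w <= (\int[P]_w G w)%:E)%E.
Proof.
move=> bG G0 fG; rewrite intE//.
have pos_le : (\int[P]_w (f^\+ w) <= \int[P]_w (G w)%:E)%E.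
  rewrite ge0_integralTE//.
  apply: ge_ereal_sup => _ [h /= hf <-].
  rewrite -integralT_nnsfun; apply: ae_ge0_le_integral => //.
  - by move=> w _; rewrite lee_fin.
  - exact/measurable_EFinP.
  - by move=> w _; rewrite lee_fin.
  - by apply/measurable_EFinP; case: bG.
  apply: filterS fG => w fw _; apply: le_trans (hf w) _.
  by rewrite funeposE ge_max fw lee_fin G0.
apply: le_trans pos_le; rewrite [leLHS]integralE.
by rewrite -[leRHS]sube0 leeB// integral_ge0.
Qed.

End domination.

Section assembly.
Context (R : realType) (m d : nat) (alpha : 'I_m -> R) (eps : R).
Hypothesis m_gt0 : (0 < m)%N.
Hypothesis d_gt0 : (0 < d)%N.
Hypothesis alpha_ge0 : forall j, 0 <= alpha j.
Hypothesis alpha1 : \sum_(j < m) alpha j = 1.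
Hypothesis eps0 : 0 < eps.
Local Notation V := 'rV[R]_d.
Local Notation cube := (@cube R d).

Let card_cells l n : #|{: dyadic_index d l * {ffun 'I_d -> 'I_n.+1}}| =
  ((2 ^ l) ^ d * n.+1 ^ d)%N.
Proof. by rewrite card_prod !card_ffun !card_ord. Qed.

Let rc := rate_const m d eps.

Let rc0 : 0 < rc. Proof. exact: rate_const_gt0. Qed.

Lemma MSB_of_cube (mu : 'I_m -> probability V R) : (forall j, mu j cube = 1%E) ->
  MSB alpha eps mu cube = 1%E.
Proof.
move=> mu1; have [p ap sp] := schroedinger_system_solvable mu (kernel_bound_ge0 m d eps0)
  (measurable_gibbs_kernel alpha eps) (gibbs_kernel_ge alpha eps0) (gibbs_kernel_le alpha eps0).
exact: (MSB_cube alpha_ge0 alpha1 eps0 mu1 ap sp m_gt0).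
Qed.

Section sampled.
Variable nu : 'I_m -> probability V R.
Hypothesis nu1 : forall j, nu j cube = 1%E.
Context dO (O : measurableType dO) (P : probability O R) (N : nat).
Variable X : 'I_m -> 'I_N -> {RV P >-> V}.
Hypothesis N2 : (2 <= N)%N.
Hypothesis iX : independent_samples nu X.

Let bary := MSB alpha eps nu.
Let ebary w := MSB alpha eps (emp X w).

Let bary_cube : bary cube = 1%E. Proof. exact: MSB_of_cube. Qed.

Let ebary_cube w : in_cube X w -> ebary w cube = 1%E.
Proof. by move=> Xw; apply: MSB_of_cube => j; exact: emp_cube. Qed.

Let sqrt_split n l : Num.sqrt (((2 ^ l) ^ d * n.+1 ^ d)%N%:R / N%:R) =
  Num.sqrt (n.+1 ^ d)%:R * Num.sqrt (((2 ^ l) ^ d)%:R / N%:R) :> R.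
Proof. by rewrite -sqrtrM// natrM; congr Num.sqrt; ring. Qed.

Let level_deviation n l : exists G : O -> R, [/\ bm G, forall w, 0 <= G w,
    forall w, in_cube X w -> \sum_(qk : dyadic_index d l * {ffun 'I_d -> 'I_n.+1})
      `|\int[bary]_x cell_weight qk x - \int[ebary w]_x cell_weight qk x| <= G w &
    \int[P]_w G w <= rc * lebesgue R n ^+ d * Num.sqrt (n.+1 ^ d)%:R *
      Num.sqrt (((2 ^ l) ^ d)%:R / N%:R)].
Proof.
have [||||G [bG G0 GX GP]] := @family_deviation R m d alpha eps m_gt0 alpha_ge0 alpha1 eps0 nu nu1
  dO O P N X N2 iX (dyadic_index d l * {ffun 'I_d -> 'I_n.+1})%type (@cell_weight R d n l)
  (lebesgue R n ^+ d).
- by rewrite card_cells muln_gt0 !expn_gt0.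
- by rewrite exprn_gt0// (lt_le_trans ltr01)// lebesgue_ge1.
- exact: bm_cell_weight.
- exact: sum_norm_cell_weight.
by exists G; split => //; rewrite -[leRHS]mulrA -sqrt_split -card_cells.
Qed.

(** The same random bounds [G l] serve all [h] at once, so the supremum can be
    taken before the expectation. *)
Lemma expected_hoelder_deviation (beta C : R) : 0 < beta ->
  (forall M, (2 <= M)%N -> let J := trunc_log (2 ^ d) M in
    side R J `^ beta + \sum_(l < J.+1) side R l `^ beta * Num.sqrt (((2 ^ l) ^ d)%:R / M%:R)
      <= C * rate d beta M) ->
  forall L : R, 0 < L ->
  (\int[P]_w ereal_sup
       [set `| \int[bary]_(x in cube) h x - \int[ebary w]_(x in cube) h x |%R%:E
       | h in hoelder_class cube beta L]
     <= (2 * multiscale_const d beta * (1 + rc * lebesgue R (strict_floor beta) ^+ d *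
         Num.sqrt ((strict_floor beta).+1 ^ d)%:R) * C * L * rate d beta N)%:E)%E.
Proof.
move=> beta0 CP L L0; set n := strict_floor beta; set J := trunc_log (2 ^ d) N.
set A := rc * _ * _.
have A0 : 0 <= A.
  rewrite !mulr_ge0 ?sqrtr_ge0 ?(ltW rc0)// exprn_ge0// (le_trans ler01)//.
  exact: lebesgue_ge1.
have [G hG] := choice (level_deviation n).
have K0 : 0 < multiscale_const d beta by exact: multiscale_const_gt0.
set K := multiscale_const d beta in K0 *.
pose F w := 2 * K * L * (side R J `^ beta + \sum_(l < J.+1) side R l `^ beta * G l w).
have bG l : bm (G l) by have [] := hG l.
have G0 l w : 0 <= G l w by have [_ ->] := hG l.
have bS : bm (fun w => \sum_(l < J.+1) side R l `^ beta * G l w).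
  by apply: bm_sum => l; exact: bmZ.
have bF : bm F by apply: bmZ; apply: bmD => //; exact: bm_cst.
have K20 : 0 <= 2 * K * L by rewrite mulr_ge0 ?(ltW L0)// mulr_ge0// ltW.
have F0 w : 0 <= F w.
  rewrite mulr_ge0// addr_ge0 ?powR_ge0// sumr_ge0// => l _.
  by rewrite mulr_ge0 ?powR_ge0.
apply: (le_trans (integral_le_ae bF F0 _)).
  apply: filterS (ae_in_cube nu1 iX) => w Xw; apply: ge_ereal_sup => _ [h hh <-].
  rewrite lee_fin; apply: le_trans (hoelder_multiscale d_gt0 beta0 hh _ _ J) _.
  rewrite ler_wpM2l// lerD2l; apply: ler_sum => l _; rewrite ler_wpM2l ?powR_ge0//.
  by have [_ _ GX _] := hG l; exact: GX.
rewrite lee_fin intZ; last by apply: bmD => //; exact: bm_cst.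
rewrite intD//; last exact: bm_cst.
rewrite int_cst int_sum; last by move=> l; exact: bmZ.
apply: (@le_trans _ _ (2 * K * L * (side R J `^ beta + A * \sum_(l < J.+1)
    side R l `^ beta * Num.sqrt (((2 ^ l) ^ d)%:R / N%:R)))).
  rewrite ler_wpM2l// lerD2l mulr_sumr; apply: ler_sum => l _; rewrite intZ//.
  rewrite mulrCA ler_wpM2l ?powR_ge0//.
  by have [_ _ _] := hG l.
set T := \sum_(l < J.+1) _.
have T0 : 0 <= T by apply: sumr_ge0 => l _; rewrite mulr_ge0 ?powR_ge0 ?sqrtr_ge0.
have s0 : 0 <= side R J `^ beta by exact: powR_ge0.
apply: (@le_trans _ _ (2 * K * L * ((1 + A) * (side R J `^ beta + T)))).
  rewrite ler_wpM2l//; have := mulr_ge0 A0 s0; have := T0; nra.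
have KA : 0 <= 2 * K * L * (1 + A) by rewrite mulr_ge0// addr_ge0.
rewrite mulrA; apply: le_trans (ler_wpM2l KA (CP N N2)) _.
by rewrite le_eqVlt; apply/orP; left; apply/eqP; ring.
Qed.

(** Here the test functions are the indicators of the cells. A cell of level [k]
    is compared with the masses of level [k.+1], which costs a factor 2 in the
    side. *)
Lemma expected_wasserstein (p : nat) (C : R) :
  (forall M, (2 <= M)%N -> let J := trunc_log (2 ^ d) M in
    side R J `^ p%:R + \sum_(l < J.+1) side R l `^ p%:R * Num.sqrt (((2 ^ l) ^ d)%:R / M%:R)
      <= C * rate d p%:R M) ->
  (\int[P]_w wasserstein_pow p bary (ebary w)
     <= ((4 * d%:R) ^+ p * (1 + rc) * C * rate d p%:R N)%:E)%E.
Proof.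
move=> CP; set J := trunc_log (2 ^ d) N.
have cells_sum l (x : V) : \sum_(q : dyadic_index d l) `|\1_(cell_set q) x : R| <= 1.
  rewrite (bigD1 (cell l x))//= big1 ?addr0.
    by rewrite indicE; case: (_ \in _); rewrite ?normr1 ?normr0.
  by move=> q qx; rewrite indic_cell_set eq_sym (negPf qx) mulr0 normr0.
have hG l : exists G : O -> R, [/\ bm G, forall w, 0 <= G w,
    forall w, in_cube X w -> \sum_(q : dyadic_index d l)
      `|\int[bary]_x (\1_(cell_set q) x : R) - \int[ebary w]_x (\1_(cell_set q) x : R)| <= G w &
    \int[P]_w G w <= rc * Num.sqrt (((2 ^ l) ^ d)%:R / N%:R)].
  have [||||G [bG G0 GX GP]] := @family_deviation R m d alpha eps m_gt0 alpha_ge0 alpha1 eps0 nu nu1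
    dO O P N X N2 iX (dyadic_index d l) (fun q x => \1_(cell_set q) x) 1.
  - by rewrite card_ffun !card_ord !expn_gt0.
  - exact: ltr01.
  - by move=> q; apply: bm_indic; exact: measurable_cell_set.
  - exact: cells_sum.
  exists G; split => //; move: GP; rewrite mulr1 card_ffun !card_ord.
  by [].
have {hG} [G hG] := choice hG.
have bG l : bm (G l) by have [] := hG l.
have G0 l w : 0 <= G l w by have [_ ->] := hG l.
pose D l : R := (2 * d%:R * side R l) ^+ p.
have D0 l : 0 <= D l by rewrite exprn_ge0// mulr_ge0 ?(ltW (side_gt0 _ _))// mulr_ge0.
pose F w := D J + \sum_(k < J) D k * G k.+1 w.
have bS : bm (fun w => \sum_(k < J) D k * G k.+1 w) by apply: bm_sum => k; exact: bmZ.
have bF : bm F by apply: bmD => //; exact: bm_cst.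
have F0 w : 0 <= F w by rewrite addr_ge0// sumr_ge0// => k _; exact: mulr_ge0.
apply: (le_trans (integral_le_ae bF F0 _)).
  apply: filterS (ae_in_cube nu1 iX) => w Xw.
  apply: le_trans (wasserstein_multiscale J p bary_cube (ebary_cube Xw)) _.
  rewrite lee_fin lerD2l; apply: ler_sum => k _; rewrite ler_wpM2l//; first exact: D0.
  by have [_ _ GX _] := hG k.+1; exact: GX.
rewrite lee_fin intD//; last exact: bm_cst.
rewrite int_cst int_sum; last by move=> l; exact: bmZ.
pose s l : R := Num.sqrt (((2 ^ l) ^ d)%:R / N%:R).
have DE l : D l = (4 * d%:R) ^+ p * side R l.+1 ^+ p.
  by rewrite /D -exprMn sideS; congr (_ ^+ _); field.
have DleE l : D l <= (4 * d%:R) ^+ p * side R l ^+ p.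
  have s0 := side_gt0 R l.
  rewrite /D -exprMn lerXn2r ?nnegrE ?mulr_ge0 ?(ltW s0)// ler_wpM2r ?(ltW s0)//.
  by rewrite ler_wpM2r// ler_nat.
have sum_le : \sum_(k < J) \int[P]_x (D k * G k.+1 x) <=
    (4 * d%:R) ^+ p * (rc * \sum_(l < J.+1) side R l `^ p%:R * s l).
  rewrite big_ord_recl mulrDr mulrDr; apply: ler_wpDl.
    by rewrite !mulr_ge0 ?exprn_ge0 ?mulr_ge0 ?powR_ge0 ?sqrtr_ge0// ltW.
  rewrite !mulr_sumr; apply: ler_sum => k _; rewrite intZ// DE -mulrA.
  rewrite ler_wpM2l ?exprn_ge0 ?mulr_ge0// powR_mulrn ?(ltW (side_gt0 _ _))//.
  rewrite mulrCA ler_wpM2l ?exprn_ge0 ?(ltW (side_gt0 _ _))//.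
  by have [_ _ _] := hG k.+1.
set T := \sum_(l < J.+1) _ in sum_le.
have T0 : 0 <= T by apply: sumr_ge0 => l _; rewrite mulr_ge0 ?powR_ge0 ?sqrtr_ge0.
have sJ0 : 0 <= side R J `^ p%:R by exact: powR_ge0.
have d40 : 0 <= (4 * d%:R) ^+ p :> R by rewrite exprn_ge0// mulr_ge0.
apply: (@le_trans _ _ ((4 * d%:R) ^+ p * ((1 + rc) * (side R J `^ p%:R + T)))).
  apply: le_trans (lerD (DleE J) sum_le) _.
  rewrite -mulrDr ler_wpM2l// powR_mulrn ?(ltW (side_gt0 _ _))//.
  have := mulr_ge0 (ltW rc0) (exprn_ge0 p (ltW (side_gt0 R J))); move: T0; nra.
have rc1 : 0 <= 1 + rc by rewrite addr_ge0// ltW.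
rewrite -!mulrA ler_wpM2l// ler_wpM2l//; exact: CP.
Qed.

End sampled.
End assembly.

Lemma support_cube (R : realType) d (Xs : set 'rV[R]_d) (nu : probability 'rV[R]_d R) :
  compact Xs -> Xs `<=` @cube R d -> nu Xs = 1%E -> nu (@cube R d) = 1%E.
Proof.
move=> cX Xc nX; have mc := @measurable_cube R d.
apply/eqP; rewrite eq_le probability_le1//= -nX le_measure ?inE//.
have oX : open (~` Xs).
  by apply: closed_openC; apply: compact_closed => //; exact: norm_hausdorff.
rewrite -[Xs]setCK; apply: measurableC; exact: sub_sigma_algebra.
Qed.

Theorem theorem5p5 (R : realType) (m d : nat) (eps : R) (alpha : 'I_m -> R)
    (hm : (2 <= m)%N) (hd : (1 <= d)%N) (heps : 0 < eps)
    (halpha : forall j, 0 <= alpha j) (halpha1 : \sum_(j < m) alpha j = 1) :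
  (forall beta : R, 0 < beta ->
    exists2 C : R, 0 < C &
    forall (L : R), 0 < L ->
    forall (Xs : 'I_m -> set 'rV[R]_d) (nu : 'I_m -> probability 'rV[R]_d R),
      (forall j, [/\ compact (Xs j), interior (Xs j) !=set0, Xs j `<=` @cube R d &
                     nu j (Xs j) = 1%E]) ->
    forall (dO : measure_display) (Omega : measurableType dO)
      (P : probability Omega R) (N : nat)
      (X : 'I_m -> 'I_N -> {RV P >-> 'rV[R]_d}),
      (2 <= N)%N -> independent_samples nu X ->
    (\int[P]_w ereal_sup
       [set `| \int[MSB alpha eps nu]_(x in @cube R d) h x
             - \int[MSB alpha eps (fun j => empirical R (fun k => X j k w))]_(x
                   in @cube R d) h x |%R%:E
       | h in hoelder_class (@cube R d) beta L]
     <= (C * L * rate d beta N)%:E)%E)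
  /\
  (exists2 C : R, 0 < C &
    forall p : nat, p = 1%N \/ p = 2%N ->
    forall (Xs : 'I_m -> set 'rV[R]_d) (nu : 'I_m -> probability 'rV[R]_d R),
      (forall j, [/\ compact (Xs j), interior (Xs j) !=set0, Xs j `<=` @cube R d &
                     nu j (Xs j) = 1%E]) ->
    forall (dO : measure_display) (Omega : measurableType dO)
      (P : probability Omega R) (N : nat)
      (X : 'I_m -> 'I_N -> {RV P >-> 'rV[R]_d}),
      (2 <= N)%N -> independent_samples nu X ->
    (\int[P]_w wasserstein_pow p (MSB alpha eps nu)
        (MSB alpha eps (fun j => empirical R (fun k => X j k w)))
     <= (C * rate d p%:R N)%:E)%E).
Proof.
have m0 : (0 < m)%N by exact: ltnW.
have rc0 : 0 < rate_const m d eps by exact: rate_const_gt0.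
split.
  move=> beta beta0; have [C C0 hC] := rate_bound hd beta0.
  exists (2 * multiscale_const d beta * (1 + rate_const m d eps * lebesgue R (strict_floor beta) ^+ d *
         Num.sqrt ((strict_floor beta).+1 ^ d)%:R) * C).
    have K0 : 0 < multiscale_const d beta by exact: multiscale_const_gt0.
    have leb0 : 0 <= lebesgue R (strict_floor beta) by rewrite (le_trans ler01)// lebesgue_ge1.
    apply: mulr_gt0 => //; apply: mulr_gt0; first exact: mulr_gt0.
    by rewrite ltr_pwDl// mulr_ge0 ?sqrtr_ge0// mulr_ge0 ?exprn_ge0// ltW.
  move=> L L0 Xs nu hX dO Omega P N X N2 iX.
  have nu1 j : nu j (@cube R d) = 1%E by have [? _ ? ?] := hX j; exact: (@support_cube _ _ (Xs j)).
  exact: (expected_hoelder_deviation m0 hd halpha halpha1 heps nu1 N2 iX beta0 hC L0).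
have [C1 C10 hC1] := rate_bound hd (ltr01 : 0 < 1%:R :> R).
have [C2 C20 hC2] := rate_bound hd (ltr0n _ 2 : 0 < 2%:R :> R).
pose B (p : nat) (C : R) := (4 * d%:R) ^+ p * (1 + rate_const m d eps) * C.
have B0 p C : 0 < C -> 0 < B p C.
  move=> C0; rewrite mulr_gt0// mulr_gt0 ?exprn_gt0 ?mulr_gt0 ?ltr0n//.
  by rewrite addr_gt0.
have rate_ge0 (q : nat) N : (2 <= N)%N -> 0 <= rate d q%:R N :> R.
  move=> N2; rewrite /rate; case: ifP => _; first exact: powR_ge0.
  case: ifP => _; last exact: powR_ge0.
  by rewrite mulr_ge0 ?powR_ge0// ln_ge0// ler1n ltnW.
exists (B 1%N C1 + B 2 C2); first by rewrite addr_gt0// B0.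
move=> p p12 Xs nu hX dO Omega P N X N2 iX.
have nu1 j : nu j (@cube R d) = 1%E by have [? _ ? ?] := hX j; exact: (@support_cube _ _ (Xs j)).
have r0 : 0 <= rate d p%:R N :> R by exact: rate_ge0.
case: p12 => pE; rewrite {}pE in r0 *.
  have h := expected_wasserstein m0 halpha halpha1 heps nu1 N2 iX (p := 1) hC1.
  by apply: (le_trans h); rewrite lee_fin ler_wpM2r// lerDl ltW// B0.
have h := expected_wasserstein m0 halpha halpha1 heps nu1 N2 iX (p := 2) hC2.
by apply: (le_trans h); rewrite lee_fin ler_wpM2r// lerDr ltW// B0.
Qed.
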